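(* Let $F$ be a totally real number field of degree $r$, $I\subset F$ a fractional ideal, $\nu:J_F\to\{0,1\}$ a multisign, and let $x\in F_{\mathbb{R}}/I$ be a torsion element. Then there exists a subgroup $U\subset O^{\times}_{F,+}$ of finite index with $x\in(F_{\mathbb{R}}/I)^U$; for such $U$ one has $g_I^{\nu}(x,\epsilon u)=g_I^{\nu}(x,u)$ for all $\epsilon\in U$, $u\in U_{\mathbb{R}}$, and $$\int_{U_{\mathbb{R}}/U}g^{\nu}_I(x,u)\,\mathrm{d}^{\times}u=\frac{2^{1-r}\Gamma(1/2)^r}{r\,\Gamma(r/2)}\lim_{\delta\to0^+}\sum_{n\in(I^{\ast}\setminus\{0\})/U}\mathrm{sgn}(n)^{\nu}\frac{e^{2\pi i\mathrm{Tr}(nx)}}{|N(n)|^{(r+\delta)/r}}.$$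
   Context: $J_F=\mathrm{Hom}(F,\mathbb{R})=\{\varsigma_1,\dots,\varsigma_r\}$, $F_{\mathbb{R}}=F\otimes\mathbb{R}\cong\mathbb{R}^r$ with the standard Euclidean norm $\|\cdot\|$; $\mathrm{Tr}$ and $N$ are the trace and norm of $F/\mathbb{Q}$ (extended to $F_{\mathbb{R}}$). $I^{\ast}=\{a\in F:\mathrm{Tr}(aI)\subset\mathbb{Z}\}$. $O^{\times}_{F,+}$ is the group of totally positive units. $U_{\mathbb{R}}=\{u=(u_1,\dots,u_r)\in\mathbb{R}_{>0}^r:\prod u_j=1\}$, acting on $F_{\mathbb{R}}$ coordinatewise, with $O^\times_{F,+}\subset U_{\mathbb{R}}$; $\mathrm{d}^{\times}u=\frac{du_1\cdots du_{r-1}}{u_1\cdots u_{r-1}}$. For $n\in F$, $\mathrm{sgn}(n)^{\nu}=\prod_{\varsigma\in J_F}\mathrm{sgn}(\varsigma(n))^{\nu(\varsigma)}$. The modified plectic Green function is $g^{\nu}_I(x,u)=\lim_{\eta\to0^+}\sum_{n\in I^{\ast}\setminus\{0\}}\mathrm{sgn}(n)^{\nu}\frac{e^{2\pi i\mathrm{Tr}(nx)}}{\|un\|^{r+\eta}}$ for $x\in F_{\mathbb{R}}/I$, $u\in U_{\mathbb{R}}$.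
   Formalization: The case where ν is identically 0 and x = 0 in F_R/I is excluded, since there the limits defining g and the right-hand side diverge; the integral over U_R/U is computed on the fundamental parallelepiped of any Z-basis of U. *)

(* Defs.v *)
From HB Require Import structures.
From mathcomp Require Import all_boot all_order all_algebra all_field.
From mathcomp Require Import all_classical all_reals all_analysis.

Set Implicit Arguments.
Unset Strict Implicit.
Unset Printing Implicit Defensive.

Import Order.TTheory GRing.Theory Num.Theory.
Import numFieldNormedType.Exports.
Local Open Scope classical_set_scope.
Local Open Scope ring_scope.

(* A totally real number field F of degree r is modelled by
   L : fieldExtType rat with \dim {:L} = r, together with an enumeration
   sigma : 'I_r -> {rmorphism L -> R} of r pairwise distinct real embeddings
   (so J_F = {sigma j}).  F_R = F (x) R is identified with 'I_r -> R via
   a |-> (sigma j a)_j. *)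

Section NF.
Variables (R : realType) (L : fieldExtType rat) (r : nat).
Variable sigma : 'I_r -> {rmorphism L -> R}.

Definition embF (a : L) : 'I_r -> R := fun j => sigma j a.

Definition TrR (y : 'I_r -> R) : R := \sum_(j < r) y j.
Definition NR (y : 'I_r -> R) : R := \prod_(j < r) y j.

Definition eucl_norm (y : 'I_r -> R) : R := Num.sqrt (\sum_(j < r) y j ^+ 2).

Definition is_int (t : R) : Prop := exists z : int, t = z%:~R.

Definition integral (a : L) : Prop :=
  exists p : {poly int}, p \is monic /\ root (map_poly (fun z : int => z%:~R) p) a.

Definition frac_ideal (I : set L) : Prop :=
  [/\ exists a, I a /\ a != 0,
      I 0,
      (forall a b, I a -> I b -> I (a - b)),
      (forall c a, integral c -> I a -> I (c * a)) &
      exists d, [/\ d != 0, integral d & forall a, I a -> integral (d * a)]].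

Definition dual (I : set L) : set L :=
  fun a => forall b, I b -> is_int (TrR (embF (a * b))).

Definition tot_pos_unit (e : L) : Prop :=
  [/\ e != 0, integral e, integral e^-1 & forall j, 0 < sigma j e].

Definition fin_index_subgroup (U : set L) : Prop :=
  [/\ (forall e, U e -> tot_pos_unit e),
      U 1,
      (forall e f, U e -> U f -> U (e * f)),
      (forall e, U e -> U e^-1) &
      exists s : seq L, forall e, tot_pos_unit e ->
        exists2 t, t \in s & exists2 u, U u & e = t * u].

Definition congr_mod (I : set L) (y z : 'I_r -> R) : Prop :=
  exists2 b, I b & forall j, y j - z j = sigma j b.

Definition torsion (I : set L) (x : 'I_r -> R) : Prop :=
  exists2 m : nat, (0 < m)%N & congr_mod I (fun j => m%:R * x j) (fun=> 0).

Definition actF (e : L) (y : 'I_r -> R) : 'I_r -> R := fun j => sigma j e * y j.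
Definition actR (u y : 'I_r -> R) : 'I_r -> R := fun j => u j * y j.

Definition fixed_by (I U : set L) (x : 'I_r -> R) : Prop :=
  forall e, U e -> congr_mod I (actF e x) x.

Definition inUR (u : 'I_r -> R) : Prop := (forall j, 0 < u j) /\ NR u = 1.

Definition sgn_nu (nu : 'I_r -> bool) (n : L) : R :=
  \prod_(j < r | nu j) Num.sg (sigma j n).

Definition expi_part (im : bool) (t : R) : R := if im then sin t else cos t.

Definition abs_sum (T : choiceType) (S : set T) (f : T -> R) : R :=
  fine (\esum_(i in S) (Num.max (f i) 0)%:E) -
  fine (\esum_(i in S) (Num.max (- f i) 0)%:E).

Definition green_part (im : bool) (I : set L) (nu : 'I_r -> bool)
    (x u : 'I_r -> R) : R :=
  lim (
     abs_sum (dual I `\ 0) (fun n =>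
       sgn_nu nu n * expi_part im (2 * pi * TrR (actF n x)) /
       eucl_norm (actR u (embF n)) `^ (r%:R + eta)) @[eta --> 0^'+]).

Definition zeta_part (im : bool) (S : set L) (nu : 'I_r -> bool)
    (x : 'I_r -> R) : R :=
  lim (
     abs_sum S (fun n =>
       sgn_nu nu n * expi_part im (2 * pi * TrR (actF n x)) /
       `|NR (embF n)| `^ ((r%:R + delta) / r%:R)) @[delta --> 0^'+]).

Definition orbit_reps (I U S : set L) : Prop :=
  S `<=` dual I `\ 0 /\
  forall n, (dual I `\ 0) n ->
    exists2 s, S s /\ (exists2 e, U e & n = e * s) &
      forall s', S s' -> (exists2 e, U e & n = e * s') -> s' = s.

(* eps is a Z-basis of the (free abelian, rank r-1) group U *)
Definition unit_basis (U : set L) (eps : 'I_r.-1 -> L) : Prop :=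
  (forall k, U (eps k)) /\
  forall e, U e -> exists! m : 'I_r.-1 -> int, e = \prod_(k < r.-1) eps k ^ m k.

Definition UR_point (eps : 'I_r.-1 -> L) (t : seq R) : 'I_r -> R :=
  fun j => \prod_(k < r.-1) (sigma j (eps k)) `^ (nth 0 t k).

Definition regulator (eps : 'I_r.-1 -> L) : R :=
  `| \det (\matrix_(j < r.-1, k < r.-1)
           ln (sigma (widen_ord (leq_pred r) j) (eps k))) |.

End NF.

Fixpoint cube_integral (R : realType) (n : nat) (F : seq R -> R) : R :=
  match n with
  | 0 => F [::]
  | n'.+1 => Rintegral (@lebesgue_measure R) `[0%R, 1%R]
               (fun t => cube_integral n' (fun s => F (t :: s)))
  end.

(* integral over U_R/U w.r.t. d^x u = du_1...du_{r-1}/(u_1...u_{r-1}),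
   computed on the fundamental parallelepiped {prod_k eps_k^{t_k} : t ∈ [0,1)^{r-1}}
   in logarithmic coordinates (Jacobian = regulator). *)
Definition quot_integral (R : realType) (L : fieldExtType rat) (r : nat)
    (sigma : 'I_r -> {rmorphism L -> R}) (eps : 'I_r.-1 -> L)
    (f : ('I_r -> R) -> R) : R :=
  regulator sigma eps * cube_integral r.-1 (fun t => f (UR_point sigma eps t)).

Definition Gamma (R : realType) (s : R) : R :=
  Rintegral (@lebesgue_measure R) `]0%R, +oo[ (fun t => t `^ (s - 1) * expR (- t)).

(* Main.v *)
Require Import Defs.
From HB Require Import structures.
From mathcomp Require Import all_boot all_order all_algebra all_field.
From mathcomp Require Import all_classical all_reals all_analysis.
From mathcomp Require Import measurable_realfun ring lra zify.
Import Order.TTheory GRing.Theory Num.Theory.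
Import numFieldNormedType.Exports.
Local Open Scope classical_set_scope.
Local Open Scope ring_scope.

Set Implicit Arguments.
Unset Strict Implicit.
Unset Printing Implicit Defensive.

(** Write [Lambda] for the dual lattice without [0] and [r] for the degree.  The
    lattice [Lambda] splits into finitely many cosets on which the additive
    character is constant, and on each coset the sum of
    [sgn^nu(n) ||u n||^(-r-eta)] differs from the corresponding integral by a
    series that converges uniformly for [0 <= eta <= 1] and [u] in a compact
    set: the summand varies little on a cell unless the cell meets a coordinate
    hyperplane.  The integrals, which diverge as [eta -> 0], cancel: by
    reflection if [nu <> 0], and otherwise because the sum of the nontrivial
    character [n |-> e(Tr(n x))] over the cosets vanishes (this uses [I** = I]).
    Hence [g(x, u)] exists and is a bounded limit on compact sets of [u].

    For [eta > 0] the integral over [U_R / U] of the absolutely convergent sum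
    over [Lambda] unfolds to a sum over [Lambda / U] of integrals over [U_R]; in
    logarithmic coordinates each of these is [|N n|^(-(r+eta)/r)] times a product
    of Gamma integrals depending only on [eta].  Dominated convergence and the
    continuity of Gamma then give the identity, and the existence of the limit
    on the zeta side along with it. *)

(** * Iterated integrals and linear changes of variables *)

Section affine_invariance.
Variable R : realType.
Local Notation mu := (@lebesgue_measure R).
Local Open Scope ereal_scope.


(** At [eta = 0] the series is in general not absolutely convergent, whereas interchanging sums and
    integrals rests on Tonelli for nonnegative functions. Signs and character are therefore split
    into positive and negative parts. Each part may blow up as [eta] tends to [0], so the estimates
    concern the difference between a lattice sum and its integral, cell by cell. In the case
    excluded by [hdeg0], [nu = 0] and [x] in [I], all terms are positive and the series tends to
    infinity.

    No Z-basis of the dual lattice is constructed: it is enclosed between the span of a family [w]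
    and [1/D] times that span, hence the denominators [D] in the cosets. The integral over [U_R / U]
    is given as an iterated integral, so multidimensional integration is developed in iterated form,
    up to linear changes of variables.

    The constant is the value at [s = r] of a Mellin integral. The regulator cancels against the
    Jacobian of the logarithmic coordinates, which is nonzero by a pigeonhole argument on units. *)

Lemma measurable_affine (a b : R) :
  measurable_fun setT ((fun t => a * t + b)%R : measurableTypeR R -> measurableTypeR R).
Proof.
by apply: measurable_funD => //; apply: measurable_funM.
Qed.

(** Lebesgue measure is determined by its values on half-open intervals, so only these are computed.
    For [a < 0] the preimage is closed on the left instead of the right, hence two cases. *)
Lemma lebesgue_measure_affine (a b : R) (A : set R) : a != 0%R -> measurable A ->
  `|a|%:E * mu ((fun t => a * t + b)%R @^-1` A) = mu A.
Proof.
move=> a0 mA.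
have na : (0 <= `|a|)%R by [].
pose phi := ((fun t => a * t + b)%R : measurableTypeR R -> measurableTypeR R).
have mphi : measurable_fun setT phi by exact: measurable_affine.
unshelve refine (@eq_trans _ _ (mscale (NngNum na) (pushforward mu phi) A) _ _ _); [exact: mphi|by []|].
apply/esym.
apply: lebesgue_measure_unique => //= {A mA}_ [[x y] _ <-] /=.
rewrite /mscale /=; change (pushforward mu phi) with (fun B => mu (phi @^-1` B)); cbv beta.
have [ap|an|a00] := ltgtP a 0%R; last by rewrite a00 eqxx in a0.
- have -> : phi @^-1` `]x, y]%classic =
    `[((y - b) / a)%R, ((x - b) / a)%R[%classic.
    apply/seteqP; split => t; rewrite /phi /= !in_itv/= => /andP[h1 h2]; apply/andP; split.
    - by rewrite ler_ndivrMr// mulrC; lra.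
    - by rewrite ltr_ndivlMr// mulrC; lra.
    - by move: h2; rewrite ltr_ndivlMr// mulrC; lra.
    - by move: h1; rewrite ler_ndivrMr// mulrC; lra.
  rewrite !lebesgue_measure_itv/= !lte_fin ltr_nM2r ?invr_lt0// ltrD2r -!EFinB.
  case: ifP => _; last by rewrite mule0.
  by rewrite -EFinM ltr0_norm//; congr (_ %:E); field.
- have -> : phi @^-1` `]x, y]%classic =
    `]((x - b) / a)%R, ((y - b) / a)%R]%classic.
    apply/seteqP; split => t; rewrite /phi /= !in_itv/= => /andP[h1 h2]; apply/andP; split.
    - by rewrite ltr_pdivrMr// mulrC; lra.
    - by rewrite ler_pdivlMr// mulrC; lra.
    - by move: h1; rewrite ltr_pdivrMr// mulrC; lra.
    - by move: h2; rewrite ler_pdivlMr// mulrC; lra.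
  rewrite !lebesgue_measure_itv/= !lte_fin ltr_pM2r ?invr_gt0// ltrD2r -!EFinB.
  case: ifP => _; last by rewrite mule0.
  by rewrite -EFinM gtr0_norm//; congr (_ %:E); field.
Qed.

Lemma ge0_integral_affine (f : R -> \bar R) (a b : R) (A : set R) :
  a != 0%R -> measurable A -> measurable_fun [set: R] f -> (forall t, 0 <= f t) ->
  \int[mu]_(t in A) f t =
  `|a|%:E * \int[mu]_(t in (fun t => a * t + b)%R @^-1` A) f (a * t + b)%R.
Proof.
move=> a0 mA mf f0.
have na : (0 <= `|a|)%R by [].
pose phi := ((fun t => a * t + b)%R : measurableTypeR R -> measurableTypeR R).
have mphi : measurable_fun setT phi by exact: measurable_affine.
unshelve refine (@eq_trans _ _ (\int[mscale (NngNum na) (pushforward mu phi)]_(t in A) f t) _ _ _); [exact: mphi| |].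
  apply: eq_measure_integral => // B mB _; exact: (esym (lebesgue_measure_affine b a0 mB)).
rewrite ge0_integral_mscale//; last exact: measurable_funTS.
congr (_ * _).
rewrite (ge0_integral_pushforward mphi)//; exact: measurable_funTS.
Qed.

End affine_invariance.

(** * Iterated integrals of nonnegative functions of a column vector *)

Section iterated_integral.
Variable R : realType.
Local Notation mR := (measurableTypeR R).
Local Notation mu := (@lebesgue_measure R).
Local Open Scope ereal_scope.

Definition ccons n (t : R) (y : 'cV[R]_n) : 'cV[R]_n.+1 := col_mx (t%:M : 'M[R]_1) y.

Lemma cconsE0 n t (y : 'cV[R]_n) : ccons t y ord0 0%R = t.
Proof.
by rewrite /ccons mxE; case: splitP => // j _; rewrite ord1 mxE eqxx mulr1n.
Qed.

Lemma cconsES n t (y : 'cV[R]_n) i : ccons t y (lift ord0 i) 0%R = y i 0%R.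
Proof.
rewrite /ccons mxE; case: splitP => [j|j [ij]]; first by rewrite ord1.
by congr (y _ _); apply/val_inj.
Qed.

Definition vmeasurable d (Y : measurableType d) n (g : Y -> 'cV[R]_n) :=
  forall i, measurable_fun [set: Y] (fun y => g y i 0%R).

(** Measurability is tested by substituting measurable maps, coordinatewise in the vector argument.
    No sigma-algebra on column vectors is needed, and stability under [ccons] and matrices is
    immediate. *)
Definition jmeas d (X : measurableType d) n (f : X -> 'cV[R]_n -> \bar R) :=
  forall d' (Y : measurableType d') (p : Y -> X) (g : Y -> 'cV[R]_n),
    measurable_fun [set: Y] p -> vmeasurable g ->
    measurable_fun [set: Y] (fun y => f (p y) (g y)).

Definition cmeas n (f : 'cV[R]_n -> \bar R) :=
  forall d (Y : measurableType d) (g : Y -> 'cV[R]_n), vmeasurable g ->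
    measurable_fun [set: Y] (fun y => f (g y)).

Lemma vmeasurable_ccons d (Y : measurableType d) n (t : Y -> mR) (g : Y -> 'cV[R]_n) :
  measurable_fun [set: Y] t -> vmeasurable g -> vmeasurable (fun y => ccons (t y) (g y)).
Proof.
move=> mt mg i; case: (unliftP ord0 i) => [j|] ->.
  by under eq_fun do rewrite cconsES; exact: mg.
by under eq_fun do rewrite cconsE0.
Qed.

Lemma jmeas_ccons d (X : measurableType d) n (f : X -> 'cV[R]_n.+1 -> \bar R) :
  jmeas f -> jmeas (fun (z : X * mR) y => f z.1 (ccons z.2 y)).
Proof.
move=> jf d' Y p g mp mg; apply: jf.
  exact: (measurableT_comp measurable_fst mp).
by apply: vmeasurable_ccons => //; exact: (measurableT_comp measurable_snd mp).
Qed.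

Lemma cmeas_ccons n (f : 'cV[R]_n.+1 -> \bar R) :
  cmeas f -> jmeas (fun (t : mR) y => f (ccons t y)).
Proof. by move=> cf d' Y p g mp mg; apply: cf; apply: vmeasurable_ccons. Qed.

Lemma jmeas_cmeas d (X : measurableType d) n (f : X -> 'cV[R]_n -> \bar R) x :
  jmeas f -> cmeas (f x).
Proof. by move=> jf d' Y g mg; apply: (jf _ Y (fun=> x)). Qed.

Lemma jmeas_measurable d (X : measurableType d) n (f : X -> 'cV[R]_n -> \bar R) y :
  jmeas f -> measurable_fun setT (fun x => f x y).
Proof. by move=> jf; apply: (jf _ X id (fun=> y)) => // i; exact: measurable_cst. Qed.

Fixpoint iint (D : set R) n : ('cV[R]_n -> \bar R) -> \bar R :=
  match n with
  | 0 => fun f => f 0%R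
  | n'.+1 => fun f => \int[mu]_(t in D) iint D (fun y : 'cV[R]_n' => f (ccons t y))
  end.

Variables (D : set R) (mD : measurable D).

Lemma iint_ge0 n (f : 'cV[R]_n -> \bar R) : (forall y, 0 <= f y) -> 0 <= iint D f.
Proof.
by elim: n f => [|n IH] f f0 //=; apply: integral_ge0 => t _; exact: IH.
Qed.

Lemma eq_iint n (f g : 'cV[R]_n -> \bar R) :
  (forall y : 'cV[R]_n, (forall i, D (y i 0%R)) -> f y = g y) -> iint D f = iint D g.
Proof.
elim: n f g => [|n IH] f g fg /=; first by apply: fg => -[].
apply: eq_integral => t; rewrite inE => Dt; apply: IH => y Dy.
apply: fg => i; case: (unliftP ord0 i) => [j|] ->; by rewrite ?cconsES ?cconsE0.
Qed.

(** Extension by zero outside [D] reduces this to the Tonelli measurability theorem on the full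
    product. *)
Lemma measurable_integral_param d (X : measurableType d) (h : X * mR -> \bar R) :
  measurable_fun setT h -> (forall z, 0 <= h z) ->
  measurable_fun setT (fun x => \int[mu]_(t in D) h (x, t)).
Proof.
move=> mh h0.
have -> : (fun x => \int[mu]_(t in D) h (x, t)) =
  fubini_F mu (h \_ (setT `*` D)).
  apply/funext => x; rewrite /fubini_F [LHS]integral_mkcond; apply: eq_integral => t _.
  rewrite /patch; have [Dt|nDt] := pselect (D t); first by rewrite !mem_set.
  by rewrite !memNset// => -[].
apply: measurable_fun_fubini_tonelli_F.
  apply/(measurable_restrictT _ _).1; last exact: measurable_funTS.
  exact: measurableX.
by move=> z; rewrite /patch; case: ifP.
Qed.

Lemma jmeas_iint d (X : measurableType d) n (f : X -> 'cV[R]_n -> \bar R) :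
  jmeas f -> (forall x y, 0 <= f x y) -> measurable_fun setT (fun x => iint D (f x)).
Proof.
elim: n d X f => [|n IH] d X f jf f0 /=; first exact: jmeas_measurable.
apply: (@measurable_integral_param _ X (fun z => iint D (fun y => f z.1 (ccons z.2 y)))).
  by apply: (IH _ (X * mR)%type) => //; exact: jmeas_ccons.
by move=> z; exact: iint_ge0.
Qed.

Lemma cmeas_iint n (f : 'cV[R]_n.+1 -> \bar R) : cmeas f -> (forall y, 0 <= f y) ->
  measurable_fun setT (fun t : mR => iint D (fun y => f (ccons t y))).
Proof.
move=> cf f0.
by apply: (@jmeas_iint _ mR _ (fun t y => f (ccons t y))) => //; exact: cmeas_ccons.
Qed.

Lemma le_iint n (f g : 'cV[R]_n -> \bar R) : cmeas f -> cmeas g ->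
  (forall y, 0 <= f y) -> (forall y, 0 <= g y) ->
  (forall y : 'cV[R]_n, (forall i, D (y i 0%R)) -> f y <= g y) -> iint D f <= iint D g.
Proof.
elim: n f g => [|n IH] f g cf cg f0 g0 fg /=; first by apply: fg => -[].
apply: ge0_le_integral => //.
- by move=> t _; exact: iint_ge0.
- by apply: measurable_funTS; exact: cmeas_iint.
- by apply: measurable_funTS; exact: cmeas_iint.
- move=> t Dt; apply: IH => //; first exact: (jmeas_cmeas _ (cmeas_ccons cf)).
    exact: (jmeas_cmeas _ (cmeas_ccons cg)).
  by move=> y Dy; apply: fg => i; case: (unliftP ord0 i) => [j|] ->;
     rewrite ?cconsES ?cconsE0.
Qed.

Lemma iintZl n (f : 'cV[R]_n -> \bar R) (k : \bar R) : cmeas f ->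
  (forall y, 0 <= f y) -> 0 <= k -> iint D (fun y => k * f y) = k * iint D f.
Proof.
move=> + + k0; elim: n f => [|n IH] f cf f0 //=.
under eq_integral => t _ do rewrite (IH _ (jmeas_cmeas t (cmeas_ccons cf)))//.
rewrite ge0_integralZl//; first by apply: measurable_funTS; exact: cmeas_iint.
by move=> t _; exact: iint_ge0.
Qed.

Lemma cmeas_sum n (f : nat -> 'cV[R]_n -> \bar R) : (forall k, cmeas (f k)) ->
  (forall k y, 0 <= f k y) -> cmeas (fun y => \sum_(k <oo) f k y).
Proof.
move=> cf f0 d Y g mg; apply: ge0_emeasurable_sum => //.
by move=> k _; exact: cf.
Qed.

End iterated_integral.

(** * Tonelli, translations and linear substitutions *)

Section change_of_variables.
Variable R : realType.
Local Notation mR := (measurableTypeR R).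
Local Notation mu := (@lebesgue_measure R).
Local Open Scope ereal_scope.

Lemma tonelli_in (D E : set R) (h : mR * mR -> \bar R) : measurable D -> measurable E ->
  measurable_fun setT h -> (forall z, 0 <= h z) ->
  \int[mu]_(t in D) \int[mu]_(s in E) h (t, s) =
  \int[mu]_(s in E) \int[mu]_(t in D) h (t, s).
Proof.
move=> mD mE mh h0.
pose h' : mR * mR -> \bar R := h \_ (D `*` E).
have h'0 z : 0 <= h' z by rewrite /h' /patch; case: ifP.
have mh' : measurable_fun setT h'.
  by apply/(measurable_restrictT _ _).1; [exact: measurableX|exact: measurable_funTS].
have h'E t s : D t -> E s -> h' (t, s) = h (t, s) by move=> Dt Es; rewrite /h' /patch mem_set.
have h'nE t s : ~ (D t /\ E s) -> h' (t, s) = 0 by move=> n; rewrite /h' /patch memNset// => -[].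
transitivity (\int[mu]_t \int[mu]_s h' (t, s)).
  rewrite [LHS]integral_mkcond; apply: eq_integral => t _; rewrite /patch.
  have [Dt|nDt] := pselect (D t).
    rewrite mem_set// [LHS]integral_mkcond; apply: eq_integral => s _; rewrite /patch.
    have [Es|nEs] := pselect (E s); first by rewrite mem_set// h'E.
    by rewrite memNset// h'nE// => -[].
  by rewrite memNset// integral0_eq// => s _; rewrite h'nE// => -[].
rewrite (fubini_tonelli h')//.
rewrite [RHS]integral_mkcond; apply: eq_integral => s _; rewrite /patch.
have [Dt|nDt] := pselect (E s).
  rewrite mem_set// [RHS]integral_mkcond; apply: eq_integral => t _; rewrite /patch.
  have [Es|nEs] := pselect (D t); first by rewrite mem_set// h'E.
  by rewrite memNset// h'nE// => -[].
by rewrite memNset// integral0_eq// => t _; rewrite h'nE// => -[].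
Qed.

Lemma jmeas_ccons2 n (f : mR -> 'cV[R]_n.+1 -> \bar R) s :
  jmeas f -> jmeas (fun t y => f t (ccons s y)).
Proof.
move=> jf d Y p g mp mg; apply: jf => //.
by apply: vmeasurable_ccons.
Qed.

Lemma iint_swap (D E : set R) n (f : mR -> 'cV[R]_n -> \bar R) :
  measurable D -> measurable E -> jmeas f -> (forall t y, 0 <= f t y) ->
  \int[mu]_(t in D) iint E (f t) = iint E (fun y => \int[mu]_(t in D) f t y).
Proof.
move=> mD mE; elim: n f => [|n IH] f jf f0 //=.
rewrite (@tonelli_in D E (fun z => iint E (fun y => f z.1 (ccons z.2 y))))//.
- apply: eq_integral => s _; rewrite IH//; exact: jmeas_ccons2.
- apply: (@jmeas_iint _ _ mE _ (mR * mR)%type) => //.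
  exact: (@jmeas_ccons _ _ mR).
- by move=> z; exact: iint_ge0.
Qed.

Local Notation J := (iint setT).

Lemma vmeasurable_add d (Y : measurableType d) n (g h : Y -> 'cV[R]_n) :
  vmeasurable g -> vmeasurable h -> vmeasurable (fun y => g y + h y)%R.
Proof.
move=> mg mh i; under eq_fun do rewrite mxE.
exact: measurable_funD.
Qed.

Lemma vmeasurable_cst d (Y : measurableType d) n (c : 'cV[R]_n) :
  vmeasurable (fun _ : Y => c).
Proof. by move=> i; exact: measurable_cst. Qed.

Lemma measurable_sumR d (Y : measurableType d) (I : Type) (r : seq I) (P : pred I)
  (f : I -> Y -> R) : (forall i, P i -> measurable_fun setT (f i)) ->
  measurable_fun [set: Y] (fun y => \sum_(i <- r | P i) f i y)%R.
Proof.
move=> mf; elim: r => [|i r IH]; first by under eq_fun do rewrite big_nil; exact: measurable_cst.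
under eq_fun do rewrite big_cons.
case Pi: (P i) => //; apply: measurable_funD => //; exact: mf.
Qed.

Lemma measurable_prodR d (Y : measurableType d) (I : Type) (r : seq I) (P : pred I)
  (f : I -> Y -> R) : (forall i, P i -> measurable_fun setT (f i)) ->
  measurable_fun [set: Y] (fun y => \prod_(i <- r | P i) f i y)%R.
Proof.
move=> mf; elim: r => [|i r IH]; first by under eq_fun do rewrite big_nil; exact: measurable_cst.
under eq_fun do rewrite big_cons.
case Pi: (P i) => //; apply: measurable_funM => //; exact: mf.
Qed.

Lemma vmeasurable_mulmx d (Y : measurableType d) m n (A : 'M[R]_(m, n)) (g : Y -> 'cV[R]_n) :
  vmeasurable g -> vmeasurable (fun y => A *m g y)%R.
Proof.
move=> mg i; under eq_fun do rewrite mxE.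
by apply: measurable_sumR => j _; apply: measurable_funM.
Qed.

Lemma cmeas_affine m n (f : 'cV[R]_m -> \bar R) (A : 'M[R]_(m, n)) c :
  cmeas f -> cmeas (fun y => f (A *m y + c)%R).
Proof.
move=> cf d Y g mg; apply: cf; apply: vmeasurable_add; last exact: vmeasurable_cst.
exact: vmeasurable_mulmx.
Qed.

Lemma cmeas_shift n (f : 'cV[R]_n -> \bar R) c : cmeas f -> cmeas (fun y => f (y + c)%R).
Proof.
move=> cf d Y g mg; apply: cf; apply: vmeasurable_add => //; exact: vmeasurable_cst.
Qed.

Lemma cmeas_mul m n (f : 'cV[R]_m -> \bar R) (A : 'M[R]_(m, n)) :
  cmeas f -> cmeas (fun y => f (A *m y)%R).
Proof. by move=> cf d Y g mg; apply: cf; exact: vmeasurable_mulmx. Qed.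

Lemma integral_affineT (f : R -> \bar R) (a b : R) :
  a != 0%R -> measurable_fun [set: R] f -> (forall t, 0 <= f t) ->
  \int[mu]_t f (a * t + b)%R = `|a|^-1%:E * \int[mu]_t f t.
Proof.
move=> a0 mf f0; rewrite [X in _ = _ * X](@ge0_integral_affine _ f a b setT)//.
by rewrite muleA -EFinM mulVf ?normr_eq0// mul1e.
Qed.

Lemma integral_shiftT (f : R -> \bar R) (b : R) :
  measurable_fun [set: R] f -> (forall t, 0 <= f t) ->
  \int[mu]_t f (t + b)%R = \int[mu]_t f t.
Proof.
move=> mf f0; have := @integral_affineT f 1%R b (oner_neq0 _) mf f0.
by rewrite normr1 invr1 mul1e => <-; apply: eq_integral => t _; rewrite mul1r.
Qed.

Lemma ccons_usub n (c : 'cV[R]_n.+1) :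
  exists c1 c2, c = ccons c1 c2 :> 'cV[R]_n.+1.
Proof.
exists (c ord0 0%R), (\col_i c (lift ord0 i) 0%R).
apply/colP => i; case: (unliftP ord0 i) => [j|] ->; by rewrite ?cconsES ?cconsE0 ?mxE.
Qed.

Lemma ccons_add n (t s : R) (y z : 'cV[R]_n) :
  (ccons t y + ccons s z)%R = ccons (t + s) (y + z).
Proof.
apply/colP => i; case: (unliftP ord0 i) => [j|] ->;
 by rewrite mxE ?cconsES ?cconsE0 ?mxE.
Qed.

Lemma iint_shift n (f : 'cV[R]_n -> \bar R) c : cmeas f -> (forall y, 0 <= f y) ->
  J (fun y => f (y + c)%R) = J f.
Proof.
elim: n f c => [|n IH] f c cf f0 /=.
  by congr f; apply/colP => -[].
have [c1 [c2 ->]] := ccons_usub c.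
transitivity (\int[mu]_t J (fun y => f (ccons (t + c1) y))).
  apply: eq_integral => t _.
  under eq_fun do rewrite ccons_add.
  apply: (IH (fun y => f (ccons (t + c1)%R y))) => //.
  exact: (jmeas_cmeas _ (cmeas_ccons cf)).
apply: (@integral_shiftT (fun t => J (fun y => f (ccons t y)))).
  exact: cmeas_iint.
by move=> t; exact: iint_ge0.
Qed.

(* One Gauss pivoting step: with [w = a y1 + b y'] as new first variable, the
   remaining variables undergo the Schur complement of the pivot [a]. *)
Lemma iint_pivot n (f : 'cV[R]_n.+1 -> \bar R) (a : R) (b : 'rV[R]_n) (g : 'cV[R]_n)
  (S : 'M[R]_n) : a != 0%R -> cmeas f -> (forall y, 0 <= f y) ->
  \int[mu]_t J (fun y => f (ccons (a * t + (b *m y) 0%R 0%R)%R ((a * t + (b *m y) 0%R 0%R) *: g + S *m y)%R)) =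
  `|a|^-1%:E * \int[mu]_w J (fun y => f (ccons w (w *: g + S *m y)%R)).
Proof.
move=> a0 cf f0.
have mb d (Y : measurableType d) (h : Y -> 'cV[R]_n) : vmeasurable h ->
   measurable_fun setT (fun y => (b *m h y) 0%R 0%R)%R.
  by move=> mh; exact: (vmeasurable_mulmx b mh).
have key d (Y : measurableType d) (w : Y -> mR) (h : Y -> 'cV[R]_n) :
   measurable_fun setT w -> vmeasurable h ->
   measurable_fun setT (fun y => f (ccons (w y) (w y *: g + S *m h y)%R)).
  move=> mw mh; apply: cf; apply: vmeasurable_ccons => //.
  apply: vmeasurable_add; last exact: vmeasurable_mulmx.
  by move=> i; under eq_fun do rewrite mxE; apply: measurable_funM.
rewrite iint_swap//; last first.
  move=> d Y p h mp mh; apply: key => //.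
  by apply: measurable_funD; [apply: measurable_funM|exact: mb].
transitivity (J (fun y => `|a|^-1%:E * \int[mu]_w f (ccons w (w *: g + S *m y)%R))).
  apply: eq_iint => y _.
  apply: (@integral_affineT (fun w => f (ccons w (w *: g + S *m y)%R))) => //.
  by apply: (key _ mR id (fun=> y)) => //; exact: vmeasurable_cst.
rewrite iintZl//; last 2 first.
  move=> d Y h mh.
  apply: (@measurable_integral_param _ setT _ _ Y (fun z => f (ccons z.2 (z.2 *: g + S *m h z.1)%R))) => //.
  apply: (key _ (Y * mR)%type snd (fun z => h z.1)); first exact: measurable_snd.
  by move=> i; apply: (measurableT_comp (mh i)); exact: measurable_fst.
- by move=> y; exact: integral_ge0.
congr (_ * _).
rewrite -(@iint_swap setT setT n (fun w y => f (ccons w (w *: g + S *m y)%R)))//.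
Qed.

Lemma mulmx_ccons n (a : R) (b : 'rV[R]_n) (g : 'cV[R]_n) (S : 'M[R]_n) t (y : 'cV[R]_n) :
  (block_mx a%:M b g S *m ccons t y)%R =
  ccons (a * t + (b *m y) 0 0)%R (t *: g + S *m y)%R.
Proof.
rewrite /ccons mul_block_col; congr col_mx.
  by apply/matrixP => i j; rewrite !ord1 !mxE/= big_ord1 !mxE/= !mulr1n.
by rewrite mul_mx_scalar.
Qed.

Lemma det_pivot n (a : R) (b : 'rV[R]_n) (g : 'cV[R]_n) (S : 'M[R]_n) : a != 0%R ->
  (\det (block_mx a%:M b g S : 'M[R]_(1 + n)) = a * \det (S - a^-1 *: (g *m b)))%R.
Proof.
move=> a0.
have -> : block_mx a%:M b g S = block_mx 1%:M 0 (a^-1 *: g) 1%:M *m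
     block_mx a%:M b 0 (S - a^-1 *: (g *m b)) :> 'M[R]_(1 + n).
  rewrite mulmx_block !mul1mx !mul0mx !addr0 mul_mx_scalar scalerA.
  by rewrite mulfV// scale1r -scalemxAl addrC subrK.
by rewrite det_mulmx det_lblock det_ublock !det1 !mul1r det_scalar1.
Qed.

(** Gauss elimination: a nonzero corner entry splits off one variable, and the Schur complement has
    smaller size. The local claim [pivot] is stated for an arbitrary integrand so that it also
    covers the shear that repairs a zero corner. *)
Theorem iint_linear n (A : 'M[R]_n) (f : 'cV[R]_n -> \bar R) : (\det A)%R != 0%R ->
  cmeas f -> (forall y, 0 <= f y) ->
  J (fun y => f (A *m y)%R) = `|\det A|^-1%:E * J f.
Proof.
elim: n A f => [|n IH] A f detA cf f0.
  rewrite det_mx00 normr1 invr1 mul1e /=; congr f; apply/colP => -[] //.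
have block (B : 'M[R]_(1 + n)) : exists a b g S, B = block_mx (a%:M) b g S.
  exists (ulsubmx B 0%R 0%R), (ursubmx B), (dlsubmx B), (drsubmx B).
  by rewrite -[LHS]submxK; congr block_mx; apply/matrixP => i j; rewrite !ord1 !mxE eqxx mulr1n.
have pivot (a : R) b g S (h : 'cV[R]_n.+1 -> \bar R) : a != 0%R ->
    (\det (block_mx a%:M b g S : 'M[R]_(1 + n)))%R != 0%R -> cmeas h -> (forall y, 0 <= h y) ->
    J (fun y : 'cV[R]_n.+1 => h (block_mx a%:M b g S *m y)%R) =
    `|\det (block_mx a%:M b g S : 'M[R]_(1 + n))|^-1%:E * J h.
  move=> a0; rewrite det_pivot// mulf_eq0 negb_or => /andP[_ dS] ch h0 /=.
  set S' := (S - _)%R in dS *.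
  transitivity (\int[mu]_t J (fun y => h (ccons (a * t + (b *m y) 0%R 0%R)%R
     ((a * t + (b *m y) 0%R 0%R) *: (a^-1 *: g) + S' *m y)%R))).
    apply: eq_integral => t _; apply: eq_iint => y _; rewrite mulmx_ccons.
    congr (h (ccons _ _)).
    rewrite /S' mulmxBl -scalemxAl -mulmxA [X in (g *m X)%R]mx11_scalar mul_mx_scalar.
    move: ((b *m y) 0 0)%R (S *m y)%R => beta Sy.
    by apply/colP => k; rewrite !mxE; field.
  rewrite iint_pivot// normrM invfM EFinM -muleA; congr (_ * _).
  rewrite -ge0_integralZl//=; last 2 first.
  - exact: (cmeas_iint measurableT ch h0).
  - by move=> t _; exact: iint_ge0.
  apply: eq_integral => w _.
  have cw : cmeas (fun y => h (ccons w y)) by exact: (jmeas_cmeas _ (cmeas_ccons ch)).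
  rewrite -(@iint_shift _ (fun y => h (ccons w y)) (w *: (a^-1 *: g))%R)// -IH//.
    by apply: eq_iint => y _; rewrite addrC.
  exact: (cmeas_shift (w *: (a^-1 *: g))%R cw).
have [a [b [g [S AE]]]] := block A.
have [a0|a0] := eqVneq a 0%R; last first.
  by rewrite [in LHS]AE [in RHS]AE; apply: pivot => //; rewrite -AE.
have [i gi] : exists i, g i 0%R != 0%R.
  case: (pickP (fun i => g i 0%R != 0%R)) => [i gi|g0]; first by exists i.
  have {}g0 : g = 0%R.
    by apply/colP => i; rewrite mxE; have /negbFE/eqP := g0 i.
  move: detA; rewrite AE g0 (det_ublock (a%:M : 'M[R]_1)%R b S).
  by rewrite a0 det_scalar1 mul0r eqxx.
(* The shear adding row [i] to the first one creates the pivot [g i]. *)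
pose e : 'rV[R]_n := delta_mx 0%R i.
pose h (y : 'cV[R]_n.+1) := f (block_mx 1%:M (- e) 0 1%:M *m y)%R.
have ch : cmeas h by exact: cmeas_mul.
have Jh : J h = J f.
  have d1 : (\det (block_mx 1%:M (- e) 0 1%:M : 'M[R]_(1 + n)))%R = 1%R.
    by rewrite det_ublock !det1 mulr1.
  have := @pivot 1%R (- e)%R 0%R 1%:M%R f (oner_neq0 _).
  by rewrite d1 normr1 invr1 mul1e; apply => //; exact: oner_neq0.
pose B : 'M[R]_(1 + n) := (block_mx 1%:M e 0 1%:M *m A)%R.
have BE : B = block_mx (g i 0)%:M%R (b + e *m S)%R g S.
  rewrite /B AE a0 (mulmx_block 1%:M e 0 1%:M (0%:M : 'M[R]_1) b g S)%R.
  rewrite !mul1mx !mul0mx !add0r; congr block_mx.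
  apply/matrixP => j k; rewrite !ord1 !mxE eqxx !mulr1n add0r (bigD1 i)//=.
  rewrite !mxE !eqxx mul1r big1 ?addr0// => l li; rewrite !mxE eqxx (negbTE li) mul0r//.
have detB : (\det B = \det A)%R by rewrite /B det_mulmx det_ublock !det1 !mul1r.
have -> : J (fun y : 'cV[R]_n.+1 => f (A *m y)%R) = J (fun y : 'cV[R]_n.+1 => h (B *m y)%R).
  apply: eq_iint => y _; rewrite /h /B mulmxA mulmxA mulmx_block.
  rewrite !mul1mx !mul0mx !mulmx1 !addr0 !add0r subrr mulmx0 addr0.
  rewrite (_ : block_mx 1%:M 0 0 1%:M = 1%:M)%R ?mul1mx//.
  by rewrite -scalar_mx_block.
rewrite -detB -Jh; have := detA; rewrite -detB BE => dB. exact: (pivot _ _ _ _ h gi dB ch (fun y => f0 _)).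
Qed.

End change_of_variables.

(** * Countable sums and the tiling of space by integer cubes *)

Section countable_sums.
Variable R : realType.
Local Notation mR := (measurableTypeR R).
Local Notation mu := (@lebesgue_measure R).
Local Open Scope ereal_scope.

(** An injection into [nat] turns a countable sum into a series, the gaps ([None]) contributing [0].
    One enumeration serves every family [a], so it can be fixed before integrating or passing to the
    limit. *)
Lemma esum_enum (T : choiceType) (D : set T) (f : T -> nat) : set_inj D f ->
  exists2 g : nat -> option T, (forall k i, g k = Some i -> D i) &
  forall a : T -> \bar R, (forall i, 0 <= a i) ->
    \esum_(i in D) a i = \sum_(k <oo) oapp a 0 (g k).
Proof.
move=> injf.
pose P k i := D i /\ f i = k.
pose g k := if pselect (exists i, P k i) is left e then Some (projT1 (cid e)) else None.
have gP k i : g k = Some i -> P k i.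
  by rewrite /g; case: pselect => // e [<-]; exact: (projT2 (cid e)).
have gf i : D i -> g (f i) = Some i.
  move=> Di; rewrite /g; case: pselect => [e|[]]; last by exists i.
  have [Dj fj] := projT2 (cid e); congr Some.
  by apply: injf => //; rewrite inE.
exists g => [k i /gP[]//|a a0].
rewrite nneseries_esumT; last by move=> k; case: (g k) => /=.
have bij : set_bij D (f @` D) f by split => //; exact: image_subset.
transitivity (\esum_(k in f @` D) oapp a 0 (g k)).
  by rewrite (reindex_esum _ _ _ _ bij); apply: eq_esum => i Di /=; rewrite gf.
rewrite esum_mkcond; apply: eq_esum => k _; case: ifPn => //.
rewrite notin_setE => nfk; case gk: (g k) => [i|]//=.
by case: nfk; have [Di <-] := gP _ _ gk; exists i.
Qed.

(** Countability as a mere property: the field [L] carries no enumeration, and for the dual lattice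
    the injection comes from integer coordinates. *)
Definition injnat (T : Type) (D : set T) := exists f : T -> nat, set_inj D f.

Lemma injnat_countType (T : countType) (D : set T) : injnat D.
Proof. by exists pickle => i j _ _; exact: (pcan_inj pickleK). Qed.

Lemma integral_esum (T : choiceType) (I : set T) (D : set R) (f : T -> mR -> \bar R) :
  injnat I -> measurable D ->
  (forall i, measurable_fun setT (f i)) -> (forall i t, 0 <= f i t) ->
  \int[mu]_(t in D) (\esum_(i in I) f i t) = \esum_(i in I) \int[mu]_(t in D) f i t.
Proof.
move=> [h /esum_enum[g gI gE]] mD mf f0.
rewrite gE; last by move=> i; exact: integral_ge0.
under eq_integral do rewrite gE//.
rewrite integral_nneseries//; last 2 first.
- by move=> k; case: (g k) => [i|]/=; [exact: measurable_funTS|exact: measurable_cst].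
- by move=> k t _; case: (g k) => /=.
apply: eq_eseriesr => k _; case: (g k) => [i|]//=.
by rewrite integral0.
Qed.

Lemma cmeas_esum (T : choiceType) (I : set T) n (f : T -> 'cV[R]_n -> \bar R) :
  injnat I -> (forall i, cmeas (f i)) -> (forall i y, 0 <= f i y) ->
  cmeas (fun y => \esum_(i in I) f i y).
Proof.
move=> [h /esum_enum[g gI gE]] cf f0.
rewrite (_ : (fun y => _) = (fun y => \sum_(k <oo) oapp (f^~ y) 0 (g k))); last first.
  by apply/funext => y; rewrite gE.
apply: cmeas_sum => [k|k y]; last by case: (g k) => /=.
by case: (g k) => [i|]//=; move=> d Y p _; exact: measurable_cst.
Qed.

Lemma iint_esum (T : choiceType) (I : set T) (D : set R) n (f : T -> 'cV[R]_n -> \bar R) :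
  injnat I -> measurable D -> (forall i, cmeas (f i)) -> (forall i y, 0 <= f i y) ->
  iint D (fun y => \esum_(i in I) f i y) = \esum_(i in I) iint D (f i).
Proof.
move=> hI mD; elim: n f => [|n IH] f cf f0 //=.
under eq_integral => t _ do
  rewrite (IH (fun i y => f i (ccons t y)) (fun i => jmeas_cmeas t (cmeas_ccons (cf i))))//.
rewrite integral_esum//; last by move=> i t; exact: iint_ge0.
by move=> i; apply: cmeas_iint.
Qed.

Lemma esum_single (T : choiceType) (z0 : T) (a : T -> \bar R) : 0 <= a z0 ->
  (forall z, z <> z0 -> a z = 0) -> \esum_(z in [set: T]) a z = a z0.
Proof.
move=> a0 az; rewrite -(esum_set1 a0) [RHS]esum_mkcond; apply: eq_esum => z _.
case: ifPn => //; rewrite notin_setE => zz0; exact: az.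
Qed.

(** Every [t] lies in exactly one half-open cell, that of its floor; the cells are closed up at the
    end at the price of a null set. *)
Lemma integral_tile (f : R -> \bar R) : measurable_fun [set: R] f ->
  (forall t, 0 <= f t) ->
  \int[mu]_t f t = \esum_(z in [set: int]) \int[mu]_(t in `[0%R, 1%R]) f (t + z%:~R)%R.
Proof.
move=> mf f0.
pose I (z : int) : set R := `[z%:~R, (z + 1)%:~R[%classic.
have mI z : measurable (I z) by exact: measurable_itv.
transitivity (\int[mu]_t (\esum_(z in [set: int]) (f \_ (I z)) t)).
  apply: eq_integral => t _.
  rewrite (@esum_single _ (Num.floor t)).
  - by rewrite /patch mem_set// /I /= in_itv /= Num.Theory.ge_floor ?num_real//= Num.Theory.floorD1_gt// num_real.
  - by rewrite /patch; case: ifP.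
  - move=> z; rewrite /patch; case: ifPn => //; rewrite inE /I /= in_itv/= => tz zE.
    by case: zE; apply/esym/Num.Theory.floor_def.
rewrite integral_esum//; last 3 first.
- exact: injnat_countType.
- by move=> z; apply/(measurable_restrictT _ _).1; [exact: mI|exact: measurable_funTS].
- by move=> z t; rewrite /patch; case: ifP.
apply: eq_esum => z _.
rewrite -integral_mkcond (@ge0_integral_affine _ f 1%R z%:~R)// normr1 mul1e.
rewrite (_ : _ @^-1` _ = `[0%R, 1%R[%classic); last first.
  by apply/seteqP; split => t /=; rewrite /I /= !in_itv/= mul1r intrD; lra.
rewrite integral_itv_bndo_bndc; first by apply: eq_integral => t _; rewrite mul1r.
apply: measurable_funTS; apply: (measurableT_comp mf).
exact: (measurable_affine 1%R z%:~R).
Qed.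

Definition icons n (z : int) (y : 'cV[int]_n) : 'cV[int]_n.+1 :=
  \col_i oapp (fun j => y j 0%R) z (unlift ord0 i).

Definition intv n (z : 'cV[int]_n) : 'cV[R]_n := \col_i (z i 0)%:~R.

Lemma intv_icons n z (y : 'cV[int]_n) : intv (icons z y) = ccons z%:~R (intv y).
Proof.
apply/colP => i; case: (unliftP ord0 i) => [j|] ->;
by rewrite ?cconsES ?cconsE0 !mxE ?liftK ?unlift_none.
Qed.

Lemma icons_bij n : set_bij [set: int * 'cV[int]_n] [set: 'cV[int]_n.+1]
  (fun z => icons z.1 z.2).
Proof.
split => //.
  move=> [z y] [z' y'] _ _ /= /colP E; congr pair.
    by have := E ord0; rewrite !mxE unlift_none.
  by apply/colP => i; have := E (lift ord0 i); rewrite !mxE liftK.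
move=> y _; exists (y ord0 0%R, \col_i y (lift ord0 i) 0%R) => //=.
apply/colP => i; rewrite !mxE; case: (unliftP ord0 i) => [j|] ->;
by rewrite ?liftK ?unlift_none /= ?mxE.
Qed.

Lemma iint_tile n (f : 'cV[R]_n -> \bar R) : cmeas f -> (forall y, 0 <= f y) ->
  iint setT f =
  \esum_(z in [set: 'cV[int]_n]) iint `[0%R, 1%R] (fun y => f (y + intv z)%R).
Proof.
elim: n f => [|n IH] f cf f0 /=.
  rewrite (@esum_single _ 0%R)//; first by congr f; apply/colP => -[].
  by move=> z []; apply/colP => -[].
have cft t : cmeas (fun y => f (ccons t y)) by exact: (jmeas_cmeas _ (cmeas_ccons cf)).
rewrite integral_tile; last 2 first.
- exact: (cmeas_iint measurableT cf f0).
- by move=> t; exact: iint_ge0.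
rewrite (reindex_esum _ _ _ _ (icons_bij n)).
rewrite (_ : [set: int * 'cV[int]_n] = setT `*`` (fun=> setT)); last first.
  by apply/seteqP; split.
rewrite -(@esum_esum _ _ _ setT (fun=> setT) (fun z y => \int[mu]_(t in `[0%R, 1%R])
  iint `[0%R, 1%R] (fun y0 : 'cV_n => f (ccons t y0 + intv (icons z y))%R))); last first.
  by move=> *; apply: integral_ge0 => t _; exact: iint_ge0.
apply: eq_esum => z _.
under eq_integral => t _ do rewrite IH//.
rewrite integral_esum//.
- apply: eq_esum => y _; apply: eq_integral => t _; apply: eq_iint => w _.
  by rewrite intv_icons ccons_add.
- exact: injnat_countType.
- move=> y; apply: (@jmeas_iint _ _ _ _ mR _ (fun t y0 => f (ccons (t + z%:~R)%R (y0 + intv y)%R))) => //.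
  move=> d Y p g mp mg; apply: cf; apply: vmeasurable_ccons.
    exact: measurable_funD.
  by apply: vmeasurable_add => //; exact: vmeasurable_cst.
- by move=> y t; exact: iint_ge0.
Qed.

End countable_sums.

(** * An integrable majorant in one variable *)

Section one_variable.
Variable R : realType.
Local Notation mR := (measurableTypeR R).
Local Notation mu := (@lebesgue_measure R).
Local Open Scope ereal_scope.

Lemma cmeas_prod n (h : R -> R) : measurable_fun setT h ->
  cmeas (fun y : 'cV[R]_n => (\prod_(i < n) h (y i 0))%R%:E).
Proof.
move=> mh d Y g mg; apply/measurable_EFinP; apply: measurable_prodR => i _.
exact: (measurableT_comp mh (mg i)).
Qed.

Lemma iint_prod n (h : R -> R) c : measurable_fun setT h -> (forall t, 0 <= h t)%R ->
  \int[mu]_t (h t)%:E = c%:E ->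
  iint setT (fun y : 'cV[R]_n => (\prod_(i < n) h (y i 0))%R%:E) = (c ^+ n)%:E.
Proof.
move=> mh h0 hc.
have mh' : measurable_fun setT (EFin \o h) by exact/measurable_EFinP.
elim: n => [|n IH] /=; first by rewrite big_ord0.
transitivity (\int[mu]_t ((h t)%:E * (c ^+ n)%:E)).
  apply: eq_integral => t _.
  rewrite -IH -iintZl//; last 3 first.
  - exact: cmeas_prod.
  - by move=> y; rewrite lee_fin prodr_ge0.
  - by rewrite lee_fin.
  apply: eq_iint => y _; rewrite big_ord_recl cconsE0 EFinM; congr (_ * (_)%:E).
  by apply: eq_bigr => i _; rewrite cconsES.
rewrite ge0_integralZr//; last 2 first.
- by move=> t _; rewrite lee_fin.
- rewrite lee_fin exprn_ge0// -lee_fin -hc; apply: integral_ge0 => t _; by rewrite lee_fin.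
by rewrite hc -EFinM exprS.
Qed.

(** A multiplicative majorant: the product of humps of exponent [p] over [r] coordinates is at least
    the power [- p * r] of the max norm cut off at [1]. It reduces convergence in several variables
    to [p > 1] in one. *)
Definition hump (p t : R) : R := ((Num.max 1 `|t|) `^ (- p))%R.

Lemma hump_ge0 p t : (0 <= hump p t)%R. Proof. exact: powR_ge0. Qed.

Lemma measurable_hump p : measurable_fun setT (hump p).
Proof.
rewrite (_ : hump p = (@powR R ^~ (- p)%R) \o (fun t => Num.max 1 `|t|)%R)//.
apply: measurableT_comp; first exact: measurable_powR.
by apply: measurable_maxr => //; exact: measurable_cst.
Qed.

Lemma cvg_powRN (q : R) : (0 < q)%R -> ((x `^ (- q))%R @[x --> +oo%R] --> (0%R : R))%classic.
Proof.
move=> q0; apply/cvgrPdist_lt => e e0.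
near=> t.
have t0 : (0 < t)%R by near: t; exact: nbhs_pinfty_gt.
rewrite sub0r normrN ger0_norm ?powR_ge0// powRN invf_plt ?posrE ?powR_gt0//.
have -> : (e^-1 = (e `^ (- q^-1)) `^ q)%R.
  by rewrite -powRrM mulNr mulVf ?gt_eqF// powR_inv1// ltW.
apply: gt0_ltr_powR => //; rewrite ?nnegrE ?powR_ge0 ?(ltW t0)//.
Unshelve. all: end_near. Qed.

Lemma integral_powRN_tail p : (1 < p)%R ->
  \int[mu]_(t in `[1%R, +oo[) (t `^ (- p))%:E < +oo.
Proof.
move=> p1; have q0 : (0 < p - 1)%R by rewrite subr_gt0.
have p10 : (1 - p != 0)%R by rewrite subr_eq0 lt_eqF.
pose F t := ((1 - p)^-1 * t `^ (1 - p))%R.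
have dF (x : R) : (0 < x)%R -> is_derive x 1%R F (x `^ (- p))%R.
  move=> x0.
  have dp : derivable (fun a => a `^ (1 - p))%R x 1%R.
    by apply: derivable_powR; rewrite in_itv/= x0.
  rewrite /F; apply: DeriveDef; first exact: derivableZ.
  rewrite deriveZ//= -derive1E powR_derive1 ?in_itv/= ?x0//.
  rewrite /GRing.scale/= mulrA mulVf// mul1r; congr (_ `^ _)%R; lra.
rewrite (@ge0_continuous_FTC2y _ (fun t => t `^ (- p))%R F 1%R 0%R)//.
- by rewrite -EFinB ltry.
- by move=> x _; exact: powR_ge0.
- apply: derivable_within_continuous => x; rewrite in_itv/= andbT => x1.
  by apply: derivable_powR; rewrite in_itv/= (lt_le_trans _ x1).
- rewrite -[X in _ --> X](mulr0 (1 - p)^-1%R).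
  apply: cvgMr; rewrite (_ : 1 - p = - (p - 1))%R; last by lra.
  exact: cvg_powRN.
- by move=> x x1; have [] := dF x (lt_trans ltr01 x1).
- apply: cvg_at_right_filter; apply: differentiable_continuous; apply/derivable1_diffP.
  by have [] := dF 1%R ltr01.
- move=> x; rewrite in_itv/= andbT => x1; rewrite derive1E.
  by have [_ ->] := dF x (lt_trans ltr01 x1).
Qed.

Lemma integral_hump p : (1 < p)%R -> \int[mu]_t (hump p t)%:E < +oo.
Proof.
move=> p1.
have mh : measurable_fun setT (fun t => (hump p t)%:E).
  by apply/measurable_EFinP; exact: measurable_hump.
have h0 (t : R) : 0 <= (hump p t)%:E by rewrite lee_fin hump_ge0.
have half : \int[mu]_(t in `[0%R, +oo[) (hump p t)%:E < +oo.
  rewrite (_ : `[0%R, +oo[%classic = `[0%R, 1%R[%classic `|` `[1%R, +oo[%classic); last first.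
    apply/seteqP; split => t /=; rewrite !in_itv/= ?andbT.
      by move=> t0; have [t1|t1] := ltP t 1%R; [left; rewrite t0|right].
    by case=> [/andP[]//|]; exact: le_trans.
  rewrite ge0_integral_setU//=; last 2 first.
  - exact: measurable_funTS.
  - apply/disj_setPS => t /= []; rewrite !in_itv/= andbT => /andP[_ t1] t2.
    by rewrite ltNge t2 in t1.
  apply: lte_add_pinfty.
    apply: (@le_lt_trans _ _ (\int[mu]_(t in `[0%R, 1%R[) (cst 1%E) t)).
      apply: ge0_le_integral => //; first exact: measurable_funTS.
      move=> t _; rewrite lee_fin /hump powRN invf_le1 ?powR_gt0 ?lt_max ?ltr01//.
      have m1 : (1 <= Num.max 1 `|t|)%R by rewrite le_max lexx.
      have p0 : (0 <= p)%R by lra.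
      by have := ler_powR m1 p0; rewrite powRr0.
    by rewrite integral_cst//= mul1e lebesgue_measure_itv/= lte_fin ltr01 -EFinB ltry.
  apply: (@le_lt_trans _ _ _ _ _ _ (integral_powRN_tail p1)).
  rewrite le_eqVlt; apply/orP; left; apply/eqP; apply: eq_integral.
  move=> t; rewrite inE/= in_itv/= andbT => t1.
  rewrite /hump ger0_norm; last exact: le_trans t1.
  by rewrite (max_idPr t1).
rewrite (_ : [set: R] = `]-oo, 0%R]%classic `|` `]0%R, +oo[%classic); last first.
  apply/seteqP; split => t //= _; rewrite !in_itv/= andbT.
  by have [t1|t1] := leP t 0%R; [left|right].
rewrite ge0_integral_setU//=; last 2 first.
- exact: measurable_funTS.
- apply/disj_setPS => t /= []; rewrite !in_itv/= andbT => t1 t2.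
  by rewrite ltNge t1 in t2.
apply: lte_add_pinfty; last first.
  by rewrite integral_itv_obnd_cbnd//; exact: measurable_funTS.
apply: (@le_lt_trans _ _ _ _ _ _ half).
rewrite (ge0_integration_by_substitution0 mh)// le_eqVlt; apply/orP; left; apply/eqP.
by apply: eq_integral => t _; rewrite /hump normrN.
Qed.

End one_variable.

(** * The Gamma function *)

Section gamma_function.
Variable R : realType.
Local Notation mR := (measurableTypeR R).
Local Notation mu := (@lebesgue_measure R).
Local Open Scope ereal_scope.

(** Integrand of the Gamma integral after replacing its variable by [expR t]; on the whole line,
    translation and rescaling are available. *)
Definition gammak (a t : R) : R := expR (a * t - expR t).

Lemma measurable_gammak a : measurable_fun setT (gammak a).
Proof.
rewrite (_ : gammak a = expR \o (fun t => a * t - expR t)%R)//.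
apply: measurableT_comp; first exact: measurable_expR.
by apply: measurable_funB; [apply: measurable_funM|exact: measurable_expR].
Qed.

Lemma expRN_sqr_le (x : R) : (0 < x)%R -> (expR (- x) <= 2 / x ^+ 2)%R.
Proof.
move=> x0; rewrite expRN -lef_pV2 ?posrE ?invr_gt0 ?expR_gt0 ?divr_gt0 ?exprn_gt0//.
rewrite invrK invf_div; apply: le_trans (expR_ge1Dxn 1 (ltW x0)).
by rewrite !factS fact0 muln1 lerDr.
Qed.

(** To the right the double exponential beats every exponential, to the left [expR (a * t)] remains;
    both decay faster than [t ^ -2]. *)
Lemma gammak_le_hump (a : R) : (0 < a)%R -> exists C, forall t, (gammak a t <= C * hump 2 t)%R.
Proof.
move=> a0; pose k := (a + 1)%R.
have k0 : (0 < k)%R by rewrite /k; lra.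
(* The best constant in [gammak a t <= C1 * expR (- t)], given by the tangent of [expR] at
   [ln k]. *)
pose C1 := expR (k * ln k - k).
have C10 : (0 < C1)%R by exact: expR_gt0.
have b1 t : (gammak a t <= C1 * expR (- t))%R.
  rewrite /gammak /C1 -expRD ler_expR.
  have := expR_ge1Dx (t - ln k); rewrite expRB lnK ?posrE//.
  rewrite ler_pdivlMr// => h; have {}h : (k * (1 + t - ln k) <= expR t)%R by lra.
  rewrite /k in h *; lra.
have b2 t : (gammak a t <= expR (a * t))%R.
  by rewrite /gammak ler_expR gerBl expR_ge0.
exists (C1 * expR 1 + 2 * C1 + 2 / a ^+ 2)%R => t.
have C20 : (0 < 2 / a ^+ 2 :> R)%R by rewrite divr_gt0 // exprn_gt0.
have e1 := @expR_gt0 R 1.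
rewrite /hump powR_invn ?le_max ?ler01//.
have [t1|t1] := leP 1%R `|t|%R; last first.
  rewrite expr1n invr1 mulr1; apply: (le_trans (b1 _)).
  have : (expR (- t) <= expR 1)%R.
    by rewrite ler_expR; move: t1; rewrite ltr_norml => /andP[]; lra.
  move=> /(ler_wpM2l (ltW C10)); have := mulr_gt0 C10 e1; lra.
have tn0 : t != 0%R by rewrite -normr_gt0 (lt_le_trans _ t1).
have t2 : (0 < `|t| ^- 2)%R by rewrite invr_gt0 exprn_gt0// normr_gt0.
have [t0|t0] := leP 0%R t.
  have tp : (0 < t)%R by rewrite lt0r tn0.
  apply: (le_trans (b1 _)).
  have := ler_wpM2l (ltW C10) (expRN_sqr_le tp).
  rewrite ger0_norm// in t2 * => h; apply: (le_trans h).
  rewrite mulrA; apply: ler_wpM2r; first exact: ltW.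
  have := mulr_gt0 C10 e1; lra.
apply: (le_trans (b2 _)).
have at0 : (0 < a * - t)%R by rewrite mulr_gt0// oppr_gt0.
have := expRN_sqr_le at0; rewrite -mulrN opprK => h; apply: (le_trans h).
rewrite exprMn sqrrN invfM mulrA real_normK ?num_real//.
rewrite real_normK ?num_real// in t2.
apply: ler_wpM2r; first exact: ltW.
have := mulr_gt0 C10 e1; lra.
Qed.

Lemma integrable_hump p : (1 < p)%R -> mu.-integrable setT (EFin \o hump p : mR -> \bar R).
Proof.
move=> p1; apply/integrableP; split; first by apply/measurable_EFinP; exact: measurable_hump.
under eq_integral do rewrite /= ger0_norm ?hump_ge0//.
exact: integral_hump.
Qed.

Lemma integral_gammak_lty (a : R) : (0 < a)%R -> \int[mu]_t (gammak a t)%:E < +oo.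
Proof.
move=> a0; have [C hC] := gammak_le_hump a0.
have mh := measurable_hump 2%R.
have C0 : (0 <= C)%R.
  have := le_trans (expR_ge0 _) (hC 0%R).
  by rewrite pmulr_lge0// /hump powR_gt0// lt_max ltr01.
apply: (@le_lt_trans _ _ (\int[mu]_t (C%:E * (hump 2%R t)%:E))).
  apply: ge0_le_integral => //.
  - by move=> t _; rewrite lee_fin expR_ge0.
  - by apply/measurable_EFinP; exact: measurable_gammak.
  - under eq_fun do rewrite -EFinM.
    apply/measurable_EFinP; apply: measurable_funM; [exact: measurable_cst|exact: mh].
  - by move=> t _; rewrite -EFinM lee_fin.
rewrite ge0_integralZl//; last 2 first.
- by apply/measurable_EFinP; exact: mh.
- by move=> t _; rewrite lee_fin hump_ge0.
by apply: lte_mul_pinfty => //; apply: integral_hump; lra.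
Qed.

(** Both sides are monotone limits over the intervals [[exp (-n), exp n]] and [[-n, n]], on which
    the substitution theorem for continuous integrands applies. *)
Lemma integral_gammak a :
  \int[mu]_(t in `]0%R, +oo[) (t `^ (a - 1) * expR (- t))%:E = \int[mu]_t (gammak a t)%:E.
Proof.
pose G (t : R) := (t `^ (a - 1) * expR (- t))%R.
pose S n : set R := `[(- n%:R)%R, n%:R%R]%classic.
pose S' n : set R := `[expR (- n%:R)%R, expR n%:R%R]%classic.
have mG : measurable_fun setT (EFin \o G : mR -> \bar R).
  apply/measurable_EFinP; apply: measurable_funM; first exact: measurable_powR.
  by apply: measurableT_comp; [exact: measurable_expR|exact: oppr_measurable].
have mg : measurable_fun setT (EFin \o gammak a : mR -> \bar R).
  by apply/measurable_EFinP; exact: measurable_gammak.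
have eqn n : \int[mu]_(t in S' n) (G t)%:E = \int[mu]_(t in S n) (gammak a t)%:E.
  have nn : (- n%:R <= n%:R :> R)%R by rewrite ge0_cp.
  have dE : (@expR R)^`()%classic = expR by apply/funext => t; rewrite derive1E; exact: derive_val.
  rewrite /S' (@integration_by_substitution_increasing _ expR G (- n%:R) n%:R)//.
  - apply: eq_integral => t _; congr (_%:E); rewrite /= dE /G /gammak fctE /=.
    rewrite mulrAC -expRM -expRD -expRD; congr expR; lra.
  - by move=> x y _ _; rewrite ltr_expR.
  - by rewrite dE => x _; exact: continuous_expR.
  - by rewrite dE; apply/cvg_ex; exists (expR (- n%:R)); apply: cvg_at_right_filter; exact: continuous_expR.
  - by rewrite dE; apply/cvg_ex; exists (expR n%:R); apply: cvg_at_left_filter; exact: continuous_expR.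
  - split.
    + by move=> x _; exact: derivable_expR.
    + by apply: cvg_at_right_filter; exact: continuous_expR.
    + by apply: cvg_at_left_filter; exact: continuous_expR.
  - apply: derivable_within_continuous => x; rewrite in_itv/= => /andP[x1 _].
    have x0 : (0 < x)%R by exact: lt_le_trans (expR_gt0 _) x1.
    apply: derivableM; first by apply: derivable_powR; rewrite in_itv/= x0.
    have : derivable (expR \o -%R) x 1%R.
      apply: diff_derivable; apply: differentiable_comp => //.
      by apply/derivable1_diffP; exact: derivable_expR.
    by [].
have U' : \bigcup_n S' n = `]0%R, +oo[%classic.
  apply/seteqP; split => t /=.
    by move=> [n _]; rewrite /S' /= !in_itv/= andbT => /andP[+ _]; apply: lt_le_trans; exact: expR_gt0.
  rewrite in_itv/= andbT => t0.
  exists (Num.truncn `|ln t|).+1 => //; rewrite /S' /= in_itv/=.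
  have := Num.Theory.truncnS_gt `|ln t|; rewrite ltr_norml => /andP[h1 h2].
  by rewrite -[t in (_ <= t <= _)%R]lnK ?posrE// !ler_expR !ltW.
have U : \bigcup_n S n = setT.
  apply/seteqP; split => t //= _.
  exists (Num.truncn `|t|).+1 => //; rewrite /S /= in_itv/=.
  by have := Num.Theory.truncnS_gt `|t|; rewrite ltr_norml => /andP[h1 h2]; rewrite !ltW.
have c' : \int[mu]_(t in S' n) (G t)%:E @[n --> \oo] --> \int[mu]_(t in \bigcup_n S' n) (G t)%:E.
  apply: ge0_nondecreasing_set_cvg_integral.
  - move=> m n mn; apply/subsetPset => t; rewrite /S' /= !in_itv/= => /andP[h1 h2].
    rewrite (le_trans _ h1) ?(le_trans h2)// ler_expR ?lerN2 ?ler_nat//.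
  - by move=> n; exact: measurable_itv.
  - by move=> n; exact: measurable_funTS.
  - by move=> n t _; rewrite lee_fin mulr_ge0 ?powR_ge0 ?expR_ge0.
have c : \int[mu]_(t in S n) (gammak a t)%:E @[n --> \oo] --> \int[mu]_(t in \bigcup_n S n) (gammak a t)%:E.
  apply: ge0_nondecreasing_set_cvg_integral.
  - move=> m n mn; apply/subsetPset => t; rewrite /S /= !in_itv/= => /andP[h1 h2].
    rewrite (le_trans _ h1) ?(le_trans h2)// ?lerN2 ?ler_nat//.
  - by move=> n; exact: measurable_itv.
  - by move=> n; exact: measurable_funTS.
  - by move=> n t _; rewrite lee_fin expR_ge0.
rewrite -U' -U.
have eqS : (fun n => \int[mu]_(t in S' n) (G t)%:E) = (fun n => \int[mu]_(t in S n) (gammak a t)%:E).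
  by apply/funext => n; exact: eqn.
rewrite eqS in c'; exact: (cvg_unique _ c' c).
Qed.

Lemma GammaE (a : R) : (0 < a)%R -> \int[mu]_t (gammak a t)%:E = (Gamma a)%:E.
Proof.
move=> a0; rewrite /Gamma /Rintegral integral_gammak fineK// ge0_fin_numE ?integral_gammak_lty//.
by apply: integral_ge0 => t _; rewrite lee_fin expR_ge0.
Qed.

Lemma Gamma_gt0 (a : R) : (0 < a)%R -> (0 < Gamma a)%R.
Proof.
move=> a0; rewrite -lte_fin -GammaE//.
pose m := expR (- expR 1) : R.
apply: (@lt_le_trans _ _ (\int[mu]_(t in `[0%R, 1%R]) m%:E)).
  rewrite integral_cst//= lebesgue_measure_itv/= lte_fin ltr01 -EFinB -EFinM lte_fin.
  by rewrite subr0 mulr1 expR_gt0.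
apply: (@le_trans _ _ (\int[mu]_(t in `[0%R, 1%R]) (gammak a t)%:E)).
  apply: ge0_le_integral => //.
  - by move=> t _; rewrite lee_fin expR_ge0.
  - by apply: measurable_funTS; apply/measurable_EFinP; exact: measurable_gammak.
  - move=> t /=; rewrite in_itv/= => /andP[t0 t1]; rewrite lee_fin ler_expR.
    have : (expR t <= expR 1)%R by rewrite ler_expR.
    have := mulr_ge0 (ltW a0) t0; lra.
apply: ge0_subset_integral => //.
- by apply/measurable_EFinP; exact: measurable_gammak.
- by move=> t _; rewrite lee_fin expR_ge0.
Qed.

(** For exponents between [a] and [a + 1] the kernel lies below the one for [a + 1] when [t >= 0]
    and below the one for [a] when [t < 0], so their sum dominates. Continuity from the right
    suffices because [eta] tends to [0] from above. *)
Lemma cvg_Gamma (a : R) (u : nat -> R) : (0 < a)%R -> (forall n, a <= u n <= a + 1)%R ->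
  (u n @[n --> \oo] --> a)%classic -> (Gamma (u n) @[n --> \oo] --> Gamma a)%classic.
Proof.
move=> a0 ua uc.
have u0 n : (0 < u n)%R by have /andP[h _] := ua n; exact: lt_le_trans h.
have a10 : (0 < a + 1)%R by lra.
have [C1 h1] := gammak_le_hump a0; have [C2 h2] := gammak_le_hump a10.
have [] := @dominated_convergence _ mR R mu setT measurableT
  (fun n t => (gammak (u n) t)%:E) (fun t => (gammak a t)%:E)
  (fun t => (C1 + C2)%:E * (hump 2%R t)%:E).
- by move=> n; apply/measurable_EFinP; exact: measurable_gammak.
- by apply/measurable_EFinP; exact: measurable_gammak.
- apply: aeW => t _; apply: cvg_EFin; first by near=> n.
  rewrite /= /gammak.
  apply: (@cvg_comp _ _ _ (fun n => u n * t - expR t)%R expR); last exact: continuous_expR.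
  by apply: cvgB; [apply: cvgMl|exact: cvg_cst].
- by apply: integrableZl => //; apply: integrable_hump; lra.
- apply: aeW => t n _ /=; rewrite ger0_norm ?expR_ge0// -EFinM lee_fin mulrDl.
  have [t0|t0] := leP 0%R t.
    apply: (@le_trans _ _ (gammak (a + 1) t)).
      rewrite /gammak ler_expR lerB// ler_wpM2r//; by have /andP[] := ua n.
    apply: (le_trans (h2 t)); rewrite lerDr.
    exact: le_trans (expR_ge0 _) (h1 t).
  apply: (@le_trans _ _ (gammak a t)).
    rewrite /gammak ler_expR lerB//; apply: ler_wnM2r; first exact: ltW.
    by have /andP[] := ua n.
  apply: (le_trans (h1 t)); rewrite lerDl.
  exact: le_trans (expR_ge0 _) (h2 t).
move=> _ _; rewrite GammaE// => h.
apply/fine_cvg; apply: cvg_trans h; apply: near_eq_cvg; near=> n.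
by rewrite /= integral_gammak.
Unshelve. all: end_near. Qed.

Lemma integral_gammak_scale (a X : R) : (0 < a)%R -> (0 < X)%R ->
  \int[mu]_t (expR (a * t - X * expR t))%:E = (Gamma a * X `^ (- a))%:E.
Proof.
move=> a0 X0.
transitivity (\int[mu]_t ((gammak a (t + ln X))%:E * (X `^ (- a))%:E)).
  apply: eq_integral => t _; rewrite -EFinM; congr (_%:E).
  rewrite /gammak /powR gt_eqF// -expRD [expR (t + ln X)]expRD lnK ?posrE//; congr expR.
  by rewrite mulrDr [(expR t * X)%R]mulrC; lra.
have mg : measurable_fun [set: R] (fun t => (gammak a t)%:E).
  by apply/measurable_EFinP; exact: measurable_gammak.
rewrite ge0_integralZr//; last 3 first.
- apply/measurable_EFinP; apply: (measurableT_comp (measurable_gammak a)).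
  by apply: measurable_funD.
- by move=> t _; rewrite lee_fin expR_ge0.
- by rewrite lee_fin powR_ge0.
rewrite (@integral_shiftT _ (fun t => (gammak a t)%:E))//; last by move=> t; rewrite lee_fin expR_ge0.
by rewrite GammaE.
Qed.

Lemma integral_gammak_half (s : R) : (0 < s)%R ->
  \int[mu]_t (expR (s * t - expR (2 * t)))%:E = (Gamma (s / 2) / 2)%:E.
Proof.
move=> s0; have s20 : (0 < s / 2)%R by rewrite divr_gt0.
transitivity (\int[mu]_t (gammak (s / 2) (2 * t + 0))%:E).
  by apply: eq_integral => t _; rewrite /gammak addr0 mulrA mulfVK.
rewrite (@integral_affineT _ (fun t => (gammak (s / 2) t)%:E)) ?pnatr_eq0//.
- by rewrite GammaE// normr_nat -EFinM mulrC.
- by apply/measurable_EFinP; exact: measurable_gammak.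
- by move=> t; rewrite lee_fin expR_ge0.
Qed.

End gamma_function.

(** * The Mellin integral in logarithmic coordinates *)

Section mellin.
Variable R : realType.
Local Notation mR := (measurableTypeR R).
Local Notation mu := (@lebesgue_measure R).
Local Open Scope ereal_scope.

(* The square of the Euclidean norm of the point of U_R with logarithmic
   coordinates [w]. *)
Definition logsqnorm n (w : 'cV[R]_n) : R :=
  (\sum_(i < n) expR (2 * w i 0) + expR (- 2 * \sum_(i < n) w i 0))%R.

Lemma logsqnorm_gt0 n (w : 'cV[R]_n) : (0 < logsqnorm w)%R.
Proof.
rewrite /logsqnorm; apply: ltr_wpDl; last exact: expR_gt0.
by apply: sumr_ge0 => i _; exact: expR_ge0.
Qed.

Lemma measurable_expR_comp d (Y : measurableType d) (f : Y -> R) :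
  measurable_fun setT f -> measurable_fun setT (fun y => expR (f y)).
Proof. by move=> mf; apply: measurableT_comp => //; exact: measurable_expR. Qed.

Lemma measurable_powR_comp d (Y : measurableType d) (f : Y -> R) (s : R) :
  measurable_fun setT f -> measurable_fun setT (fun y => f y `^ s)%R.
Proof.
by move=> mf; apply: (@measurableT_comp _ _ _ _ _ _ (@powR R ^~ s)) => //; exact: measurable_powR.
Qed.

Lemma measurable_logsqnorm n d (Y : measurableType d) (g : Y -> 'cV[R]_n) :
  vmeasurable g -> measurable_fun setT (fun y => logsqnorm (g y)).
Proof.
move=> mg; apply: measurable_funD.
  by apply: measurable_sumR => i _; apply: measurable_expR_comp; apply: measurable_funM.
apply: measurable_expR_comp; apply: measurable_funM => //.
by apply: measurable_sumR.
Qed.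

Lemma cmeas_logsqnorm n (s : R) : cmeas (fun w : 'cV[R]_n => (logsqnorm w `^ s)%:E).
Proof.
move=> d Y g mg; apply/measurable_EFinP; apply: measurable_powR_comp.
exact: measurable_logsqnorm.
Qed.

(* Write [logsqnorm w `^ (- s / 2)] as a Gamma integral over [t] and pass to the
   [n.+1] independent variables [w i + t / 2] and [t / 2 - \sum_i w i]. *)
Lemma iint_logsqnorm n (s : R) : (0 < s)%R ->
  iint setT (fun w : 'cV[R]_n => (logsqnorm w `^ (- (s / 2)))%:E) =
  (2 / n.+1%:R * (Gamma (s / n.+1%:R / 2) / 2) ^+ n.+1 / Gamma (s / 2))%:E.
Proof.
move=> s0; have s20 : (0 < s / 2)%R by rewrite divr_gt0.
have n0 : (0 < n.+1%:R :> R)%R by rewrite ltr0n.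
have G0 := Gamma_gt0 s20.
set lhs := iint _ _; set rhs := (_ / Gamma (s / 2))%R.
suff: (Gamma (s / 2))%:E * lhs = (Gamma (s / 2))%:E * rhs%:E.
  move=> /(congr1 (fun x => (Gamma (s / 2))^-1%:E * x)).
  by rewrite !muleA -EFinM mulVf ?gt_eqF// !mul1e.
have -> : (Gamma (s / 2))%:E * rhs%:E = (2 / n.+1%:R * (Gamma (s / n.+1%:R / 2) / 2) ^+ n.+1)%:E.
  by rewrite -EFinM /rhs mulrC divfK ?gt_eqF.
rewrite /lhs -iintZl//; last 3 first.
- exact: cmeas_logsqnorm.
- by move=> y; rewrite lee_fin powR_ge0.
- by rewrite lee_fin ltW.
pose F t (w : 'cV[R]_n) := expR (s / 2 * t - logsqnorm w * expR t).
have jF : jmeas (fun (t : mR) w => (F t w)%:E).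
  move=> d Y p g mp mg; apply/measurable_EFinP; apply: measurable_expR_comp.
  apply: measurable_funB; first exact: measurable_funM.
  apply: measurable_funM; first exact: measurable_logsqnorm.
  exact: measurable_expR_comp.
have F0 t w : 0 <= (F t w)%:E by rewrite lee_fin expR_ge0.
transitivity (iint setT (fun w : 'cV[R]_n => \int[mu]_t (F t w)%:E)).
  by apply: eq_iint => w _; rewrite integral_gammak_scale ?logsqnorm_gt0// EFinM.
rewrite -iint_swap//.
pose L (y : 'cV[R]_n) := (\sum_(i < n) y i 0)%R.
(* [H] is [F] with every coordinate translated by [- t / 2]: the factor [expR t] disappears from the
   first [n] exponentials and collects in the last one. *)
pose H t (y : 'cV[R]_n) := expR (s / 2 * t - \sum_(i < n) expR (2 * y i 0) - expR (n.+1%:R * t - 2 * L y)).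
have mL d (Y : measurableType d) (g : Y -> 'cV[R]_n) : vmeasurable g ->
    measurable_fun setT (fun y => L (g y)).
  by move=> mg; apply: measurable_sumR.
have jH : jmeas (fun (t : mR) w => (H t w)%:E).
  move=> d Y p g mp mg; apply/measurable_EFinP; apply: measurable_expR_comp.
  apply: measurable_funB; first apply: measurable_funB.
  - exact: measurable_funM.
  - by apply: measurable_sumR => i _; apply: measurable_expR_comp; apply: measurable_funM.
  - apply: measurable_expR_comp; apply: measurable_funB; first exact: measurable_funM.
    by apply: measurable_funM => //; exact: mL.
have H0 t w : 0 <= (H t w)%:E by rewrite lee_fin expR_ge0.
transitivity (\int[mu]_t iint setT (fun y : 'cV[R]_n => (H t y)%:E)).
  apply: eq_integral => t _.
  rewrite -(@iint_shift _ _ (fun w => (F t w)%:E) (\col_i (- (t / 2)))%R)//; last exact: (jmeas_cmeas _ jF).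
  apply: eq_iint => y _; congr (_%:E); rewrite /F /H; congr expR.
  rewrite /logsqnorm mulrDl mulr_suml -expRD -addrA -opprD; congr (_ - _)%R; congr (_ + _)%R.
    by apply: eq_bigr => i _; rewrite -expRD !mxE; congr expR; lra.
  congr expR; under eq_bigr do rewrite !mxE.
  rewrite big_split /= sumr_const card_ord -/(L y) -mulr_natr -[in RHS]natr1; lra.
rewrite iint_swap//.
(* The [n.+1] new variables add up to [n.+1 * t / 2], so giving each the weight [q] reproduces
   [s / 2 * t]. The factor [2 / n.+1] below is the inverse slope of the last variable in [t]. *)
pose q := (s / n.+1%:R)%R.
have q0 : (0 < q)%R by rewrite divr_gt0.
pose c := (Gamma (q / 2) / 2)%R.
have c0 : (0 < c)%R by rewrite divr_gt0// Gamma_gt0// divr_gt0.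
pose h x := expR (q * x - expR (2 * x)) : R.
have mh : measurable_fun setT h.
  apply: measurable_expR_comp; apply: measurable_funB; first exact: measurable_funM.
  by apply: measurable_expR_comp; exact: measurable_funM.
transitivity (iint setT (fun y : 'cV[R]_n => (2 / n.+1%:R * c)%:E * (\prod_(i < n) h (y i 0))%R%:E)); last first.
  rewrite iintZl//; last 3 first.
  - exact: cmeas_prod.
  - by move=> y; rewrite lee_fin prodr_ge0// => i _; exact: expR_ge0.
  - by rewrite lee_fin; apply: mulr_ge0; [rewrite divr_ge0|exact: ltW].
  rewrite (@iint_prod _ n h c)//; last 2 first.
  - by move=> t; exact: expR_ge0.
  - exact: integral_gammak_half.
  by rewrite -EFinM -/q -/c exprS; congr (_%:E); ring.
apply: eq_iint => y _.
have hP : (\prod_(i < n) h (y i 0) = expR (q * L y - \sum_(i < n) expR (2 * y i 0)))%R.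
  by rewrite -expR_sum sumrB mulr_sumr.
transitivity (\int[mu]_t ((\prod_(i < n) h (y i 0))%R%:E * (h (n.+1%:R / 2 * t + (- L y)))%:E)).
  apply: eq_integral => t _; rewrite hP -EFinM; congr (_%:E).
  rewrite /H /h -expRD; congr expR.
  have -> : (q * (n.+1%:R / 2 * t + - L y) = s / 2 * t - q * L y)%R.
    by rewrite /q; move: (n.+1%:R : R)%R n0 => N N0; field; exact: lt0r_neq0.
  have -> : (2 * (n.+1%:R / 2 * t + - L y) = n.+1%:R * t - 2 * L y)%R by move: (n.+1%:R : R)%R => N; field.
  lra.
have a0 : (n.+1%:R / 2 != 0 :> R)%R by rewrite mulf_neq0// ?invr_eq0 pnatr_eq0.
rewrite ge0_integralZl//; last 3 first.
- apply/measurable_EFinP; apply: (measurableT_comp mh).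
  exact: (measurable_affine (n.+1%:R / 2) (- L y)).
- by move=> t _; rewrite lee_fin expR_ge0.
- by rewrite lee_fin prodr_ge0// => i _; exact: expR_ge0.
rewrite (@integral_affineT _ (fun t => (h t)%:E) _ (- L y)%R a0)//; last 2 first.
- exact/measurable_EFinP.
- by move=> t; rewrite lee_fin expR_ge0.
rewrite integral_gammak_half// -?EFinM mulrC; congr (_ * _)%:E.
by rewrite ger0_norm ?divr_ge0// invf_div.
Qed.

End mellin.

(** * Number fields, duals of ideals and units *)

(** [hsigma] separates embeddings as packaged morphisms, while linear independence needs an element
    at which two of them differ. *)
Lemma rmorphism_ext (A B : nzRingType) (f g : {rmorphism A -> B}) :
  (f : A -> B) =1 g -> f = g.
Proof.
move=> /funext; case: f => f [[f1] [f2]]; case: g => g [[g1] [g2]] /= fg.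
by subst g; rewrite (Prop_irrelevance f1 g1) (Prop_irrelevance f2 g2).
Qed.

Section number_field.
Variables (R : realType) (L : fieldExtType rat).

Lemma integralP (a : L) : Defs.integral a <-> integralOver (intr : int -> L) a.
Proof.
split; first by case=> p [pm pr]; exists p.
by case=> p pm pr; exists p.
Qed.

Lemma integralM (a b : L) : Defs.integral a -> Defs.integral b -> Defs.integral (a * b).
Proof. by move=> /integralP ha /integralP hb; apply/integralP; exact: integral_mul. Qed.

Lemma integral_intr (z : int) : Defs.integral (z%:~R : L).
Proof. by apply/integralP; exact: (@integral_id _ _ (intr : {rmorphism int -> L})). Qed.

Lemma in_alg_ratr (q : rat) : q%:A = ratr q :> L.
Proof. by rewrite -[q%:A]/(GRing.in_alg L q) fmorph_eq_rat. Qed.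

Lemma intrL_eq0 (z : int) : (z%:~R == 0 :> L) = (z == 0).
Proof. by rewrite -(rmorph_int (GRing.in_alg L)) fmorph_eq0 intr_eq0. Qed.

Lemma scale_ratr (q : rat) (a : L) : q *: a = ratr q * a.
Proof. by rewrite -in_alg_ratr mulr_algl. Qed.

Lemma rmorphZ (s : {rmorphism L -> R}) (q : rat) (a : L) : s (q *: a) = ratr q * s a.
Proof. by rewrite scale_ratr rmorphM fmorph_rat. Qed.

(** The monic relation has integer coefficients, so it transfers through the rationals from [R] to
    [algC], where rational algebraic integers are known to be integers. *)
Lemma integral_rat_int (q : rat) : integralOver (intr : int -> R) (ratr q) -> q \in Num.int.
Proof.
case=> p pm; rewrite /root.
have -> : map_poly (intr : int -> R) p = map_poly (ratr : rat -> R) (map_poly intr p).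
  by rewrite -map_poly_comp; apply: eq_map_poly => z /=; rewrite ratr_int.
rewrite -/(root _ _) fmorph_root => rq.
have : (ratr q : algC) \in Num.int.
  apply: Cint_rat_Aint; first exact: Crat_rat.
  apply: (@root_monic_Aint (map_poly (ratr : rat -> algC) (map_poly intr p))).
  - by rewrite fmorph_root.
  - by do 2 apply: monic_map.
  - apply/polyOverP => i; rewrite coef_map/= coef_map/= ratr_int; exact: rpred_int.
by rewrite Cint_rat.
Qed.

(** An integer relation with leading coefficient [m] makes [m * a] integral; passing to the absolute
    value of [m] only adjusts the sign. *)
Lemma integral_scale (a : L) : exists2 m : nat, (0 < m)%N & Defs.integral (m%:R * a).
Proof.
have /polyOver1P[p0 p0E] := minPolyOver 1 a.
have [q [c c0 p0q]] := rat_poly_scale p0.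
have p00 : p0 != 0.
  by apply/eqP => p00; have := monic_neq0 (monic_minPoly 1 a); rewrite p0E p00 rmorph0 eqxx.
have q0 : q != 0 by apply/eqP => q0; rewrite q0 rmorph0 scaler0 in p0q; rewrite p0q eqxx in p00.
have qa : root (map_poly intr q : {poly L}) a.
  have := root_minPoly 1 a; rewrite p0E p0q linearZ/= rootZ; last first.
    by rewrite ?fmorph_eq0 ?scaler_eq0 ?oner_eq0 ?orbF invr_eq0 intr_eq0.
  rewrite -map_poly_comp; congr (root _ a); apply: eq_map_poly => z /=.
  by rewrite in_alg_ratr ratr_int.
pose m := lead_coef q; pose n := (size q).-1.
have sq : size q = n.+1 by rewrite prednK// size_poly_gt0.
have m0 : m != 0 by rewrite lead_coef_eq0.
have int_ma : Defs.integral (m%:~R * a).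
  have n0 : (0 < n)%N.
    rewrite lt0n; apply/eqP => n0; move: qa; rewrite n0 in sq.
    have /eqP/size_poly1P[k k0 ->] := sq.
    by rewrite map_polyC/= rootC intrL_eq0 (negbTE k0).
  (* This is [m ^+ n.-1 * q (X / m)], with its coefficients written without division. *)
  exists (\poly_(i < n.+1) (if i == n then 1 else q`_i * m ^+ (n - i).-1)); split.
    by rewrite monicE lead_coef_poly ?eqxx// oner_neq0.
  rewrite /root (@horner_coef_wide _ n.+1); last first.
    by apply: (leq_trans (size_poly _ _)); exact: size_poly.
  move: qa; rewrite /root horner_coef size_map_poly_id0 ?intrL_eq0 ?lead_coef_eq0//.
  move=> /eqP/(congr1 (fun t => m%:~R ^+ n.-1 * t)); rewrite mulr0 => qa.
  apply/eqP; rewrite -[RHS]qa sq mulr_sumr; apply: eq_bigr => -[i]/=; rewrite ltnS => le_in _.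
  rewrite !coef_map/= coef_poly ltnS le_in exprMn; case: eqP => [->|/eqP ni].
    have -> : q`_n = m by rewrite /m /lead_coef.
    by rewrite rmorph1 mul1r mulrA -exprSr prednK.
  have lt_in : (i < n)%N by rewrite ltn_neqAle ni.
  rewrite rmorphM rmorphXn /= -!mulrA [in RHS]mulrCA; congr (_ * _).
  by rewrite !mulrA -exprD; congr (_ ^+ _ * _); lia.
exists `|m|%N; first by rewrite absz_gt0.
have [->|->] : (`|m|%N%:R : L) = m%:~R \/ (`|m|%N%:R : L) = - m%:~R.
  rewrite -[_%:R]/(`|m|%N%:Z%:~R) abszE; have [h|h] := leP 0 m; first by left; rewrite ger0_norm.
  by right; rewrite ltr0_norm// rmorphN.
- by [].
- have -> : - m%:~R * a = (-1)%:~R * (m%:~R * a) by rewrite mulrN1z mulN1r mulNr.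
  by apply: integralM => //; exact: integral_intr.
Qed.

End number_field.

(** * Independence of the embeddings, trace and norm *)

Section embeddings.
Variables (R : realType) (L : fieldExtType rat) (r : nat).
Variable sigma : 'I_r -> {rmorphism L -> R}.
Hypothesis hdeg : \dim {: L} = r.
Hypothesis hsigma : injective sigma.

Local Notation Tr a := (TrR (embF sigma a)).

(** Induction on the number of nonzero coefficients: evaluating a relation at [y * x] and
    subtracting [sigma j0 y] times the relation removes the term [j0] and keeps [j1], provided that
    [y] separates these two embeddings. *)
Lemma dedekind (c : 'I_r -> R) : (forall x, \sum_j c j * sigma j x = 0) ->
  forall j, c j = 0.
Proof.
have [n] := ubnP #|[pred j | c j != 0]|; elim: n c => // n IH c cn c0 j0.
apply/eqP; apply: contraT => cj0.
have [j1 /andP[cj1 j10]|only] := pickP [pred j | (c j != 0) && (j != j0)].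
  have [y ys] : exists y, sigma j1 y <> sigma j0 y.
    apply: contrapT => /forallNP h; move: j10 => /eqP; apply; apply: hsigma.
    by apply: rmorphism_ext => y; apply: contrapT; exact: h.
  pose c' j := c j * (sigma j y - sigma j0 y).
  have c'0 : forall x, \sum_j c' j * sigma j x = 0.
    move=> x; transitivity (\sum_j c j * sigma j (y * x) - sigma j0 y * \sum_j c j * sigma j x).
      rewrite mulr_sumr -sumrB; apply: eq_bigr => j _.
      by rewrite /c' rmorphM; ring.
    by rewrite !c0 mulr0 subr0.
  have lt_c' : (#|[pred j | c' j != 0%R]| < n)%N.
    rewrite ltnS in cn; apply: (leq_trans _ cn); apply: proper_card; apply/properP; split.
      by apply/fintype.subsetP => j; rewrite !inE /c' mulf_eq0 negb_or => /andP[].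
    by exists j0; rewrite !inE /c' ?subrr ?mulr0 ?eqxx.
  have /eqP := IH _ lt_c' c'0 j1; rewrite mulf_eq0 (negbTE cj1)/= subr_eq0 => /eqP.
  by move/ys.
have := c0 1; rewrite (bigD1 j0)//= rmorph1 mulr1 big1 ?addr0; first by move/eqP; rewrite (negbTE cj0).
by move=> j jj0; have := only j; rewrite /= jj0 andbT => /negbFE/eqP ->; rewrite mul0r.
Qed.

Lemma exists_basis : exists b : r.-tuple L, basis_of {: L} b.
Proof. by case: _ / hdeg; exists (vbasis {: L}); exact: vbasisP. Qed.

Definition embmx (v : 'I_r -> L) : 'M[R]_r := \matrix_(j, i) sigma j (v i).

(** A row in the kernel is a linear relation between the embeddings on a basis, hence everywhere.
    Here the number of distinct embeddings meets the degree. *)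
Lemma embmx_basis (b : r.-tuple L) : basis_of {: L} b ->
  \det (embmx (fun i => b`_i)) != 0.
Proof.
move=> bb; rewrite -unitfE -unitmxE -row_free_unit -kermx_eq0.
apply/rowV0P => c /sub_kermxP cV.
suff h : forall j, c 0 j = 0 by apply/rowP => j; rewrite h mxE.
apply: dedekind => x; rewrite (coord_basis bb (memvf x)).
under eq_bigr do rewrite rmorph_sum mulr_sumr.
rewrite exchange_big big1 // => i _.
have := congr1 (fun M : 'rV_r => M 0 i) cV; rewrite !mxE => h.
under eq_bigr do rewrite rmorphZ mulrCA.
rewrite -mulr_sumr; apply/eqP; rewrite mulf_eq0; apply/orP; right.
by rewrite -[X in _ == X]h; apply/eqP; apply: eq_bigr => j _; rewrite ?mxE.
Qed.

Lemma embmx_scale (v : 'I_r -> L) (c : 'I_r -> L) : (forall i, c i != 0) ->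
  (forall i, exists q : rat, c i = ratr q) ->
  \det (embmx v) != 0 -> \det (embmx (fun i => c i * v i)) != 0.
Proof.
move=> c0 cq dv.
pose q i := projT1 (cid (cq i)).
have qE i : c i = ratr (q i) by exact: (projT2 (cid (cq i))).
have -> : embmx (fun i => c i * v i) = embmx v *m diag_mx (\row_i ratr (q i)).
  by apply/matrixP => j i; rewrite mul_mx_diag !mxE rmorphM qE fmorph_rat mulrC.
rewrite det_mulmx mulf_neq0// det_diag prodf_seq_neq0; apply/allP => i _ /=.
by rewrite mxE fmorph_eq0; have := c0 i; rewrite qE -in_alg_ratr scaler_eq0 oner_eq0 orbF.
Qed.

Lemma TrB a b : Tr (a - b) = Tr a - Tr b.
Proof. by rewrite /TrR -sumrB; apply: eq_bigr => j _; rewrite /embF rmorphB. Qed.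

Lemma Tr_sum (T : finType) (f : T -> L) : Tr (\sum_i f i) = \sum_i Tr (f i).
Proof.
rewrite /TrR exchange_big /=; apply: eq_bigr => j _; by rewrite /embF rmorph_sum.
Qed.

Lemma TrZ (z : int) a : Tr (z%:~R * a) = z%:~R * Tr a.
Proof. by rewrite /TrR mulr_sumr; apply: eq_bigr => j _; rewrite /embF rmorphM rmorph_int. Qed.

(* Multiplication by [a] has matrix [M] in a rational basis, and the embeddings
   diagonalize it. *)
Lemma TrN_rat a : exists t n : rat, Tr a = ratr t /\ NR (embF sigma a) = ratr n.
Proof.
have [b bb] := exists_basis.
pose V := embmx (fun i => b`_i).
have Vu : V \in unitmx by rewrite unitmxE unitfE embmx_basis.
pose M : 'M[rat]_r := \matrix_(k, i) coord b k (a * b`_i).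
pose D : 'M[R]_r := diag_mx (\row_j sigma j a).
have VM : V *m map_mx ratr M = D *m V.
  apply/matrixP => j i; rewrite mul_diag_mx !mxE -rmorphM.
  rewrite [in RHS](coord_basis bb (memvf (a * b`_i))) rmorph_sum.
  by apply: eq_bigr => k _; rewrite !mxE rmorphZ mulrC.
have ME : map_mx ratr M = invmx V *m D *m V by rewrite -mulmxA -VM mulKmx.
exists (\tr M), (\det M); split.
  have := congr1 mxtrace ME.
  rewrite mxtrace_mulC mulmxA mulmxV// mul1mx mxtrace_diag trace_map_mx => ->.
  by apply: eq_bigr => j _; rewrite mxE.
have := congr1 determinant ME.
rewrite !det_mulmx mulrAC det_inv mulVr ?mul1r -?unitmxE// det_map_mx => ->.
by rewrite det_diag; apply: eq_bigr => j _; rewrite mxE.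
Qed.

Lemma integral_sigma a j : Defs.integral a -> integralOver (intr : int -> R) (sigma j a).
Proof.
move=> /integralP/(integral_rmorph (sigma j)) [p pm pr]; exists p => //.
by rewrite (@eq_map_poly _ _ _ ((sigma j) \o intr)) // => z /=; rewrite rmorph_int.
Qed.

Lemma integral_is_int (t : R) (q : rat) : t = ratr q -> integralOver (intr : int -> R) t ->
  is_int t.
Proof.
move=> -> /integral_rat_int/intrP[z ->]; exists z; exact: ratr_int.
Qed.

Lemma integral_Tr a : Defs.integral a -> is_int (Tr a).
Proof.
move=> ia; have [t [_ [tE _]]] := TrN_rat a; apply: (integral_is_int tE).
apply: (big_ind (integralOver (intr : int -> R))).
- exact: mxpoly.integral0.
- by move=> ? ?; exact: mxpoly.integral_add.
- by move=> j _; exact: integral_sigma.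
Qed.

Lemma integral_NR a : Defs.integral a -> is_int (NR (embF sigma a)).
Proof.
move=> ia; have [_ [t [_ tE]]] := TrN_rat a; apply: (integral_is_int tE).
apply: (big_ind (integralOver (intr : int -> R))).
- exact: mxpoly.integral1.
- by move=> ? ?; exact: mxpoly.integral_mul.
- by move=> j _; exact: integral_sigma.
Qed.

Lemma degree_gt0 : (0 < r)%N.
Proof. by rewrite -hdeg adim_gt0. Qed.

(** The traces are the entries of the row of conjugates of [a] multiplied by an invertible
    matrix. *)
Lemma Tr_nondeg (v : 'I_r -> L) a : \det (embmx v) != 0 ->
  (forall i, Tr (a * v i) = 0) -> a = 0.
Proof.
move=> dv av.
have h : forall j, sigma j a = 0.
  have Vu : embmx v \in unitmx by rewrite unitmxE unitfE.
  have : \row_j sigma j a *m embmx v = 0.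
    apply/rowP => i; rewrite !mxE -[RHS](av i); apply: eq_bigr => j _.
    by rewrite !mxE /embF rmorphM.
  move=> /(congr1 (mulmx^~ (invmx (embmx v)))); rewrite mulmxK// mul0mx => /rowP E j.
  by have := E j; rewrite !mxE.
by have /eqP := h (Ordinal degree_gt0); rewrite fmorph_eq0 => /eqP.
Qed.

End embeddings.

(** * Biduality for subgroups with integral rational functionals *)

Section functionals.
Variable V : zmodType.

Lemma subgroup_muln (H : set V) : H 0 -> (forall a b, H a -> H b -> H (a - b)) ->
  forall a (n : nat), H a -> H (a *+ n).
Proof.
move=> H0 Hsub a n Ha; elim: n => // n IH; rewrite mulrS.
rewrite -[a *+ n]opprK; apply: (Hsub) => //; rewrite -sub0r; exact: Hsub.
Qed.

Lemma subgroup_mulz (H : set V) : H 0 -> (forall a b, H a -> H b -> H (a - b)) ->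
  forall a (z : int), H a -> H (a *~ z).
Proof.
move=> H0 Hsub a [n|n] Ha; first exact: subgroup_muln.
by rewrite NegzE mulrNz -sub0r; apply: (Hsub) => //; exact: subgroup_muln.
Qed.

Variable pi : nat -> V -> rat.
Hypothesis piB : forall i a b, pi i (a - b) = pi i a - pi i b.

Lemma pi0 i : pi i 0 = 0. Proof. by rewrite -(subrr 0) piB subrr. Qed.

Lemma piD i a b : pi i (a + b) = pi i a + pi i b.
Proof. by rewrite -[in LHS](opprK b) -[- b]sub0r !piB pi0 sub0r opprK. Qed.

Lemma pizM i a (z : int) : pi i (a *~ z) = z%:~R * pi i a.
Proof.
have h n : pi i (a *+ n) = n%:R * pi i a.
  by elim: n => [|n IH]; rewrite ?mulr0n ?pi0 ?mul0r// mulrS piD IH -natr1 mulrDl mul1r addrC.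
case: z => n; first exact: h.
rewrite NegzE mulrNz -sub0r piB pi0 sub0r.
by rewrite -[a *~ _]/(a *+ n.+1) h rmorphN mulNr.
Qed.

(* Biduality of lattices: eliminate the functional [pi k] by splitting off an
   element of [H] whose value generates [pi k @` H]. *)
Lemma subgroup_separation k (H : set V) y : H 0 -> (forall a b, H a -> H b -> H (a - b)) ->
  (forall i h, H h -> pi i h \in Num.int) ->
  (forall q : nat -> rat, (forall h, H h -> \sum_(i < k) q i * pi i h \in Num.int) ->
     \sum_(i < k) q i * pi i y \in Num.int) ->
  exists2 h, H h & forall i, (i < k)%N -> pi i h = pi i y.
Proof.
elim: k H y => [|k IH] H y H0 Hsub Hint Hy; first by exists 0.
have [allz|] := pselect (forall h, H h -> pi k h = 0).
  have pky : pi k y = 0.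
    apply/eqP; apply: contraT => pky.
    (* [H] puts no constraint on the coefficient of [pi k]; this choice would force [1/2] to be an
       integer. *)
    have := Hy (fun i => if i == k then (2 * pi k y)^-1 else 0).
    rewrite big_ord_recr /= eqxx big1 ?add0r; last first.
      by move=> i _; rewrite ltn_eqF ?mul0r.
    rewrite invfM -mulrA mulVf// mulr1 => h; exfalso.
    have : (2^-1 : rat) \in Num.int.
      apply: h => h Hh; rewrite big_ord_recr /= eqxx (allz h)// mulr0 addr0 big1 ?rpred0//.
      by move=> i _; rewrite ltn_eqF ?mul0r.
    by [].
  have [|h Hh hy] := IH H y H0 Hsub Hint.
    move=> q hq.
    have := Hy (fun i => if i == k then 0 else q i).
    have E x : \sum_(i < k.+1) (if i == k :> nat then 0 else q i) * pi i x = \sum_(i < k) q i * pi i x.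
      rewrite big_ord_recr /= eqxx mul0r addr0; apply: eq_bigr => i _.
      by rewrite ltn_eqF.
    by rewrite E; apply => h Hh; rewrite E; exact: hq.
  exists h => // i; rewrite ltnS leq_eqVlt => /predU1P[->|]; last exact: hy.
  by rewrite allz.
move=> /existsNP[h0 /not_implyP[Hh0 ph0]].
(* The index is shifted by one so that the minimum over [nat] is the least positive value of [pi k]
   on [H]. *)
pose P (n : nat) := `[< exists2 h, H h & pi k h = n.+1%:R >].
have exP : exists n, P n.
  have /intrP[z zE] := Hint k _ Hh0.
  have z0 : z != 0 by apply: contra_notN ph0 => /eqP z0; rewrite zE z0.
  exists `|z|.-1%N; apply/asboolP; rewrite prednK ?absz_gt0//.
  have [zp|zn] := leP 0 z.
    by exists h0 => //; rewrite zE -[in LHS](gez0_abs zp).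
  exists (0 - h0); first exact: Hsub.
  by rewrite piB pi0 sub0r zE -rmorphN /= -[in LHS](ltz0_abs zn).
have [g0 /asboolP[e He eg] gmin] := ex_minnP exP.
pose g : rat := g0.+1%:R; have g_neq0 : g != 0 by rewrite pnatr_eq0.
have gdvd h : H h -> exists z : int, pi k h = z%:~R * g.
  move=> Hh; have /intrP[z zE] := Hint k _ Hh.
  exists (z %/ g0.+1)%Z.
  have zdm := divz_eq z g0.+1.
  suff m0 : (z %% g0.+1)%Z = 0 by rewrite zE {1}zdm m0 addr0 rmorphM.
  have m_ge0 : 0 <= (z %% g0.+1)%Z by exact: modz_ge0.
  have m_lt : (z %% g0.+1)%Z < g0.+1 by have := ltz_pmod z (isT : 0 < g0.+1%:Z).
  apply/eqP; apply: contraT => mn0.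
  case mE : (z %% g0.+1)%Z m_ge0 m_lt mn0 => [[|n]|//] // _ ltn _.
  have /gmin : P n.
    apply/asboolP; exists (h - e *~ (z %/ g0.+1)%Z); first by apply: (Hsub) => //; exact: subgroup_mulz.
    rewrite piB pizM eg zE {1}zdm mE rmorphD rmorphM /=.
    by rewrite -!pmulrn; ring.
  by move: ltn; rewrite ltz_nat; lia.
have [z zy] : exists z : int, pi k y = z%:~R * g.
  have := Hy (fun i => if i == k then g^-1 else 0).
  have E x : \sum_(i < k.+1) (if i == k :> nat then g^-1 else 0) * pi i x = g^-1 * pi k x.
    rewrite big_ord_recr /= eqxx big1 ?add0r// => i _; by rewrite ltn_eqF ?mul0r.
  rewrite E => h.
  have /intrP[z zE] : g^-1 * pi k y \in Num.int.
    apply: h => h Hh; rewrite E; have [z ->] := gdvd h Hh.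
    by rewrite mulrCA mulVf// mulr1 rpred_int.
  by exists z; rewrite -zE mulrAC mulVf// mul1r.
pose y' := y - e *~ z.
pose H' h := H h /\ pi k h = 0.
have [||i h []|q hq|h' [Hh' ph'] hy'] := IH H' y'.
- by split => //; exact: pi0.
- by move=> a b [Ha pa] [Hb pb]; split; [exact: Hsub|rewrite piB pa pb subrr].
- by move=> Hh _; exact: Hint.
- pose f x := \sum_(i < k) q i * pi i x.
  have fB a b : f (a - b) = f a - f b.
    by rewrite /f -sumrB; apply: eq_bigr => i _; rewrite piB mulrBr.
  have fM a t : f (a *~ t) = t%:~R * f a.
    by rewrite /f mulr_sumr; apply: eq_bigr => i _; rewrite pizM mulrCA.
  (* The coefficient of [pi k] is chosen so that the extended functional vanishes on [e]; it then
     only sees the component in the kernel of [pi k]. *)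
  have := Hy (fun i => if i == k then - (f e / g) else q i).
  have E x : \sum_(i < k.+1) (if i == k :> nat then - (f e / g) else q i) * pi i x = f x - f e / g * pi k x.
    rewrite big_ord_recr /= eqxx mulNr; congr (_ - _); apply: eq_bigr => i _.
    by rewrite ltn_eqF.
  have key x t : pi k x = t%:~R * g -> f x - f e / g * pi k x = f (x - e *~ t).
    by move=> ->; rewrite fB fM; field.
  rewrite E (key _ _ zy) => h; apply: h => h Hh; rewrite E.
  have [t tE] := gdvd h Hh; rewrite (key _ _ tE); apply: hq; split.
    by apply: (Hsub) => //; exact: subgroup_mulz.
  by rewrite piB pizM eg tE subrr.
exists (h' + e *~ z).
  rewrite -[e *~ z]opprK; apply: (Hsub) => //; rewrite -sub0r; apply: (Hsub) => //; exact: subgroup_mulz.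
move=> i; rewrite ltnS leq_eqVlt piD => /predU1P[->|/hy' ->].
  by rewrite ph' add0r pizM eg zy.
by rewrite piB subrK.
Qed.

End functionals.

(** * Duals of fractional ideals and stabilizers of torsion points *)

Section ideals.
Variables (R : realType) (L : fieldExtType rat) (r : nat).
Variable sigma : 'I_r -> {rmorphism L -> R}.
Hypothesis hdeg : \dim {: L} = r.
Hypothesis hsigma : injective sigma.

Local Notation Tr a := (TrR (embF sigma a)).

Lemma embmx_mul (v : 'I_r -> L) a : a != 0 -> \det (embmx sigma v) != 0 ->
  \det (embmx sigma (fun i => a * v i)) != 0.
Proof.
move=> a0 dv.
have -> : embmx sigma (fun i => a * v i) = diag_mx (\row_j sigma j a) *m embmx sigma v.
  by apply/matrixP => j i; rewrite mul_diag_mx !mxE rmorphM.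
rewrite det_mulmx mulf_neq0// det_diag prodf_seq_neq0; apply/allP => i _ /=.
by rewrite mxE fmorph_eq0.
Qed.

Lemma ideal_add (I : set L) : frac_ideal I -> forall a b, I a -> I b -> I (a + b).
Proof.
move=> [_ I0 IB _ _] a b Ia Ib; rewrite -[b]opprK; apply: (IB) => //.
by rewrite -sub0r; exact: IB.
Qed.

(** The family [w] is a rational basis scaled to integral elements and multiplied by the denominator
    [d], so it lies in the dual. [D] is the absolute determinant of the integral trace pairing
    between [w] and the elements [a0 * v i] of [I]; Cramer's rule then puts [D] times the dual in
    the span of [w]. The last clause is the same argument for the transposed pairing and detects
    divisibility by [m] inside [I]. *)
Lemma ideal_lattice (I : set L) : frac_ideal I -> exists (w : 'I_r -> L) (D : nat),
  [/\ (0 < D)%N,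
      forall i, dual sigma I (w i),
      \det (embmx sigma w) != 0,
      forall n, dual sigma I n -> exists z : 'cV[int]_r, D%:R * n = \sum_i (z i 0)%:~R * w i &
      forall (m : nat) b, (forall i, exists t : int, Tr (w i * b) = (m * D)%:R * t%:~R) ->
        exists2 b', I b' & b = m%:R * b'].
Proof.
move=> hI; have [[a0 [Ia0 a00]] I0 IB IM [d [d0 id dI]]] := hI.
have [b bb] := exists_basis hdeg.
pose m i := projT1 (cid2 (integral_scale (b`_i))).
have mP i : (0 < m i)%N /\ Defs.integral ((m i)%:R * b`_i).
  by rewrite /m; case: (cid2 _).
pose v (i : 'I_r) : L := (m i)%:R * b`_i.
have dv : \det (embmx sigma v) != 0.
  apply: (@embmx_scale _ _ _ sigma (fun i => b`_i) (fun i : 'I_r => (m i)%:R)).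
  - by move=> i; rewrite -[_%:R]/((m i)%:Z%:~R) intrL_eq0; have [] := mP i; case: (m i).
  - by move=> i; exists (m i)%:R; rewrite -in_alg_ratr scaler_nat.
  - exact: embmx_basis.
have iv i : Defs.integral (v i) by have [] := mP i.
pose w i := d * v i.
have dw : \det (embmx sigma w) != 0 by exact: embmx_mul.
have dav : \det (embmx sigma (fun i => a0 * v i)) != 0 by exact: embmx_mul.
have Iav i : I (a0 * v i) by rewrite mulrC; apply: IM.
have dualw i : dual sigma I (w i).
  move=> c Ic; rewrite /w (_ : d * v i * c = v i * (d * c)); last by ring.
  by apply: integral_Tr => //; apply: integralM => //; exact: dI.
pose Wz : 'M[int]_r := \matrix_(i, j) projT1 (cid (dualw j _ (Iav i))).
have WzE i j : (Wz i j)%:~R = Tr (w j * (a0 * v i)).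
  by rewrite mxE; case: (cid _) => z /= ->.
have detW : \det Wz != 0.
  rewrite -(intr_eq0 R) -det_map_mx.
  have -> : map_mx intr Wz = (embmx sigma (fun i => a0 * v i))^T *m embmx sigma w.
    apply/matrixP => i j; rewrite [LHS]mxE WzE !mxE; apply: eq_bigr => k _.
    by rewrite !mxE /embF rmorphM mulrC.
  by rewrite det_mulmx det_tr mulf_neq0.
pose D := `|\det Wz|%N.
have [s sD] : exists s : int, s * \det Wz = D%:Z.
  rewrite /D abszE; have [h|h] := leP 0 (\det Wz); first by exists 1; rewrite mul1r ger0_norm.
  by exists (-1); rewrite mulN1r ltr0_norm.
have solve (M : 'M[int]_r) (t : 'cV[int]_r) : \det M = \det Wz ->
    exists z : 'cV[int]_r, forall i, \sum_j M i j * z j 0 = D%:Z * t i 0.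
  move=> dM; exists (s *: (\adj M *m t)) => i.
  have : (M *m (s *: (\adj M *m t))) i 0 = D%:Z * t i 0.
    by rewrite -scalemxAr mulmxA mul_mx_adj mul_scalar_mx scalerA mxE dM sD.
  by rewrite mxE.
exists w, D; split => //.
- by rewrite absz_gt0.
- move=> n dn; pose t : 'cV[int]_r := \col_i projT1 (cid (dn _ (Iav i))).
  have tE i : (t i 0)%:~R = Tr (n * (a0 * v i)) by rewrite mxE; case: (cid _) => z /= ->.
  have [z zE] := solve Wz t erefl; exists z; apply/eqP; rewrite -subr_eq0; apply/eqP.
  apply: (Tr_nondeg hdeg dav) => i.
  rewrite mulrBl TrB -mulrA -[D%:R]/(D%:Z%:~R) TrZ mulr_suml Tr_sum -tE -intrM -zE.
  rewrite rmorph_sum -sumrB big1 // => j _.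
  by rewrite -mulrA TrZ -WzE /= intrM mulrC subrr.
- move=> k c /choice[t tE].
  have [z zE] := solve Wz^T (\col_i t i) (det_tr _).
  exists (\sum_j (z j 0)%:~R * (a0 * v j)).
    apply: big_ind; [exact: I0|exact: ideal_add|move=> j _].
    by apply: IM; [exact: integral_intr|exact: Iav].
  apply/eqP; rewrite -subr_eq0; apply/eqP; apply: (Tr_nondeg hdeg dw) => i.
  rewrite mulrBl TrB mulrC tE -mulrA -[k%:R]/(k%:Z%:~R) TrZ natrM -mulrA.
  have := zE i; rewrite mxE => /(congr1 (fun x : int => x%:~R : R)).
  rewrite intrM => h; rewrite -[D%:R]/(D%:Z%:~R) -h mulr_suml Tr_sum rmorph_sum -mulrBr -sumrB big1 ?mulr0// => j _.
  rewrite -mulrA TrZ [_ * w i]mulrC -WzE mxE /= intrM; ring.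
Qed.

(** A rational combination of the [w i] with integral traces against [I] belongs to the dual, so the
    assumption on [y] is the one required by [subgroup_separation] for the functionals
    [Tr (w i * _)]; these are jointly injective by nondegeneracy. *)
Lemma bidual (I : set L) y : frac_ideal I ->
  (forall n, dual sigma I n -> is_int (Tr (n * y))) -> I y.
Proof.
move=> hI hy; have [_ I0 IB IM _] := hI.
have [w [D [D0 dw detw lw _]]] := ideal_lattice hI.
pose trQ a : rat := projT1 (cid (TrN_rat hdeg hsigma a)).
have trQE a : ratr (trQ a) = Tr a.
  by rewrite /trQ; case: (cid _) => t /= [n [-> _]].
have trQB a b : trQ (a - b) = trQ a - trQ b.
  by apply: (fmorph_inj (ratr : {rmorphism rat -> R})); rewrite rmorphB /= !trQE TrB.
have trQZ (q : rat) a : trQ (q *: a) = q * trQ a.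
  apply: (fmorph_inj (ratr : {rmorphism rat -> R})); rewrite rmorphM /= !trQE.
  by rewrite /TrR mulr_sumr; apply: eq_bigr => j _; rewrite /embF rmorphZ.
have trQsum (f : 'I_r -> L) : trQ (\sum_i f i) = \sum_i trQ (f i).
  apply: (fmorph_inj (ratr : {rmorphism rat -> R})); rewrite rmorph_sum /= trQE Tr_sum.
  by apply: eq_bigr => i _; rewrite trQE.
have intE a : is_int (Tr a) <-> trQ a \in Num.int.
  split; first by move=> [z zE]; apply/intrP; exists z; apply: (fmorph_inj (ratr : {rmorphism rat -> R})); rewrite /= trQE zE ratr_int.
  by move=> /intrP[z zE]; exists z; rewrite -trQE zE ratr_int.
pose o := Ordinal (degree_gt0 hdeg).
pose W i := w (insubd o i).
have WE (i : 'I_r) : W i = w i by rewrite /W valKd.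
have [|||||h Ih hE] := @subgroup_separation L (fun i a => trQ (W i * a)) _ r I y => //.
- by move=> i a b; rewrite mulrBr trQB.
- by move=> i a Ia; apply/intE; exact: dw.
- move=> q.
  have E x : \sum_(i < r) q i * trQ (W i * x) = trQ ((\sum_(i < r) q i *: w i) * x).
    rewrite mulr_suml trQsum; apply: eq_bigr => i _.
    by rewrite -scalerAl trQZ WE.
  rewrite E => hq; apply/intE; apply: hy => b Ib; apply/intE; rewrite -E; exact: hq.
suff <- : h = y by [].
apply/eqP; rewrite -subr_eq0; apply/eqP; apply: (Tr_nondeg hdeg detw) => i.
rewrite mulrBl TrB -!trQE -(mulrC (w i)) -(mulrC (w i)) -WE; have /= -> := hE i (ltn_ord i).
by rewrite subrr.
Qed.

Lemma dual_mul (I : set L) e n : frac_ideal I -> Defs.integral e -> dual sigma I n ->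
  dual sigma I (e * n).
Proof.
move=> [_ _ _ IM _] ie dn b Ib; rewrite -mulrA mulrCA; apply: dn; exact: IM.
Qed.

Lemma dual_sub (I : set L) a b : dual sigma I a -> dual sigma I b -> dual sigma I (a - b).
Proof.
move=> da db c Ic; rewrite mulrBl TrB.
have [z ->] := da c Ic; have [t ->] := db c Ic.
by exists (z - t); rewrite rmorphB.
Qed.

(** The norms of [e] and of its inverse are integers with product [1], and total positivity excludes
    [-1]. *)
Lemma tot_pos_unit_NR e : tot_pos_unit sigma e -> NR (embF sigma e) = 1.
Proof.
move=> [e0 ie ie' pe].
have [z zE] := integral_NR hdeg hsigma ie; have [t tE] := integral_NR hdeg hsigma ie'.
have p : 0 < NR (embF sigma e) by apply: prodr_gt0 => j _; exact: pe.
have : NR (embF sigma e) * NR (embF sigma e^-1) = 1.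
  rewrite /NR -big_split /= big1// => j _.
  by rewrite /embF fmorphV mulfV// fmorph_eq0.
rewrite tE zE -intrM => /eqP; rewrite -[X in _ == X]/(1%:~R) eqr_int => /eqP zt.
have zp : 0 < z by move: p; rewrite zE ltr0z.
suff -> : z = 1 by [].
have tp : 0 < t by rewrite -(pmulr_rgt0 _ zp) zt.
nia.
Qed.

Lemma tot_pos_unitM e f : tot_pos_unit sigma e -> tot_pos_unit sigma f ->
  tot_pos_unit sigma (e * f).
Proof.
move=> [e0 ie ie' pe] [f0 if_ if' pf]; split.
- by rewrite mulf_neq0.
- exact: integralM.
- by rewrite invfM; exact: integralM.
- by move=> j; rewrite rmorphM mulr_gt0.
Qed.

Lemma tot_pos_unitV e : tot_pos_unit sigma e -> tot_pos_unit sigma e^-1.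
Proof.
move=> [e0 ie ie' pe]; split; rewrite ?invr_eq0 ?invrK//.
by move=> j; rewrite fmorphV invr_gt0.
Qed.

Lemma tot_pos_unit1 : tot_pos_unit sigma 1.
Proof.
split; rewrite ?oner_neq0 ?invr1//; try exact: (integral_intr L 1).
by move=> j; rewrite rmorph1.
Qed.

Lemma torsion_point (I : set L) x : torsion sigma I x ->
  exists (m : nat) b, [/\ (0 < m)%N, I b & forall j, x j = sigma j (b / m%:R)].
Proof.
move=> [m m0 [b Ib E]]; exists m, b; split => // j.
have := E j; rewrite subr0 => h; rewrite fmorph_div rmorph_nat -h mulrC mulKf//.
by rewrite pnatr_eq0 -lt0n.
Qed.

Lemma congr_modP (I : set L) (y : 'I_r -> R) (a : L) c : (forall j, y j - c j = sigma j a) ->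
  congr_mod sigma I y c <-> I a.
Proof.
move=> ya; split; last by move=> Ia; exists a.
move=> [b Ib E]; suff -> : a = b by [].
apply: (fmorph_inj (sigma (Ordinal (degree_gt0 hdeg)))); by rewrite -ya E.
Qed.

(** Units are sorted by the residues modulo [m * D] of the traces of [w i * (e * b)]. If [e] and [t]
    have the same residues, the divisibility clause of [ideal_lattice] puts [(e - t) * b] in [m I],
    so [e / t] fixes [x]; there are finitely many residue vectors. *)
Lemma exists_stabilizer (I : set L) x : frac_ideal I -> torsion sigma I x ->
  exists U, fin_index_subgroup sigma U /\ fixed_by sigma I U x.
Proof.
move=> hI /torsion_point[m [b [m0 Ib xE]]]; have [_ I0 IB IM _] := hI.
have mL : (m%:R : L) != 0 by rewrite -[_%:R]/(m%:Z%:~R) intrL_eq0; case: (m) m0.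
pose y := b / m%:R.
have fixE e : congr_mod sigma I (actF sigma e x) x <-> I ((e - 1) * y).
  by apply: congr_modP => j; rewrite /actF xE -/y [in RHS]rmorphM [in RHS]rmorphB rmorph1; ring.
have [w [D [D0 dw detw _ lI]]] := ideal_lattice hI.
pose U e := tot_pos_unit sigma e /\ I ((e - 1) * y).
exists U; split; last by move=> e [_ /fixE].
split.
- by move=> e [].
- by split; [exact: tot_pos_unit1|rewrite subrr mul0r].
- move=> e f [te Ie] [tf If]; split; first exact: tot_pos_unitM.
  rewrite (_ : _ * y = f * ((e - 1) * y) + (f - 1) * y); last by ring.
  by apply: ideal_add => //; apply: IM => //; case: tf.
- move=> e [te Ie]; split; first exact: tot_pos_unitV.
  have e0 : e != 0 by case: te.
  rewrite (_ : _ * y = 0 - e^-1 * ((e - 1) * y)); last by field.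
  by apply: IB => //; apply: IM => //; case: te.
pose q := (m * D)%N; have q0 : (0 < q)%N by rewrite muln_gt0 m0.
pose res e (c : {ffun 'I_r -> 'I_q}) :=
  forall i, exists z : int, Tr (w i * (e * b)) = (c i : nat)%:R + q%:R * z%:~R.
have exres e : tot_pos_unit sigma e -> exists c, res e c.
  move=> [_ ie _ _].
  have h i : exists z : int, Tr (w i * (e * b)) = z%:~R by apply: dw; exact: IM.
  have lt_q i : (`|(projT1 (cid (h i)) %% q)%Z| < q)%N.
    by have := ltz_pmod (projT1 (cid (h i))) (q0 : 0 < q%:Z); have := modz_ge0 (projT1 (cid (h i))) (lt0r_neq0 (q0 : 0 < q%:Z)); lia.
  exists [ffun i => Ordinal (lt_q i)] => i; rewrite ffunE /=.
  move: (lt_q i) => _; case: (cid (h i)) => z /= ->.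
  exists (z %/ q)%Z; rewrite -[_%:R]/((`|(z %% q)%Z|%N)%:Z%:~R) gez0_abs ?modz_ge0 ?lt0r_neq0//.
  by rewrite {1}(divz_eq z q) intrD intrM addrC [X in _ + X]mulrC.
(* One unit is chosen for each residue vector that occurs; the default [1] fills the others. *)
pose rep c := if pselect (exists e, tot_pos_unit sigma e /\ res e c) is left h
  then projT1 (cid h) else 1.
exists [seq rep c | c <- enum {ffun 'I_r -> 'I_q}] => e te.
have [c ec] := exres e te; exists (rep c); first by apply: map_f; rewrite mem_enum.
rewrite /rep; case: pselect => [h|[]]; last by exists e.
case: (cid h) => t /= [tt tc].
have t0 : t != 0 by case: tt.
exists (t^-1 * e); last by rewrite mulVKf.
split; first by apply: tot_pos_unitM => //; exact: tot_pos_unitV.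
have [i|b' Ib' bE] := lI m ((e - t) * b).
  have [z zE] := ec i; have [z' zE'] := tc i; exists (z - z').
  by rewrite mulrBl mulrBr TrB zE zE' intrB -/q; move: (q%:R : R) => Q; ring.
have -> : (t^-1 * e - 1) * y = t^-1 * b'.
  apply: (mulfI mL); rewrite [RHS]mulrCA -bE /y; by field; rewrite ?mL ?t0.
by apply: IM => //; case: tt.
Qed.

End ideals.

(** * Integrals over the unit cube and absolutely convergent sums *)

Section cube.
Variable R : realType.
Local Notation mR := (measurableTypeR R).
Local Notation mu := (@lebesgue_measure R).

Definition incube n (y : 'cV[R]_n) := forall i, 0 <= y i 0 <= 1.

Lemma incube_ccons n t (y : 'cV[R]_n) : 0 <= t <= 1 -> incube y -> incube (ccons t y).
Proof.
by move=> t01 hy i; case: (unliftP ord0 i) => [j|] ->; rewrite ?cconsES ?cconsE0.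
Qed.

Fixpoint cint n : ('cV[R]_n -> R) -> R :=
  match n with
  | 0 => fun f => f 0
  | n'.+1 => fun f => Rintegral mu `[0, 1] (fun t => cint (fun y : 'cV[R]_n' => f (ccons t y)))
  end.

Definition seqv n (y : 'cV[R]_n) : seq R := [seq y i 0 | i <- enum 'I_n].

Lemma cube_integralE n (F : seq R -> R) : cube_integral n F = cint (fun y : 'cV[R]_n => F (seqv y)).
Proof.
elim: n F => [|n IH] F /=.
  by congr F; apply/esym/size0nil; rewrite size_map size_enum_ord.
apply: eq_Rintegral => t _; rewrite IH; congr cint; apply/funext => y; congr F.
rewrite /seqv enum_ordSl /= cconsE0 -map_comp; congr (_ :: _).
by apply: eq_map => i /=; rewrite cconsES.
Qed.

Lemma nth_seqv n (y : 'cV[R]_n) (k : 'I_n) : nth 0 (seqv y) k = y k 0.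
Proof. by rewrite (nth_map k) ?size_enum_ord// nth_ord_enum. Qed.

Definition jmeasR d (X : measurableType d) n (f : X -> 'cV[R]_n -> R) :=
  jmeas (fun x y => (f x y)%:E).

Definition cmeasR n (f : 'cV[R]_n -> R) := cmeas (fun y => (f y)%:E).

(** The integrand has no sign, so its positive and negative parts are integrated separately; [fine]
    keeps the statement meaningful without integrability. *)
Lemma jmeasR_cint d (X : measurableType d) n (f : X -> 'cV[R]_n -> R) :
  jmeasR f -> measurable_fun setT (fun x => cint (f x)).
Proof.
elim: n d X f => [|n IH] d X f jf /=; first exact/measurable_EFinP/(jmeas_measurable 0 jf).
have mh : measurable_fun setT (fun z : X * mR => cint (fun y => f z.1 (ccons z.2 y))).
  by apply: (IH _ (X * mR)%type); exact: (@jmeas_ccons _ _ _ _ (fun x y => (f x y)%:E)).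
set h := (fun z : X * mR => _) in mh.
have mh' : measurable_fun setT (fun z : X * mR => (h z)%:E) by exact/measurable_EFinP.
rewrite /Rintegral; apply: (measurableT_comp (@fine_measurable R setT measurableT)).
rewrite (_ : (fun x => _) = (fun x => \int[mu]_(t in `[0%R, 1%R]) ((fun z => (h z)%:E)^\+ (x, t)) -
   \int[mu]_(t in `[0%R, 1%R]) ((fun z => (h z)%:E)^\- (x, t))))%E; last first.
  apply/funext => x; rewrite [LHS]integralE.
  by congr (_ - _)%E; apply: eq_integral => t _; rewrite ?funeposE ?funenegE.
apply: emeasurable_funB; apply: measurable_integral_param => //.
- exact: measurable_funepos.
- exact: measurable_funeneg.
Qed.

Lemma cmeasR_section n (f : 'cV[R]_n.+1 -> R) t : cmeasR f -> cmeasR (fun y => f (ccons t y)).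
Proof. by move=> cf; exact: (jmeas_cmeas t (cmeas_ccons cf)). Qed.

Lemma cmeasR_cint n (f : 'cV[R]_n.+1 -> R) : cmeasR f ->
  measurable_fun setT (fun t : mR => cint (fun y => f (ccons t y))).
Proof.
move=> cf; apply: (@jmeasR_cint _ mR _ (fun t y => f (ccons t y))).
exact: (cmeas_ccons cf).
Qed.

Lemma mu01 : mu `[0%R, 1%R] = 1%E.
Proof. by rewrite lebesgue_measure_itv/= lte_fin ltr01 -EFinB subr0. Qed.

Lemma integrable01 (f : mR -> R) C : measurable_fun setT f ->
  (forall t, 0 <= t <= 1 -> `|f t| <= C) -> mu.-integrable `[0, 1] (EFin \o f).
Proof.
move=> mf fC; apply: measurable_bounded_integrable => //.
- by rewrite [X in (X < _)%E](_ : _ = 1%E) ?ltry//; exact: mu01.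
- exact: measurable_funTS.
- exists C; split; first exact: num_real.
  by move=> x Cx t /=; rewrite in_itv/= => /fC h; apply: le_trans h _; exact: ltW.
Qed.

Lemma normr_cint n (f : 'cV[R]_n -> R) C : cmeasR f ->
  (forall y, incube y -> `|f y| <= C) -> `|cint f| <= C.
Proof.
elim: n f => [|n IH] f cf fC /=; first by apply: fC => -[].
have b t : 0 <= t <= 1 -> `|cint (fun y => f (ccons t y))| <= C.
  move=> t01; apply: IH; first exact: cmeasR_section.
  by move=> y hy; apply: fC; exact: incube_ccons.
have i := integrable01 (cmeasR_cint cf) b.
apply: (le_trans (le_normr_Rintegral _ i)) => //.
apply: (@le_trans _ _ (Rintegral mu `[0, 1] (fun=> C))).
  apply: le_Rintegral => //.
  - by apply: (@integrable01 (fun t => `|_|) C) => [|t /b]; [apply: measurableT_comp => //; exact: cmeasR_cint|rewrite normr_id].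
  - by apply: (@integrable01 (fun=> C) `|C|).
by rewrite Rintegral_cst//= mu01 mulr1.
Qed.

Lemma cint_cst n (c : R) : cint (fun _ : 'cV[R]_n => c) = c.
Proof.
elim: n => //= n IH; under eq_Rintegral do rewrite IH.
by rewrite Rintegral_cst//= mu01 mulr1.
Qed.

Lemma cintB n (f g : 'cV[R]_n -> R) C : cmeasR f -> cmeasR g ->
  (forall y, incube y -> `|f y| <= C) -> (forall y, incube y -> `|g y| <= C) ->
  cint (fun y => f y - g y) = cint f - cint g.
Proof.
elim: n f g => [|n IH] f g cf cg fC gC //=.
have hf t : 0 <= t <= 1 -> forall y, incube y -> `|f (ccons t y)| <= C.
  by move=> t01 y hy; apply: fC; exact: incube_ccons.
have hg t : 0 <= t <= 1 -> forall y, incube y -> `|g (ccons t y)| <= C.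
  by move=> t01 y hy; apply: gC; exact: incube_ccons.
rewrite -RintegralB//.
- apply: eq_Rintegral => t; rewrite inE/= in_itv/= => t01.
  by apply: IH; [exact: cmeasR_section|exact: cmeasR_section|exact: hf|exact: hg].
- apply: (@integrable01 _ C); first exact: cmeasR_cint.
  by move=> t t01; apply: normr_cint; [exact: cmeasR_section|exact: hf].
- apply: (@integrable01 _ C); first exact: cmeasR_cint.
  by move=> t t01; apply: normr_cint; [exact: cmeasR_section|exact: hg].
Qed.

(** Dominated convergence one variable at a time: a constant bound survives integration over the
    unit interval, so it dominates the inner integrals as well. *)
Lemma cvg_cint n (f_ : nat -> 'cV[R]_n -> R) (f : 'cV[R]_n -> R) C :
  (forall k, cmeasR (f_ k)) -> cmeasR f ->
  (forall k y, incube y -> `|f_ k y| <= C) ->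
  (forall y, incube y -> f_ k y @[k --> \oo] --> f y) ->
  cint (f_ k) @[k --> \oo] --> cint f.
Proof.
elim: n f_ f => [|n IH] f_ f cf_ cf fC fc /=; first by apply: fc => -[].
have b k t : 0 <= t <= 1 -> `|cint (fun y => f_ k (ccons t y))| <= C.
  move=> t01; apply: normr_cint; first exact: cmeasR_section.
  by move=> y hy; apply: fC; exact: incube_ccons.
have [] := @dominated_convergence _ mR R mu `[0, 1]%classic (measurable_itv _)
  (fun k t => (cint (fun y => f_ k (ccons t y)))%:E)
  (fun t => (cint (fun y => f (ccons t y)))%:E) (fun=> C%:E).
- by move=> k; apply: measurable_funTS; apply/measurable_EFinP; exact: cmeasR_cint.
- by apply: measurable_funTS; apply/measurable_EFinP; exact: cmeasR_cint.
- apply: aeW => t /=; rewrite in_itv/= => t01; apply: cvg_EFin; first by near=> k.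
  apply: IH.
  + by move=> k; exact: cmeasR_section.
  + exact: cmeasR_section.
  + by move=> k y hy; apply: fC; exact: incube_ccons.
  + by move=> y hy; apply: fc; exact: incube_ccons.
- by apply: (@integrable01 (fun=> C) `|C|).
- by apply: aeW => t k /=; rewrite in_itv/= lee_fin; exact: b.
move=> i _ h; apply/fine_cvg; rewrite fineK//; exact: integrable_fin_num i.
Unshelve. all: end_near. Qed.

Lemma iint_cint n (f : 'cV[R]_n -> R) C : cmeasR f -> (forall y, 0 <= f y) ->
  (forall y, incube y -> f y <= C) ->
  iint `[0, 1]%classic (fun y => (f y)%:E) = (cint f)%:E.
Proof.
elim: n f => [|n IH] f cf f0 fC //=.
rewrite /Rintegral fineK.
  apply: eq_integral => t; rewrite inE/= in_itv/= => t01; rewrite IH//.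
    exact: cmeasR_section.
  by move=> y hy; apply: fC; exact: incube_ccons.
apply: integrable_fin_num => //; apply: (@integrable01 _ C); first exact: cmeasR_cint.
move=> t t01; apply: normr_cint; first exact: cmeasR_section.
by move=> y hy; rewrite ger0_norm//; apply: fC; exact: incube_ccons.
Qed.

End cube.

(** * Absolutely convergent signed sums and dominated convergence *)

Section absolute_sums.
Variable R : realType.
Local Open Scope ereal_scope.

(** Since [max (a - b) 0 + b = a + max (b - a) 0], any nonnegative decomposition with finite sums
    may replace the positive and negative parts in [abs_sum]. *)
Lemma abs_sumB (T : choiceType) (D : set T) (a b : T -> R) :
  (forall i, 0 <= a i)%R -> (forall i, 0 <= b i)%R ->
  \esum_(i in D) (a i)%:E < +oo -> \esum_(i in D) (b i)%:E < +oo ->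
  abs_sum D (fun i => a i - b i)%R =
  (fine (\esum_(i in D) (a i)%:E) - fine (\esum_(i in D) (b i)%:E))%R.
Proof.
move=> a0 b0 sa sb.
have ea0 i : 0 <= (a i)%:E by rewrite lee_fin.
have eb0 i : 0 <= (b i)%:E by rewrite lee_fin.
have h1 i : 0 <= (Num.max (a i - b i) 0)%R%:E by rewrite lee_fin le_max lexx orbT.
have h2 i : 0 <= (Num.max (- (a i - b i)) 0)%R%:E by rewrite lee_fin le_max lexx orbT.
have l1 : \esum_(i in D) (Num.max (a i - b i) 0)%R%:E < +oo.
  apply: le_lt_trans sa; apply: le_esum => i _; rewrite lee_fin ge_max a0 andbT.
  by rewrite gerBl.
have l2 : \esum_(i in D) (Num.max (- (a i - b i)) 0)%R%:E < +oo.
  apply: le_lt_trans sb; apply: le_esum => i _; rewrite lee_fin ge_max b0 andbT.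
  by rewrite opprB gerBl.
have f1 : \esum_(i in D) (Num.max (a i - b i) 0)%R%:E \is a fin_num by rewrite ge0_fin_numE// esum_ge0.
have f2 : \esum_(i in D) (Num.max (- (a i - b i)) 0)%R%:E \is a fin_num by rewrite ge0_fin_numE// esum_ge0.
have f3 : \esum_(i in D) (a i)%:E \is a fin_num by rewrite ge0_fin_numE// esum_ge0.
have f4 : \esum_(i in D) (b i)%:E \is a fin_num by rewrite ge0_fin_numE// esum_ge0.
have : \esum_(i in D) (Num.max (a i - b i) 0)%R%:E + \esum_(i in D) (b i)%:E =
  \esum_(i in D) (a i)%:E + \esum_(i in D) (Num.max (- (a i - b i)) 0)%R%:E.
  rewrite -!esumD//; apply: eq_esum => i _; rewrite -!EFinD; congr (_%:E).
  rewrite !maxEle; case: ifP => h; case: ifP => h'; lra.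
move=> /(congr1 fine); rewrite !fineD// /abs_sum; lra.
Qed.

Lemma abs_sum_le (T : choiceType) (D : set T) (f M : T -> R) :
  (forall i, D i -> `|f i| <= M i)%R -> \esum_(i in D) (M i)%:E < +oo ->
  (`|abs_sum D f| <= fine (\esum_(i in D) (M i)%:E))%R.
Proof.
move=> fM sM.
have M0 i : D i -> 0 <= (M i)%:E by move=> Di; rewrite lee_fin (le_trans _ (fM i Di)).
have h1 i : 0 <= (Num.max (f i) 0)%R%:E by rewrite lee_fin le_max lexx orbT.
have h2 i : 0 <= (Num.max (- f i) 0)%R%:E by rewrite lee_fin le_max lexx orbT.
have fnM : \esum_(i in D) (M i)%:E \is a fin_num by rewrite ge0_fin_numE// esum_ge0.
have bnd (g : T -> R) : (forall i, D i -> g i <= M i)%R -> (forall i, 0 <= g i)%R ->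
    (0 <= fine (\esum_(i in D) (g i)%:E) <= fine (\esum_(i in D) (M i)%:E))%R.
  move=> gM g0; have g0' : 0 <= \esum_(i in D) (g i)%:E by apply: esum_ge0 => i _; rewrite lee_fin.
  have le : \esum_(i in D) (g i)%:E <= \esum_(i in D) (M i)%:E.
    by apply: le_esum => i Di; rewrite lee_fin gM.
  rewrite fine_ge0//= fine_le// ge0_fin_numE//; exact: le_lt_trans le sM.
have b1 := bnd (fun i => Num.max (f i) 0)%R; have b2 := bnd (fun i => Num.max (- f i) 0)%R.
rewrite /abs_sum ler_norml.
have {b1} /andP[? ?] : (0 <= fine (\esum_(i in D) (Num.max (f i) 0)%R%:E) <= fine (\esum_(i in D) (M i)%:E))%R.
  apply: b1 => [i Di|i]; last by rewrite le_max lexx orbT.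
  by have := fM i Di; rewrite ler_norml ge_max => /andP[? ->] /=; rewrite (le_trans _ (fM i Di)).
have {b2} /andP[? ?] : (0 <= fine (\esum_(i in D) (Num.max (- f i) 0)%R%:E) <= fine (\esum_(i in D) (M i)%:E))%R.
  apply: b2 => [i Di|i]; last by rewrite le_max lexx orbT.
  by have := fM i Di; rewrite ler_norml ge_max lerNl => /andP[-> ?] /=; rewrite (le_trans _ (fM i Di)).
apply/andP; split; lra.
Qed.

(** Dominated convergence for the counting measure on [nat], after an enumeration of the index set
    whose empty slots carry the value [0]. *)
Lemma cvg_esum (T : choiceType) (D : set T) (f_ : nat -> T -> R) (f M : T -> R) :
  injnat D -> (forall k i, 0 <= f_ k i)%R -> (forall i, 0 <= f i)%R -> (forall i, 0 <= M i)%R ->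
  (forall k i, D i -> f_ k i <= M i)%R -> \esum_(i in D) (M i)%:E < +oo ->
  (forall i, D i -> (f_ k i @[k --> \oo] --> f i)%classic) ->
  (fine (\esum_(i in D) (f_ k i)%:E) @[k --> \oo] --> fine (\esum_(i in D) (f i)%:E))%classic.
Proof.
move=> [h injh] f_0 f0 M0 fM sM fc.
have [g gD gE] := esum_enum R injh.
pose ext (a : T -> R) (j : nat) : \bar R := oapp (fun i => (a i)%:E) 0 (g j).
have extE a : (forall i, 0 <= a i)%R -> \esum_(i in D) (a i)%:E = \int[counting]_j ext a j.
  move=> a0; rewrite gE; last by move=> i; rewrite lee_fin.
  rewrite ge0_integral_count// => j; rewrite /ext; by case: (g j) => //= i; rewrite lee_fin.
have mnat (a : nat -> \bar R) : measurable_fun setT a by [].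
have ext0 a j : (forall i, 0 <= a i)%R -> 0 <= ext a j.
  by move=> a0; rewrite /ext; case: (g j) => //= i; rewrite lee_fin.
have [] := @dominated_convergence _ _ R counting setT measurableT (fun k => ext (f_ k)) (ext f) (ext M).
- by [].
- by [].
- apply: aeW => j _; rewrite /ext; case gj: (g j) => [i|]/=; last exact: cvg_cst.
  by apply: cvg_EFin; [near=> k|apply: fc; exact: gD gj].
- apply/integrableP; split => //; under eq_integral => j _ do rewrite gee0_abs ?ext0//.
  by rewrite -extE.
- apply: aeW => j k _; rewrite gee0_abs ?ext0// /ext; case gj: (g j) => [i|]//=.
  by rewrite lee_fin fM//; exact: gD gj.
move=> i _ c; rewrite extE//; under eq_fun do rewrite extE//.
apply/fine_cvg; rewrite fineK//; exact: integrable_fin_num i.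
Unshelve. all: end_near. Qed.

Lemma cvg_max0 (u : nat -> R) (l : R) : (u k @[k --> \oo] --> l)%classic ->
  (Num.max (u k) 0%R @[k --> \oo] --> Num.max l 0%R)%classic.
Proof.
move=> ul; have mE (x : R) : Num.max x 0%R = ((x + `|x|) * 2^-1)%R.
  by rewrite maxr_absE addr0 subr0.
rewrite mE; under eq_fun do rewrite mE.
by apply: (cvgM _ (cvg_cst _)); apply: cvgD => //; exact: cvg_norm.
Qed.

Lemma cvg_abs_sum (T : choiceType) (D : set T) (f_ : nat -> T -> R) (f M : T -> R) :
  injnat D -> (forall i, 0 <= M i)%R ->
  (forall k i, D i -> `|f_ k i| <= M i)%R -> \esum_(i in D) (M i)%:E < +oo ->
  (forall i, D i -> (f_ k i @[k --> \oo] --> f i)%classic) ->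
  (abs_sum D (f_ k) @[k --> \oo] --> abs_sum D f)%classic.
Proof.
move=> iD M0 fM sM fc; rewrite /abs_sum; apply: cvgB; apply: (@cvg_esum _ _ _ _ M) => //.
- by move=> k i; rewrite le_max lexx orbT.
- by move=> i; rewrite le_max lexx orbT.
- by move=> k i Di; have := fM k i Di; rewrite ge_max M0 andbT ler_norml => /andP[].
- by move=> i Di; apply: cvg_max0; exact: fc.
- by move=> k i; rewrite le_max lexx orbT.
- by move=> i; rewrite le_max lexx orbT.
- by move=> k i Di; have := fM k i Di; rewrite ge_max M0 andbT lerNl ler_norml => /andP[].
- by move=> i Di; apply: cvg_max0; apply: cvgN; exact: fc.
Qed.

End absolute_sums.

(** * Comparison of lattice sums with integrals *)

Section estimates.
Variables (R : realType) (r : nat).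
Hypothesis r_gt0 : (0 < r)%N.

Let r0 : 0 < r%:R :> R. Proof. by rewrite ltr0n. Qed.

Definition enorm (u : 'I_r -> R) (v : 'cV[R]_r) : R := eucl_norm (actR u (fun j => v j 0)).
(* Cutting the norm off at a small [kappa] removes the singularity at [0]
   without changing the values on a lattice. *)
Definition rho (kappa : R) (u : 'I_r -> R) (v : 'cV[R]_r) : R := Num.max kappa (enorm u v).
Definition mx (v : 'cV[R]_r) : R := \big[Num.max/1]_(j < r) `|v j 0|.

Lemma mx_ge1 (v : 'cV[R]_r) : 1 <= mx v. Proof. exact: bigmax_ge_id. Qed.
Lemma mx_ge (v : 'cV[R]_r) j : `|v j 0| <= mx v. Proof. exact: le_bigmax. Qed.
Lemma mx_le (v : 'cV[R]_r) M : 1 <= M -> (forall j, `|v j 0| <= M) -> mx v <= M.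
Proof. by move=> M1 vM; apply: bigmax_le. Qed.
Lemma mx_gt0 (v : 'cV[R]_r) : 0 < mx v. Proof. exact: lt_le_trans (mx_ge1 v). Qed.

Lemma mx_shift (v v' : 'cV[R]_r) M : 0 <= M -> (forall j, `|v j 0 - v' j 0| <= M) ->
  mx v <= (1 + M) * mx v'.
Proof.
move=> M0 vM; have m1 := mx_ge1 v'.
apply: mx_le => [|j]; first by nra.
have := vM j; have := mx_ge v' j; have := ler_normD (v j 0 - v' j 0) (v' j 0).
by rewrite subrK; nra.
Qed.

Lemma enorm_ge0 u v : 0 <= enorm u v. Proof. exact: sqrtr_ge0. Qed.

Lemma enorm_ge u (v : 'cV[R]_r) j : `|u j * v j 0| <= enorm u v.
Proof.
rewrite -sqrtr_sqr /enorm /eucl_norm ler_sqrt; last by apply: sumr_ge0 => i _; exact: sqr_ge0.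
rewrite (bigD1 j)//= /actR lerDl; apply: sumr_ge0 => i _; exact: sqr_ge0.
Qed.

Lemma rho_ge kappa u (v : 'cV[R]_r) lo : 0 < kappa <= 1 -> 0 < lo -> (forall j, lo <= u j) ->
  Num.min lo kappa * mx v <= rho kappa u v.
Proof.
move=> /andP[k0 k1] l0 lu.
have c0 : 0 < Num.min lo kappa by rewrite lt_min l0.
rewrite mulrC -ler_pdivlMr//; apply: mx_le => [|j].
  rewrite ler_pdivlMr// mul1r; apply: (@le_trans _ _ kappa); first by rewrite ge_min lexx orbT.
  by rewrite le_max lexx.
rewrite ler_pdivlMr//; apply: (@le_trans _ _ (enorm u v)); last by rewrite le_max lexx orbT.
apply: le_trans (enorm_ge u v j); rewrite normrM mulrC ler_wpM2r//.
apply: (@le_trans _ _ lo); first by rewrite ge_min lexx.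
by apply: le_trans (lu j) _; exact: ler_norm.
Qed.

Lemma enorm_lip u (v v' : 'cV[R]_r) : `|enorm u v - enorm u v'| <= \sum_j `|u j * (v j 0 - v' j 0)|.
Proof.
have [/eqP|n0] := eqVneq (enorm u v + enorm u v') 0.
  rewrite paddr_eq0 ?enorm_ge0// => /andP[/eqP -> /eqP ->].
  by rewrite subrr normr0; apply: sumr_ge0.
have p : 0 < enorm u v + enorm u v' by rewrite lt_neqAle eq_sym n0 addr_ge0 ?enorm_ge0.
rewrite -(ler_pM2r p) -{1}(gtr0_norm p) -normrM -subr_sqr.
rewrite /enorm /eucl_norm !sqr_sqrtr; try by apply: sumr_ge0 => i _; exact: sqr_ge0.
rewrite -sumrB; apply: (le_trans (ler_norm_sum _ _ _)).
rewrite mulr_suml; apply: ler_sum => j _; rewrite subr_sqr normrM /actR -mulrBr.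
apply: ler_wpM2l => //; apply: (le_trans (ler_normD _ _)).
by apply: lerD; exact: enorm_ge.
Qed.

Lemma rho_lip kappa u (v v' : 'cV[R]_r) hi M : (forall j, 0 <= u j <= hi) -> 0 <= M ->
  (forall j, `|v j 0 - v' j 0| <= M) -> `|rho kappa u v - rho kappa u v'| <= r%:R * (hi * M).
Proof.
move=> uh M0 vM.
apply: (@le_trans _ _ `|enorm u v - enorm u v'|).
  rewrite /rho !maxEle; case: ifP => h; case: ifP => h'; rewrite ?subrr ?normr0//.
  - by move/negbT: h'; rewrite -ltNge => h'; rewrite !ger0_norm; lra.
  - by move/negbT: h; rewrite -ltNge => h; rewrite !ler0_norm; lra.
apply: (le_trans (enorm_lip _ _ _)).
apply: (@le_trans _ _ (\sum_(j < r) (hi * M))); last by rewrite sumr_const card_ord mulr_natl.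
apply: ler_sum => j _; rewrite normrM; have /andP[u0 u1] := uh j.
by apply: ler_pM => //; rewrite ger0_norm.
Qed.

Lemma bernoulli_le (x : R) k : 0 <= x <= 1 -> 1 - k%:R * (1 - x) <= x ^+ k.
Proof.
move=> /andP[x0 x1]; elim: k => [|k IH]; first by rewrite mul0r subr0 expr0.
rewrite exprS -natr1.
have xk1 : x ^+ k <= 1 by exact: exprn_ile1.
have xk0 : 0 <= x ^+ k by exact: exprn_ge0.
have k0 : 0 <= k%:R :> R by [].
nra.
Qed.

(** With [x = a / b <= 1] one has [1 - x ^ s <= 1 - x ^ k <= k (1 - x)], the second step being
    Bernoulli's inequality for an integer exponent above [s]. *)
Lemma powRN_diff (a b m s : R) k : 0 < m -> m <= a -> m <= b -> 0 <= s <= k%:R ->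
  `|a `^ (- s) - b `^ (- s)| <= k%:R * `|a - b| * (m `^ (- s) / m).
Proof.
wlog ab : a b / a <= b.
  move=> h m0 ma mb sk; have [ab|/ltW ba] := leP a b; first exact: h.
  by rewrite distrC [X in _ * X * _]distrC; exact: h.
move=> m0 ma mb /andP[s0 sk].
have a0 : 0 < a by exact: lt_le_trans ma.
have b0 : 0 < b by exact: lt_le_trans mb.
have x01 : 0 <= a / b <= 1 by rewrite divr_ge0 ?(ltW a0) ?(ltW b0)//= ler_pdivrMr// mul1r.
have abs : b `^ (- s) = a `^ (- s) * (a / b) `^ s.
  have e : b = a * (b / a) by rewrite mulrCA mulfV ?mulr1 ?gt_eqF.
  rewrite {1}e powRM ?divr_ge0 ?(ltW a0) ?(ltW b0)//.
  congr (_ * _); rewrite -[a / b]invf_div -[(b / a)^-1]powR_inv1 ?divr_ge0 ?(ltW a0) ?(ltW b0)//.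
  by rewrite -powRrM mulN1r.
rewrite abs -[X in `|X - _|]mulr1 -mulrBr normrM (ger0_norm (powR_ge0 _ _)).
have x0 : 0 < a / b by rewrite divr_gt0.
have xs : 1 - k%:R * (1 - a / b) <= (a / b) `^ s.
  apply: (le_trans (bernoulli_le k x01)); rewrite -powR_mulrn ?(ltW x0)//.
  by apply: ger_powR => //; rewrite x0; case/andP: x01.
have xs1 : (a / b) `^ s <= 1.
  by rewrite -[X in _ <= X](powRr0 (a / b)); apply: ger_powR => //; rewrite x0; case/andP: x01.
rewrite ger0_norm ?subr_ge0//.
have am : a `^ (- s) <= m `^ (- s).
  rewrite !powRN lef_pV2 ?posrE ?powR_gt0//; by apply: ge0_ler_powR => //; rewrite nnegrE ltW.
have d : 1 - (a / b) `^ s <= k%:R * `|a - b| / m.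
  apply: (@le_trans _ _ (k%:R * (1 - a / b))); first by lra.
  rewrite -mulrA ler_wpM2l// distrC ger0_norm ?subr_ge0//.
  rewrite -{1}(mulfV (lt0r_neq0 b0)) -mulrBl ler_wpM2l ?subr_ge0// lef_pV2 ?posrE//.
apply: (le_trans (ler_pM (powR_ge0 _ _) _ am d)); first by rewrite subr_ge0.
by rewrite [leRHS]mulrCA !mulrA.
Qed.

Lemma hump_prod_ge p (v : 'cV[R]_r) : 0 <= p ->
  mx v `^ (- (p * r%:R)) <= \prod_j hump p (v j 0).
Proof.
move=> p0; have -> : mx v `^ (- (p * r%:R)) = \prod_(j < r) (mx v `^ (- p)).
  by rewrite prodr_const card_ord -powR_mulrn ?powR_ge0// -powRrM mulNr.
apply: ler_prod => j _; rewrite powR_ge0 /= /hump !powRN.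
rewrite lef_pV2 ?posrE ?powR_gt0 ?mx_gt0 ?lt_max ?ltr01//.
apply: ge0_ler_powR; rewrite ?nnegrE ?le_max ?ler01//; first exact/ltW/mx_gt0.
by rewrite ge_max mx_ge1 mx_ge.
Qed.

(** In a bounded slab around the hyperplane of the coordinate [j0] that factor stays bounded below,
    so only the other [r.-1] factors have to be compared with the power of [mx v]. *)
Lemma hump_prod_sparse p (v : 'cV[R]_r) j0 M : 0 <= p -> 0 <= M -> `|v j0 0| <= M ->
  mx v `^ (- (p * r.-1%:R)) <= (1 + M) `^ p * \prod_j hump p (v j 0).
Proof.
move=> p0 M0 vM.
have h j : mx v `^ (- p) <= hump p (v j 0).
  rewrite /hump !powRN lef_pV2 ?posrE ?powR_gt0 ?mx_gt0 ?lt_max ?ltr01//.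
  apply: ge0_ler_powR; rewrite ?nnegrE ?le_max ?ler01//; first exact/ltW/mx_gt0.
  by rewrite ge_max mx_ge1 mx_ge.
have M1 : 0 < 1 + M by lra.
have h0 : 1 <= (1 + M) `^ p * hump p (v j0 0).
  rewrite /hump powRN ler_pdivlMr ?powR_gt0 ?lt_max ?ltr01// mul1r.
  apply: ge0_ler_powR; rewrite ?nnegrE ?le_max ?ler01 ?(ltW M1)//.
  by rewrite ge_max; lra.
rewrite (bigD1 j0)//= mulrA; apply: (@le_trans _ _ (\prod_(j < r | j != j0) hump p (v j 0))).
  have -> : mx v `^ (- (p * r.-1%:R)) = \prod_(j < r | j != j0) (mx v `^ (- p)).
    rewrite prodr_const -powR_mulrn ?powR_ge0// -powRrM mulNr; congr (_ `^ (- (_ * _%:R))).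
    by rewrite cardC1 card_ord.
  by apply: ler_prod => j _; rewrite powR_ge0 h.
by rewrite ler_peMl// prodr_ge0// => j _; exact: hump_ge0.
Qed.

(** Since [p * r = r + 1] and [p * r.-1 <= r], humps of exponent [p] dominate both the smooth error,
    of order [r + 1], and the jumps near hyperplanes, of order [r]; since [p > 1], their products
    are summable over a lattice. *)
Let p := 1 + r%:R^-1 : R.
Let p0 : 0 <= p. Proof. by rewrite addr_ge0// invr_ge0. Qed.

Definition Fs (phi : 'cV[R]_r -> R) kappa s u v : R := phi v * rho kappa u v `^ (- s).

(* A jump of [phi] costs one order of decay, but only happens near a coordinate
   hyperplane, which has one dimension less. *)
Definition sparse (phi : 'cV[R]_r -> R) := forall (M : R) (v v' : 'cV[R]_r), 0 <= M ->
  (forall j, `|v j 0 - v' j 0| <= M) -> phi v <> phi v' -> exists j, `|v j 0| <= M.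

(** The difference splits into a variation of the norm, where the Lipschitz bound gains one order of
    decay, and a variation of [phi], controlled by sparseness. It matters that [C] is chosen before
    [u] and [s]. *)
Lemma Fs_diff phi kappa lo hi M : (forall v, 0 <= phi v <= 1) -> sparse phi ->
  0 < kappa <= 1 -> 0 < lo -> 0 <= hi -> 0 <= M ->
  exists2 C, 0 <= C & forall u s (v v' : 'cV[R]_r), (forall j, lo <= u j <= hi) -> r%:R <= s <= r%:R + 1 ->
    (forall j, `|v j 0 - v' j 0| <= M) ->
    `|Fs phi kappa s u v - Fs phi kappa s u v'| <= C * \prod_j hump p (v j 0).
Proof.
move=> phi01 sp k01 l0 h0 M0.
(* [c1] compares [rho] with [mx] at the same point; dividing by [1 + M] makes the comparison with
   [mx v] valid at [v'] too. *)
pose c1 := Num.min lo kappa; pose c2 := c1 / (1 + M).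
have M1 : 0 < 1 + M by lra.
have c10 : 0 < c1 by rewrite lt_min l0; case/andP: k01.
have c20 : 0 < c2 by rewrite divr_gt0.
have c11 : c1 <= 1 by rewrite ge_min; case/andP: k01 => _ ->; rewrite orbT.
have c21 : c2 <= 1 by rewrite ler_pdivrMr// mul1r; lra.
have c21' : c2 <= c1 by rewrite ler_pdivrMr// ler_peMr ?(ltW c10)//; lra.
pose K := c2 `^ (- (r%:R + 1)) / c2.
have K0 : 0 <= K by rewrite divr_ge0 ?powR_ge0// ltW.
exists (K * (1 + M) `^ p + r.+1%:R * (r%:R * (hi * M)) * K).
  apply: addr_ge0; first by rewrite mulr_ge0 ?powR_ge0.
  by do 4 (apply: mulr_ge0 => //).
move=> u s v v' uh /andP[rs sr] vM.
set H := \prod_j _.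
have H0 : 0 <= H by apply: prodr_ge0 => j _; exact: hump_ge0.
have lu j : lo <= u j by case/andP: (uh j).
have X1 := mx_ge1 v; have X0 := mx_gt0 v; set X := mx v in X1 X0.
have aX : c2 * X <= rho kappa u v.
  by apply: le_trans (rho_ge v k01 l0 lu); rewrite ler_wpM2r// ltW.
have bX : c2 * X <= rho kappa u v'.
  apply: le_trans (rho_ge v' k01 l0 lu); rewrite -/c1 /c2 -mulrA ler_wpM2l ?(ltW c10)//.
  by rewrite ler_pdivrMl// mx_shift.
have cX0 : 0 < c2 * X by rewrite mulr_gt0.
have cXs : (c2 * X) `^ (- s) <= c2 `^ (- (r%:R + 1)) * X `^ (- s).
  rewrite powRM ?(ltW c20) ?(ltW X0)// ler_wpM2r ?powR_ge0//.
  by apply: ger_powR; rewrite ?c20// lerN2.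
have Xs : X `^ (- s) <= X `^ (- r%:R) by apply: ler_powR => //; rewrite lerN2.
have s0 : 0 <= s by apply: le_trans rs.
have as_ : rho kappa u v `^ (- s) <= c2 `^ (- (r%:R + 1)) * X `^ (- r%:R).
  apply: (@le_trans _ _ ((c2 * X) `^ (- s))).
    have a0 : 0 < rho kappa u v by exact: lt_le_trans aX.
    by rewrite !powRN lef_pV2 ?posrE ?powR_gt0//; apply: ge0_ler_powR => //; rewrite nnegrE ltW.
  by apply: (le_trans cXs); rewrite ler_wpM2l ?powR_ge0.
have dif : `|rho kappa u v `^ (- s) - rho kappa u v' `^ (- s)| <=
    r.+1%:R * (r%:R * (hi * M)) * (K * H).
  have sk : 0 <= s <= r.+1%:R by rewrite s0 -natr1.
  apply: (le_trans (powRN_diff cX0 aX bX sk)).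
  apply: ler_pM; rewrite ?mulr_ge0 ?powR_ge0 ?invr_ge0 ?(ltW cX0)//.
    rewrite ler_wpM2l//; apply: rho_lip => // j.
    by have /andP[h1 h2] := uh j; rewrite h2 (le_trans (ltW l0) h1).
  apply: (@le_trans _ _ (c2 `^ (- (r%:R + 1)) * X `^ (- r%:R) / (c2 * X))).
    rewrite ler_wpM2r ?invr_ge0 ?(ltW cX0)//; apply: (le_trans cXs).
    by rewrite ler_wpM2l ?powR_ge0.
  have -> : c2 `^ (- (r%:R + 1)) * X `^ (- r%:R) / (c2 * X) = K * (X `^ (- r%:R) * X^-1).
    by rewrite /K; field; rewrite !gt_eqF.
  rewrite ler_wpM2l//; have := hump_prod_ge v p0; rewrite -/H -/X.
  rewrite /p mulrDl mul1r mulVf ?gt_eqF// opprD powRD ?powR_inv1 ?(ltW X0)//.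
  by rewrite (gt_eqF X0) implybT.
have /andP[f0 f1] := phi01 v; have /andP[f0' f1'] := phi01 v'.
have -> : Fs phi kappa s u v - Fs phi kappa s u v' =
  (phi v - phi v') * rho kappa u v `^ (- s) + phi v' * (rho kappa u v `^ (- s) - rho kappa u v' `^ (- s)).
  by rewrite /Fs; ring.
apply: (le_trans (ler_normD _ _)); rewrite [leRHS]mulrDl; apply: lerD; last first.
  rewrite normrM (ger0_norm f0') -mulrA; apply: le_trans dif.
  by rewrite ler_piMl.
have [->|ne] := pselect (phi v = phi v').
  by rewrite subrr mul0r normr0; apply: mulr_ge0 => //; apply: mulr_ge0 => //; exact: powR_ge0.
have [j0 vj0] := sp M v v' M0 vM ne.
rewrite normrM [X in _ * X <= _]ger0_norm ?powR_ge0//.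
apply: (@le_trans _ _ (rho kappa u v `^ (- s))).
  by rewrite ler_piMl ?powR_ge0// ler_norml; lra.
apply: (le_trans as_); rewrite -mulrA.
have KK : c2 `^ (- (r%:R + 1)) <= K by rewrite /K ler_peMr ?powR_ge0// invf_ge1.
apply: ler_pM; rewrite ?powR_ge0//.
apply: (le_trans _ (hump_prod_sparse p0 M0 vj0)); rewrite -/X; apply: ler_powR => //.
rewrite lerN2 /p mulrDl mul1r -[X in _ <= X](_ : r.-1%:R + 1 = r%:R); last by rewrite natr1 prednK.
by rewrite lerD2l ler_pdivrMl// mulr1 ler_nat leq_pred.
Qed.

Lemma Fs_le phi kappa lo s u (v : 'cV[R]_r) : (forall v, 0 <= phi v <= 1) ->
  0 < kappa <= 1 -> 0 < lo -> (forall j, lo <= u j) -> 0 <= s ->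
  0 <= Fs phi kappa s u v <= (Num.min lo kappa) `^ (- s) * \prod_j hump (s / r%:R) (v j 0).
Proof.
move=> phi01 k01 l0 lu s0; have /andP[f0 f1] := phi01 v.
set c1 := Num.min lo kappa.
have c10 : 0 < c1 by rewrite lt_min l0; case/andP: k01.
have X0 := mx_gt0 v.
have a0 := lt_le_trans (mulr_gt0 c10 X0) (rho_ge v k01 l0 lu).
rewrite mulr_ge0 ?powR_ge0//=.
apply: (@le_trans _ _ (rho kappa u v `^ (- s))); first by rewrite ler_piMl ?powR_ge0.
apply: (@le_trans _ _ ((c1 * mx v) `^ (- s))).
  rewrite !powRN lef_pV2 ?posrE ?powR_gt0 ?mulr_gt0//.
  by apply: ge0_ler_powR; rewrite ?nnegrE ?mulr_ge0 ?(ltW a0) ?(ltW c10) ?(ltW X0)// rho_ge.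
rewrite powRM ?(ltW c10) ?(ltW X0)// ler_wpM2l ?powR_ge0//.
have := @hump_prod_ge (s / r%:R) v (divr_ge0 s0 (ltW r0)).
by rewrite divfK// gt_eqF.
Qed.

End estimates.

Lemma esumZl (R : realType) (T : choiceType) (D : set T) (a : T -> \bar R) (k : R) :
  injnat D -> (forall i, 0 <= a i)%E -> 0 <= k ->
  (\esum_(i in D) (k%:E * a i) = k%:E * \esum_(i in D) a i)%E.
Proof.
move=> [h /(esum_enum R)[g _ gE]] a0 k0.
rewrite !gE//; last by move=> i; rewrite mule_ge0// lee_fin.
rewrite -nneseriesZl; last by move=> i _; case: (g i) => /=.
by apply: eq_eseriesr => i _; case: (g i) => //=; rewrite mule0.
Qed.

(** * Sums over a translated lattice against integrals over its cells *)

Section lattice_sums.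
Variables (R : realType) (r : nat).
Hypothesis r_gt0 : (0 < r)%N.
Variables (B : 'M[R]_r) (c : 'cV[R]_r).
Hypothesis detB : \det B != 0.
Local Notation mu := (@lebesgue_measure R).

Let r0 : 0 < r%:R :> R. Proof. by rewrite ltr0n. Qed.

Definition lpt (y : 'cV[R]_r) : 'cV[R]_r := c + B *m y.
Definition cellM : R := \sum_j \sum_k `|B j k|.

Lemma cellM_ge0 : 0 <= cellM.
Proof. by apply: sumr_ge0 => j _; apply: sumr_ge0. Qed.

Lemma lpt_cell (y z : 'cV[R]_r) : incube y -> forall j, `|lpt z j 0 - lpt (y + z) j 0| <= cellM.
Proof.
move=> hy j; rewrite /lpt mulmxDr !mxE distrC.
rewrite (_ : _ - _ = \sum_k B j k * y k 0); last by ring.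
apply: (le_trans (ler_norm_sum _ _ _)).
apply: (@le_trans _ _ (\sum_k `|B j k|)); last first.
  by rewrite /cellM [leRHS](bigD1 j)//= lerDl; apply: sumr_ge0 => i _; apply: sumr_ge0.
apply: ler_sum => k _; rewrite normrM; have /andP[y0 y1] := hy k.
by rewrite ler_piMr// ger0_norm.
Qed.

Lemma hump_shift (q t t' M : R) : 0 <= q -> 0 <= M -> `|t - t'| <= M ->
  hump q t <= (1 + M) `^ q * hump q t'.
Proof.
move=> q0 M0 tt'; have M1 : 0 < 1 + M by lra.
have m0 (x : R) : 0 < Num.max 1 `|x| by rewrite lt_max ltr01.
rewrite /hump !powRN -ler_pdivrMl ?powR_gt0// mulrC -invfM lef_pV2 ?posrE ?mulr_gt0 ?powR_gt0//.
rewrite -powRM ?(ltW M1) ?(ltW (m0 _))//; apply: ge0_ler_powR => //.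
- by rewrite nnegrE ltW.
- by rewrite nnegrE mulr_ge0// ltW.
have h1 : 1 <= Num.max 1 `|t| by rewrite le_max lexx.
have h2 : `|t| <= Num.max 1 `|t| by rewrite le_max lexx orbT.
have := ler_normD (t' - t) t; rewrite subrK distrC => h.
rewrite ge_max; apply/andP; split; nra.
Qed.

Lemma prod_hump_shift (q M : R) (v v' : 'cV[R]_r) : 0 <= q -> 0 <= M ->
  (forall j, `|v j 0 - v' j 0| <= M) ->
  \prod_j hump q (v j 0) <= ((1 + M) `^ q) ^+ r * \prod_j hump q (v' j 0).
Proof.
move=> q0 M0 vv'.
have -> : ((1 + M) `^ q) ^+ r * \prod_j hump q (v' j 0) = \prod_j ((1 + M) `^ q * hump q (v' j 0)).
  by rewrite big_split /= prodr_const card_ord.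
by apply: ler_prod => j _; rewrite hump_ge0 hump_shift.
Qed.

Lemma cmeas_lpt (f : 'cV[R]_r -> \bar R) : cmeas f -> cmeas (fun y => f (lpt y)).
Proof.
move=> cf; rewrite /lpt.
have -> : (fun y => f (c + B *m y)) = (fun y => f (B *m y + c)).
  by apply/funext => y; rewrite addrC.
exact: cmeas_affine.
Qed.

Lemma iint_lpt (f : 'cV[R]_r -> \bar R) : cmeas f -> (forall y, 0 <= f y)%E ->
  iint setT (fun y => f (lpt y)) = (`|\det B|^-1%:E * iint setT f)%E.
Proof.
move=> cf f0.
rewrite (@iint_linear _ _ B (fun v => f (c + v)))//.
- congr (_ * _)%E; rewrite -[RHS](@iint_shift _ _ f c)//.
  by apply: eq_iint => y _; rewrite addrC.
- have -> : (fun v => f (c + v)) = (fun v => f (v + c)).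
    by apply/funext => y; rewrite addrC.
  exact: cmeas_shift.
Qed.

Lemma iint_prod_hump_lty (q : R) : 1 < q ->
  (iint setT (fun y : 'cV[R]_r => (\prod_j hump q (y j 0))%:E) < +oo)%E.
Proof.
move=> q1.
have fin : (\int[mu]_t (hump q t)%:E)%E \is a fin_num.
  rewrite ge0_fin_numE ?integral_hump//; apply: integral_ge0 => t _; by rewrite lee_fin hump_ge0.
rewrite (@iint_prod _ _ (hump q) (fine (\int[mu]_t (hump q t)%:E)%E)) ?ltry//.
- exact: measurable_hump.
- exact: hump_ge0.
- by rewrite fineK.
Qed.

(** On one cell the product of humps changes by at most the factor [K], so the sum is at most [K]
    times the integral over the whole space. *)
Lemma lattice_hump_sum (q : R) : 1 < q ->
  (\esum_(z in [set: 'cV[int]_r]) (\prod_j hump q (lpt (intv R z) j 0))%:E < +oo)%E.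
Proof.
move=> q1; have q0 : 0 <= q by lra.
pose G (y : 'cV[R]_r) := (\prod_j hump q (y j 0))%:E.
have cG : cmeas G by apply: cmeas_prod; exact: measurable_hump.
have G0 y : (0 <= G y)%E by rewrite lee_fin prodr_ge0// => j _; exact: hump_ge0.
pose K := ((1 + cellM) `^ q) ^+ r.
have K0 : 0 <= K by rewrite exprn_ge0// powR_ge0.
have step : (\esum_(z in [set: 'cV[int]_r]) (\prod_j hump q (lpt (intv R z) j 0))%:E <=
  \esum_(z in [set: 'cV[int]_r]) (K%:E * iint `[0%R, 1%R]%classic (fun y => G (lpt (y + intv R z)%R))))%E.
  apply: le_esum => z _.
  have -> : (\prod_j hump q (lpt (intv R z) j 0))%:E = iint `[0, 1]%classic (fun _ : 'cV[R]_r => (\prod_j hump q (lpt (intv R z) j 0))%:E).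
    rewrite (@iint_cint _ _ (fun=> _) (\prod_j hump q (lpt (intv R z) j 0))) ?cint_cst//.
    by move=> _; apply: prodr_ge0 => j _; exact: hump_ge0.
  have cGz : cmeas (fun y => G (lpt (y + intv R z)%R)) by apply: (cmeas_shift (intv R z) (cmeas_lpt cG)).
  rewrite -iintZl//.
  apply: le_iint => //.
  - by move=> d Y g mg; apply: emeasurable_funM; [exact: measurable_cst|exact: cGz].
  - by move=> y; rewrite lee_fin prodr_ge0// => j _; exact: hump_ge0.
  - by move=> y; apply: mule_ge0; rewrite ?lee_fin//; exact: G0.
  - move=> y hy; rewrite /G -EFinM lee_fin; apply: prod_hump_shift => //; first exact: cellM_ge0.
    by apply: lpt_cell => i; have := hy i; rewrite /= in_itv.
apply: (le_lt_trans step) => {step}.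
have -> : (\esum_(z in [set: 'cV[int]_r]) (K%:E * iint `[0%R, 1%R]%classic (fun y => G (lpt (y + intv R z)%R))) =
  K%:E * iint setT (fun y => G (lpt y)))%E.
  rewrite (iint_tile (cmeas_lpt cG))// esumZl//; first exact: injnat_countType.
  by move=> z; exact: iint_ge0.
rewrite iint_lpt// lte_mul_pinfty// ?lte_mul_pinfty ?lee_fin ?invr_ge0//.
exact: iint_prod_hump_lty.
Qed.

Variables (phi : 'cV[R]_r -> R) (kappa lo hi : R).
Hypothesis phi01 : forall v, 0 <= phi v <= 1.
Hypothesis sp : sparse phi.
Hypothesis mphi : cmeasR phi.
Hypothesis k01 : 0 < kappa <= 1.
Hypothesis lo0 : 0 < lo.
Hypothesis hi0 : 0 <= hi.

Local Notation F := (Fs phi kappa).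

Lemma rho_gt0 u (v : 'cV[R]_r) : 0 < rho kappa u v.
Proof. by rewrite lt_max; case/andP: k01 => ->. Qed.

Lemma F_ge0 s u v : 0 <= F s u v.
Proof. by rewrite mulr_ge0 ?powR_ge0//; case/andP: (phi01 v). Qed.

Lemma F_le s u v : 0 <= s <= r%:R + 1 -> F s u v <= kappa `^ (- (r%:R + 1)).
Proof.
move=> /andP[s0 sr]; have /andP[f0 f1] := phi01 v; have /andP[k0 k1] := k01.
apply: (@le_trans _ _ (rho kappa u v `^ (- s))); first by rewrite ler_piMl ?powR_ge0.
apply: (@le_trans _ _ (kappa `^ (- s))); last by apply: ger_powR; rewrite ?k0// lerN2.
rewrite !powRN lef_pV2 ?posrE ?powR_gt0 ?rho_gt0//; apply: ge0_ler_powR => //.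
- by rewrite nnegrE ltW.
- by rewrite nnegrE ltW// rho_gt0.
- by rewrite le_max lexx.
Qed.

Lemma measurable_rho (u : 'I_r -> R) d (Y : measurableType d) (g : Y -> 'cV[R]_r) : vmeasurable g ->
  measurable_fun setT (fun y => rho kappa u (g y)).
Proof.
move=> mg; apply: measurable_maxr; first exact: measurable_cst.
apply: (measurableT_comp (continuous_measurable_fun (@sqrt_continuous R))).
by apply: measurable_sumR => j _; apply: measurable_funX; apply: measurable_funM.
Qed.

Lemma cmeas_F s u : cmeasR (F s u).
Proof.
move=> d Y g mg; apply/measurable_EFinP; apply: measurable_funM.
  by apply/measurable_EFinP; exact: mphi.
apply: (@measurableT_comp _ _ _ _ _ _ (@powR R ^~ (- s))); first exact: measurable_powR.
exact: measurable_rho.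
Qed.

Lemma cmeas_F_lpt s u : cmeasR (fun y => F s u (lpt y)).
Proof. exact: (cmeas_lpt (cmeas_F s u)). Qed.

Lemma cmeas_F_lpt_shift s u z : cmeasR (fun y => F s u (lpt (y + z))).
Proof. exact: (cmeas_shift z (cmeas_F_lpt s u)). Qed.

Definition lsum s u : \bar R := \esum_(z in [set: 'cV[int]_r]) (F s u (lpt (intv R z)))%:E.
Definition lintegral s u : \bar R := iint setT (fun y => (F s u (lpt y))%:E).
Definition cell_diff s u (z : 'cV[int]_r) : R :=
  F s u (lpt (intv R z)) - cint (fun y => F s u (lpt (y + intv R z))).

Lemma lsum_lty s u : r%:R < s -> (forall j, lo <= u j) -> (lsum s u < +oo)%E.
Proof.
move=> rs lu; have s0 : 0 <= s by apply: le_trans (ltW rs).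
have q1 : 1 < s / r%:R by rewrite ltr_pdivlMr// mul1r.
apply: le_lt_trans (_ : (_ <= (Num.min lo kappa `^ (- s))%:E *
  \esum_(z in [set: 'cV[int]_r]) (\prod_j hump (s / r%:R) (lpt (intv R z) j 0))%:E)%E) _.
  rewrite -esumZl; last 3 first.
  - exact: injnat_countType.
  - by move=> z; rewrite lee_fin prodr_ge0// => j _; exact: hump_ge0.
  - exact: powR_ge0.
  apply: le_esum => z _; rewrite -EFinM lee_fin.
  by have /andP[] := Fs_le r_gt0 (lpt (intv R z)) phi01 k01 lo0 lu s0.
by rewrite lte_mul_pinfty ?lee_fin ?powR_ge0// lattice_hump_sum.
Qed.

Lemma iint_F_lty s u : r%:R < s -> (forall j, lo <= u j) ->
  (iint setT (fun y => (F s u y)%:E) < +oo)%E.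
Proof.
move=> rs lu; have s0 : 0 <= s by apply: le_trans (ltW rs).
have q1 : 1 < s / r%:R by rewrite ltr_pdivlMr// mul1r.
have cP := @cmeas_prod R r _ (measurable_hump (s / r%:R)).
have P0 (y : 'cV[R]_r) : (0 <= (\prod_j hump (s / r%:R) (y j 0))%:E)%E.
  by rewrite lee_fin prodr_ge0// => j _; exact: hump_ge0.
apply: le_lt_trans (_ : (_ <= (Num.min lo kappa `^ (- s))%:E *
  iint setT (fun y : 'cV[R]_r => (\prod_j hump (s / r%:R) (y j 0))%:E))%E) _.
  rewrite -iintZl ?lee_fin ?powR_ge0//; apply: le_iint => //.
  - exact: cmeas_F.
  - by move=> d Y g mg; apply: emeasurable_funM; [exact: measurable_cst|exact: cP].
  - by move=> y; rewrite lee_fin F_ge0.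
  - by move=> y; rewrite mule_ge0 ?lee_fin ?powR_ge0//; exact: P0.
  - move=> y _; rewrite -EFinM lee_fin.
    by have /andP[] := Fs_le r_gt0 y phi01 k01 lo0 lu s0.
by rewrite lte_mul_pinfty ?lee_fin ?powR_ge0// iint_prod_hump_lty.
Qed.

Lemma lintegralE s u : lintegral s u = (`|\det B|^-1%:E * iint setT (fun y => (F s u y)%:E))%E.
Proof.
rewrite /lintegral (@iint_lpt (fun y => (F s u y)%:E))//; first exact: cmeas_F.
by move=> y; rewrite lee_fin F_ge0.
Qed.

Lemma lsum_sub_lintegral s u : r%:R < s <= r%:R + 1 -> (forall j, lo <= u j) ->
  fine (lsum s u) - fine (lintegral s u) = abs_sum [set: 'cV[int]_r] (cell_diff s u).
Proof.
move=> /andP[rs sr] lu; have s0 : 0 <= s by apply: le_trans (ltW rs).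
have cE z : iint `[0, 1]%classic (fun y => (F s u (lpt (y + intv R z)))%:E) =
    (cint (fun y => F s u (lpt (y + intv R z))))%:E.
  apply: (@iint_cint _ _ _ (kappa `^ (- (r%:R + 1)))); first exact: cmeas_F_lpt_shift.
    by move=> y; exact: F_ge0.
  by move=> y _; apply: F_le; rewrite s0.
have b0 z : 0 <= cint (fun y => F s u (lpt (y + intv R z))).
  by rewrite -lee_fin -cE; apply: iint_ge0 => y; rewrite lee_fin F_ge0.
have E : (\esum_(z in [set: 'cV[int]_r]) (cint (fun y => F s u (lpt (y + intv R z))))%:E = lintegral s u)%E.
  rewrite /lintegral (iint_tile (cmeas_F_lpt s u)); last by move=> y; rewrite lee_fin F_ge0.
  by apply: eq_esum => z _; rewrite cE.
rewrite abs_sumB//.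
- by rewrite E.
- by move=> z; exact: F_ge0.
- exact: lsum_lty.
- by rewrite E lintegralE lte_mul_pinfty ?lee_fin ?invr_ge0// iint_F_lty.
Qed.

(** The constant does not depend on [s], and the endpoint [s = r] is included: there the sum and the
    integral may both be infinite, yet the cell differences keep a summable majorant. *)
Lemma cell_diff_le : exists2 C, 0 <= C & forall s u z, r%:R <= s <= r%:R + 1 ->
  (forall j, lo <= u j <= hi) ->
  `|cell_diff s u z| <= C * \prod_j hump (1 + r%:R^-1) (lpt (intv R z) j 0).
Proof.
have [C C0 hC] := Fs_diff r_gt0 phi01 sp k01 lo0 hi0 cellM_ge0.
exists C => // s u z sr uh.
have s0 : 0 <= s by case/andP: sr => rs _; apply: le_trans rs.
have bd (v : 'cV[R]_r) : `|F s u v| <= kappa `^ (- (r%:R + 1)).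
  by rewrite ger0_norm ?F_ge0//; apply: F_le; rewrite s0; case/andP: sr.
rewrite /cell_diff -{1}(cint_cst r (F s u (lpt (intv R z)))).
have cc : cmeasR (fun _ : 'cV[R]_r => F s u (lpt (intv R z))).
  by move=> d Y g mg; exact: measurable_cst.
have cs := cmeas_F_lpt_shift s u (intv R z).
rewrite -(@cintB _ _ _ _ (kappa `^ (- (r%:R + 1))))//.
apply: normr_cint.
  move=> d Y g mg; apply/measurable_EFinP; apply: measurable_funB; first exact: measurable_cst.
  by apply/measurable_EFinP; exact: cs.
by move=> y hy; apply: hC => //; exact: lpt_cell.
Qed.

Let p1 : 1 < 1 + r%:R^-1 :> R. Proof. by rewrite ltrDl invr_gt0. Qed.

Lemma lsum_sub_lintegral_bounded : exists C, forall s u, r%:R < s <= r%:R + 1 ->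
  (forall j, lo <= u j <= hi) -> `|fine (lsum s u) - fine (lintegral s u)| <= C.
Proof.
have [C C0 hC] := cell_diff_le.
exists (fine (\esum_(z in [set: 'cV[int]_r]) (C * \prod_j hump (1 + r%:R^-1) (lpt (intv R z) j 0))%:E)).
move=> s u sr uh; rewrite lsum_sub_lintegral//; last by move=> j; case/andP: (uh j).
apply: abs_sum_le.
  by move=> z _; apply: hC => //; case/andP: sr => /ltW -> ->.
under eq_esum do rewrite EFinM.
rewrite esumZl//; first by rewrite lte_mul_pinfty ?lee_fin// lattice_hump_sum.
- exact: injnat_countType.
- by move=> z; rewrite lee_fin prodr_ge0// => j _; exact: hump_ge0.
Qed.

Lemma cvg_F (s_ : nat -> R) s u v : s_ k @[k --> \oo] --> s -> F (s_ k) u v @[k --> \oo] --> F s u v.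
Proof.
move=> sc; apply: cvgM; first exact: cvg_cst.
rewrite /powR gt_eqF ?rho_gt0//.
apply: (@cvg_comp _ _ _ (fun k => - s_ k * ln (rho kappa u v)) expR); last exact: continuous_expR.
by apply: cvgM; [exact: cvgN|exact: cvg_cst].
Qed.

(** The summable majorant of the cell differences allows the limit to be taken termwise, and inside
    each cell integral by boundedness. *)
Lemma cvg_lsum_sub_lintegral (s_ : nat -> R) u : (forall k, r%:R < s_ k <= r%:R + 1) ->
  s_ k @[k --> \oo] --> (r%:R : R) -> (forall j, lo <= u j <= hi) ->
  fine (lsum (s_ k) u) - fine (lintegral (s_ k) u) @[k --> \oo] -->
  abs_sum [set: 'cV[int]_r] (cell_diff r%:R u).
Proof.
move=> sr sc uh; have [C C0 hC] := cell_diff_le.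
have lu j : lo <= u j by case/andP: (uh j).
under eq_fun do rewrite lsum_sub_lintegral//.
apply: (@cvg_abs_sum _ _ _ _ _ (fun z => C * \prod_j hump (1 + r%:R^-1) (lpt (intv R z) j 0))).
- exact: injnat_countType.
- by move=> z; rewrite mulr_ge0// prodr_ge0// => j _; exact: hump_ge0.
- by move=> k z _; apply: hC => //; case/andP: (sr k) => /ltW -> ->.
- under eq_esum do rewrite EFinM.
  rewrite esumZl//; first by rewrite lte_mul_pinfty ?lee_fin// lattice_hump_sum.
  + exact: injnat_countType.
  + by move=> z; rewrite lee_fin prodr_ge0// => j _; exact: hump_ge0.
move=> z _; apply: cvgB; first exact: cvg_F.
apply: (@cvg_cint _ _ _ _ (kappa `^ (- (r%:R + 1)))).
- by move=> k; exact: cmeas_F_lpt_shift.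
- exact: cmeas_F_lpt_shift.
- move=> k y _; rewrite ger0_norm ?F_ge0//; apply: F_le.
  by case/andP: (sr k) => /ltW h ->; rewrite (le_trans _ h).
- by move=> y _; exact: cvg_F.
Qed.

End lattice_sums.

(** * Cosets, signs and characters *)

Lemma esum_finType (R : realType) (T : finType) (P : pred T) (f : T -> \bar R) :
  (forall i, 0 <= f i)%E -> (\esum_(i in [set i | P i]) f i = \sum_(i | P i) f i)%E.
Proof.
move=> f0.
have E (j : T) : (\esum_(i in [set i | P i]) (if i == j then f j else 0) = if P j then f j else 0)%E.
  rewrite esum_mkcond (@esum_single _ _ j).
  - by rewrite eqxx; congr (if _ then _ else _); apply/idP/idP; rewrite inE.
  - by rewrite eqxx; case: ifP.
  - by move=> i /eqP/negbTE ->; case: ifP.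
transitivity (\esum_(i in [set i | P i]) \sum_j (if i == j then f j else 0))%E.
  apply: eq_esum => i _; rewrite (bigD1 i)//= eqxx big1 ?adde0// => j ji.
  by rewrite eq_sym (negbTE ji).
rewrite esum_sum; last by move=> i j _ _; case: ifP.
by rewrite [RHS]big_mkcond; apply: eq_bigr => j _; exact: E.
Qed.

(** * Cosets in the dual lattice on which the character is constant *)

Section cosets.
Variables (R : realType) (L : fieldExtType rat) (r : nat).
Variable sigma : 'I_r -> {rmorphism L -> R}.
Hypothesis hdeg : \dim {: L} = r.
Hypothesis hsigma : injective sigma.
Local Notation Tr a := (TrR (embF sigma a)).

Variable I : set L.
Hypothesis hI : frac_ideal I.
Variables (w : 'I_r -> L) (D : nat).
Hypothesis D0 : (0 < D)%N.
Hypothesis dw : forall i, dual sigma I (w i).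
Hypothesis detw : \det (embmx sigma w) != 0.
Hypothesis lw : forall n, dual sigma I n ->
  exists z : 'cV[int]_r, D%:R * n = \sum_i (z i 0)%:~R * w i.

Definition emb (n : L) : 'cV[R]_r := \col_j sigma j n.

Lemma natL_neq0 (m : nat) : (0 < m)%N -> (m%:R : L) != 0.
Proof. by case: m => // m _; rewrite -[_%:R]/(m.+1%:Z%:~R) intrL_eq0. Qed.

Lemma wfree (z : 'cV[int]_r) : \sum_i (z i 0)%:~R * w i = 0 -> z = 0.
Proof.
move=> zw; have wu : embmx sigma w \in unitmx by rewrite unitmxE unitfE.
have h : embmx sigma w *m intv R z = 0.
  apply/colP => j; rewrite !mxE; have := congr1 (sigma j) zw; rewrite rmorph0 rmorph_sum => h.
  by rewrite -[RHS]h; apply: eq_bigr => i _; rewrite !mxE rmorphM rmorph_int mulrC.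
have {}h : intv R z = 0 by rewrite -[intv R z](mulKmx wu) h mulmx0.
apply/colP => i; have := congr1 (fun v : 'cV[R]_r => v i 0) h; rewrite !mxE => /eqP.
by rewrite intr_eq0 => /eqP.
Qed.

(** The coordinates of a dual element in [w] are integers over [D], not all zero, and are bounded by
    a constant times the largest conjugate. This gap around [0] makes the cutoff in [rho]
    harmless. *)
Lemma dual_lower : exists2 k : R, 0 < k & forall n, dual sigma I n -> n != 0 ->
  exists j, k <= `|sigma j n|.
Proof.
have wu : embmx sigma w \in unitmx by rewrite unitmxE unitfE.
pose W := invmx (embmx sigma w).
pose s := 1 + \sum_i \sum_j `|W i j|.
have s0 : 0 < s by rewrite ltr_wpDr// sumr_ge0// => i _; rewrite sumr_ge0.
have DR : 0 < D%:R :> R by rewrite ltr0n.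
exists (D%:R * s)^-1 => [|n dn n0]; first by rewrite invr_gt0 mulr_gt0.
have [z zE] := lw dn.
have vE : D%:R *: emb n = embmx sigma w *m intv R z.
  apply/colP => j; rewrite !mxE; have := congr1 (sigma j) zE.
  rewrite rmorphM rmorph_nat rmorph_sum => ->.
  by apply: eq_bigr => i _; rewrite !mxE rmorphM rmorph_int mulrC.
have zv : intv R z = D%:R *: (W *m emb n) by rewrite scalemxAr vE mulKmx.
have [i zi] : exists i, z i 0 != 0.
  apply: contrapT => /forallNP h.
  have z0 : z = 0 by apply/colP => i; rewrite mxE; apply/eqP; apply: contrapT => /negP; exact: h.
  move: zE; rewrite z0 big1; last by move=> i _; rewrite mxE mul0r.
  by move/eqP; rewrite mulf_eq0 (negbTE n0) (negbTE (natL_neq0 D0)).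
apply: contrapT => /forallNP h.
have {}h j : `|sigma j n| <= (D%:R * s)^-1 by apply: ltW; rewrite ltNge; apply/negP; exact: h.
have z1 : 1 <= `|(z i 0)%:~R| :> R by rewrite -intr_norm (ler1z R); lia.
have : `|(z i 0)%:~R| <= D%:R * (\sum_j `|W i j|) * (D%:R * s)^-1 :> R.
  have := congr1 (fun v : 'cV[R]_r => v i 0) zv; rewrite !mxE => ->.
  rewrite normrM ger0_norm// -mulrA ler_wpM2l// (le_trans (ler_norm_sum _ _ _))//.
  rewrite mulr_suml ler_sum// => j _; rewrite normrM ler_wpM2l// mxE; exact: h.
rewrite invfM mulrACA mulfV ?gt_eqF// mul1r => /(le_trans z1); rewrite ler_pdivlMr// mul1r.
rewrite /s (bigD1 i)//=.
have : 0 <= \sum_(i0 < r | i0 != i) \sum_j `|W i0 j| by apply: sumr_ge0 => k _; apply: sumr_ge0.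
lra.
Qed.

Lemma injnat_dual (S : set L) : S `<=` dual sigma I -> injnat S.
Proof.
move=> Sd.
pose f n := if pselect (dual sigma I n) is left h then pickle (projT1 (cid (lw h))) else 0%N.
exists f => n n'; rewrite !inE => /Sd dn /Sd dn'; rewrite /f.
case: pselect => // h; case: pselect => // h'; case: (cid _) => z /= zE; case: (cid _) => z' /= zE'.
move=> /(pcan_inj pickleK) zz'; rewrite -zz' -zE in zE'.
exact: (mulfI (natL_neq0 D0)).
Qed.

Variable m : nat.
Hypothesis m0 : (0 < m)%N.

Let P := (m * D)%N.
Let P0 : (0 < P)%N. Proof. by rewrite muln_gt0 m0. Qed.

Definition cosetB : 'M[R]_r := embmx sigma (fun k => m%:R * w k).

Lemma det_cosetB : \det cosetB != 0.
Proof. by apply: embmx_mul => //; exact: natL_neq0. Qed.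

(* The cosets of [\sum_i Z (m * w i)] in [\sum_i Z (w i / D)]; the lattice generated by
   the [m * w i] lies in [m * dual I], on which the character of an [m]-torsion point is
   trivial. *)
Definition na (a : {ffun 'I_r -> 'I_(m * D)}) : L := \sum_i ((a i : nat)%:R / D%:R) * w i.
Definition shift_pt (z : 'cV[int]_r) : L := \sum_i (z i 0)%:~R * (m%:R * w i).
Definition pt a z := na a + shift_pt z.
(** The points [na a] represent the whole lattice of the [w i / D], in which the dual is only
    contained; this test selects the cosets that belong to the dual. *)
Definition isrep (a : {ffun 'I_r -> 'I_(m * D)}) := `[< dual sigma I (na a) >].

Lemma emb_pt a z : emb (pt a z) = emb (na a) + cosetB *m intv R z.
Proof.
apply/colP => j; rewrite !mxE rmorphD; congr (_ + _); rewrite rmorph_sum; apply: eq_bigr => i _.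
by rewrite !mxE rmorphM rmorph_int mulrC.
Qed.

Lemma dual_shift_pt z : dual sigma I (shift_pt z).
Proof.
apply: big_ind.
- by move=> b Ib; exists 0; rewrite mul0r /TrR big1// => j _; rewrite /embF rmorph0.
- move=> a b da db; rewrite -[b]opprK; apply: dual_sub => //; rewrite -sub0r; apply: dual_sub => //.
  by move=> c Ic; exists 0; rewrite mul0r /TrR big1// => j _; rewrite /embF rmorph0.
- move=> i _; apply: dual_mul => //; first exact: integral_intr.
  by apply: dual_mul => //; exact: (integral_intr L m).
Qed.

Lemma dual_pt a z : dual sigma I (pt a z) <-> isrep a.
Proof.
have ds := dual_shift_pt z; split.
  by move=> dp; apply/asboolP; rewrite -(addrK (shift_pt z) (na a)); exact: dual_sub.
move=> /asboolP da; rewrite /pt -[shift_pt z]opprK; apply: dual_sub => //.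
rewrite -sub0r; apply: dual_sub => //.
by move=> c Ic; exists 0; rewrite mul0r /TrR big1// => j _; rewrite /embF rmorph0.
Qed.

Lemma DptE a z : D%:R * pt a z = \sum_i ((a i : nat)%:Z + P%:Z * z i 0)%:~R * w i.
Proof.
rewrite /pt /na /shift_pt mulrDr !mulr_sumr -big_split; apply: eq_bigr => i _ /=.
have D1 := natL_neq0 D0.
rewrite intrD intrM /P -[(m * D)%:Z%:~R]/((m * D)%:R) natrM -[((a i : nat)%:Z)%:~R]/((a i : nat)%:R).
by field.
Qed.

Lemma pt_surj n (z : 'cV[int]_r) : D%:R * n = \sum_i (z i 0)%:~R * w i ->
  exists a z, pt a z = n.
Proof.
move=> zE.
have P1 : P%:Z != 0 by rewrite -lt0n.
have lt_P i : (`|(z i 0%R %% P)%Z| < P)%N.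
  by have := ltz_pmod (z i 0) (P0 : 0 < P%:Z); have := modz_ge0 (z i 0) P1; lia.
exists [ffun i => Ordinal (lt_P i)], (\col_i (z i 0%R %/ P)%Z).
apply: (mulfI (natL_neq0 D0)); rewrite DptE zE; apply: eq_bigr => i _; congr (_%:~R * _).
rewrite ffunE /= mxE gez0_abs ?modz_ge0// addrC mulrC -divz_eq//.
Qed.

Lemma pt_inj a z a' z' : pt a z = pt a' z' -> a = a' /\ z = z'.
Proof.
move=> /(congr1 (fun n => D%:R * n)); rewrite !DptE => /eqP; rewrite -subr_eq0 -sumrB => /eqP h.
have k i : (a i : nat)%:Z + P%:Z * z i 0 = (a' i : nat)%:Z + P%:Z * z' i 0.
  have h0 : \sum_i ((\col_i ((a i : nat)%:Z + P%:Z * z i 0 - ((a' i : nat)%:Z + P%:Z * z' i 0))) i 0)%:~R * w i = 0.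
    by rewrite -[RHS]h; apply: eq_bigr => j _; rewrite mxE intrB mulrBl.
  have := congr1 (fun v : 'cV[int]_r => v i 0) (wfree h0); rewrite !mxE => /eqP.
  by rewrite subr_eq0 => /eqP.
have e i : (a i : nat) = a' i /\ z i 0 = z' i 0.
  have := k i; have := ltn_ord (a i); have := ltn_ord (a' i); rewrite -/P; move: (nat_of_ord (a i)) (nat_of_ord (a' i)) => s t.
  move=> tP sP E; suff zz : z i 0 = z' i 0 by split => //; move: E; rewrite zz => /addIr [].
  by nia.
by split; [apply/ffunP => i; apply/val_inj; case: (e i)|apply/colP => i; case: (e i)].
Qed.

Lemma esum_dual (h : L -> \bar R) : (forall n, 0 <= h n)%E ->
  (\esum_(n in dual sigma I) h n =
   \sum_(a | isrep a) \esum_(z in [set: 'cV[int]_r]) h (pt a z))%E.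
Proof.
move=> h0; rewrite -esum_finType; last by move=> a; exact: esum_ge0.
rewrite (@esum_esum _ _ _ [set a | isrep a] (fun=> setT) (fun a z => h (pt a z)))//.
apply: (reindex_esum _ _ (fun k => pt k.1 k.2)); split.
- by move=> [a z] /= [ha _]; apply/dual_pt.
- by move=> [a z] [a' z'] _ _ /= /pt_inj[-> ->].
- move=> n dn; have [z' z'E] := lw dn; have [a [z E]] := pt_surj z'E; exists (a, z) => //=; split => //=.
  by apply/(dual_pt a z); rewrite E.
Qed.

End cosets.

(** * Positive and negative parts of the sign product *)

Section sign_functions.
Variables (R : realType) (r : nat) (nu : 'I_r -> bool).

Definition Phi (v : 'cV[R]_r) : R := \prod_(j < r | nu j) Num.sg (v j 0).
Definition phi (b : bool) (v : 'cV[R]_r) : R := Num.max ((-1) ^+ b * Phi v) 0.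

Lemma Phi_norm v : `|Phi v| <= 1.
Proof.
rewrite /Phi normr_prod; apply: prodr_ile1 => j _.
by rewrite normr_ge0 /= normr_sg; case: (_ != 0).
Qed.

Lemma phi01 b v : 0 <= phi b v <= 1.
Proof.
have := Phi_norm v; rewrite /phi ler_norml => /andP[h1 h2].
by rewrite le_max lexx orbT ge_max ler01 andbT; case: b; rewrite ?expr0 ?expr1; lra.
Qed.

Lemma phiB v : phi false v - phi true v = Phi v.
Proof.
rewrite /phi expr0 expr1 mul1r mulN1r !maxEle; case: ifP => h; case: ifP => h'; lra.
Qed.

(** A coordinate of size more than [M] keeps its sign under a displacement of at most [M]. *)
Lemma sparse_phi b : sparse (phi b).
Proof.
move=> M v v' M0 vv' ne; apply: contrapT => /forallNP far; apply: ne.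
rewrite /phi; congr (Num.max (_ * _) _); apply: eq_bigr => j _.
have vj : M < `|v j 0| by rewrite ltNge; apply/negP; exact: far.
have := vv' j; rewrite ler_norml => /andP[h1 h2].
have [z|p|n] := sgrP (v j 0).
- by rewrite z normr0 ltNge M0 in vj.
- by rewrite gtr0_norm// in vj; rewrite gtr0_sg//; lra.
- by rewrite ltr0_norm// in vj; rewrite ltr0_sg//; lra.
Qed.

Lemma measurable_sg : measurable_fun setT (@Num.sg R).
Proof.
apply: nondecreasing_measurable => // x y xy.
have [p|n|z] := sgrP x; have [p'|n'|z'] := sgrP y; lra.
Qed.

Lemma cmeas_phi b : cmeasR (phi b).
Proof.
move=> d Y g mg; apply/measurable_EFinP; apply: measurable_maxr; last exact: measurable_cst.
apply: measurable_funM; first exact: measurable_cst.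
by apply: measurable_prodR => j _; apply: (measurableT_comp measurable_sg).
Qed.

(** Reflecting a coordinate that enters the sign exchanges the two parts and preserves the norm. The
    equality is between extended reals, so it holds even where both sides are infinite. *)
Lemma iint_phi_sym kappa s u j0 : nu j0 -> 0 < kappa <= 1 ->
  iint setT (fun y => (Fs (phi false) kappa s u y)%:E) =
  iint setT (fun y => (Fs (phi true) kappa s u y)%:E).
Proof.
move=> nj0 k01.
pose A : 'M[R]_r := diag_mx (\row_j (if j == j0 then -1 else 1)).
have dA : \det A = -1.
  rewrite det_diag (bigD1 j0)//= mxE eqxx big1 ?mulr1// => j jj0.
  by rewrite mxE (negbTE jj0).
have AE y j : (A *m y) j 0 = (if j == j0 then -1 else 1) * y j 0 by rewrite mul_diag_mx !mxE.
have := @iint_linear _ _ A (fun y => (Fs (phi true) kappa s u y)%:E).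
rewrite dA normrN1 invr1 mul1e => <-.
- apply: eq_iint => y _; congr (_%:E); rewrite /Fs; congr (_ * _).
    rewrite /phi expr0 expr1 mul1r mulN1r; congr Num.max.
    rewrite /Phi (bigD1 j0)//= [in RHS](bigD1 j0)//= AE eqxx mulN1r sgrN mulNr opprK; congr (_ * _).
    by apply: eq_bigr => j /andP[_ jj0]; rewrite AE (negbTE jj0) mul1r.
  rewrite /rho; congr (Num.max _ _ `^ _); rewrite /enorm /eucl_norm; congr Num.sqrt.
  apply: eq_bigr => j _; rewrite /actR AE; case: ifP => _; ring.
- by rewrite oppr_eq0 oner_eq0.
- by apply: cmeas_F => //; exact: cmeas_phi.
- by move=> y; rewrite lee_fin; apply: F_ge0; exact: phi01.
Qed.

End sign_functions.

Section trigonometry.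
Variable R : realType.

Lemma expi_period im (t : R) (z : int) :
  expi_part im (2 * pi * (t + z%:~R)) = expi_part im (2 * pi * t).
Proof.
have h n t' : expi_part im (2 * pi * (t' + n%:R)) = expi_part im (2 * pi * t') :> R.
  rewrite (_ : 2 * pi * (t' + n%:R) = 2 * pi * t' + pi *+ 2 *+ n); last first.
    by rewrite -[pi *+ 2 *+ n]mulr_natr -[pi *+ 2]mulr_natr; ring.
  by case: im; rewrite /expi_part; [rewrite (periodicn (@sinD2pi R))|rewrite (periodicn (@cosD2pi R))].
case: z => n; first exact: h.
rewrite NegzE -[in RHS](subrK n.+1%:R t) h; congr (expi_part im (2 * pi * (t + _))).
Qed.

Lemma cos2pi_eq1 (t : R) : cos (2 * pi * t) = 1 -> is_int t.
Proof.
pose z := Num.floor t; pose f := t - z%:~R => ct.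
have fE : t = f + z%:~R by rewrite subrK.
have /andP[f0 f1] : 0 <= f < 1.
  have := Num.Theory.ge_floor t; have := Num.Theory.floorD1_gt t.
  by rewrite intrD /f -/z; lra.
have : cos (2 * pi * f) = 1 by rewrite -[LHS](expi_period false f z) -fE.
rewrite (_ : 2 * pi * f = (pi * f) *+ 2); last by rewrite -mulr_natl; ring.
rewrite cos_mulr2n cos2sin2 => h.
have s0 : sin (pi * f) = 0 by apply/eqP; rewrite -sqrf_eq0; apply/eqP; lra.
have [f00|fn0] := eqVneq f 0; first by exists z; rewrite fE f00 add0r.
have fp : 0 < f by rewrite lt0r fn0.
have pi0 := pi_gt0 R.
have : 0 < sin (pi * f) by apply: sin_gt0_pi; rewrite mulr_gt0//= gtr_pMr.
by rewrite s0 ltxx.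
Qed.

Lemma expi_norm im (t : R) : `|expi_part im t| <= 1.
Proof.
by rewrite ler_norml; case: im; rewrite /expi_part ?cos_geN1 ?cos_le1 ?sin_geN1 ?sin_le1.
Qed.

(** In complex terms, [(C + i S) (c + i s) = C + i S] with [c + i s] different from [1]. *)
Lemma rotation_fixed (c s C S : R) : c ^+ 2 + s ^+ 2 = 1 -> c != 1 ->
  C = C * c - S * s -> S = S * c + C * s -> C = 0 /\ S = 0.
Proof.
move=> cs c1 hC hS.
have h : (C ^+ 2 + S ^+ 2) * (1 - c) = 0.
  have e1 : C * C = C * (C * c - S * s) by rewrite -hC.
  have e2 : S * S = S * (S * c + C * s) by rewrite -hS.
  by rewrite !expr2; lra.
move/eqP: h; rewrite mulf_eq0 subr_eq0 [1 == c]eq_sym (negbTE c1) orbF.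
by rewrite paddr_eq0 ?sqr_ge0// !sqrf_eq0 => /andP[/eqP -> /eqP ->].
Qed.

End trigonometry.

(** * Vanishing of a nontrivial character sum over the cosets *)

Section character_sums.
Variables (R : realType) (L : fieldExtType rat) (r : nat).
Variable sigma : 'I_r -> {rmorphism L -> R}.
Hypothesis hdeg : \dim {: L} = r.
Hypothesis hsigma : injective sigma.
Local Notation Tr a := (TrR (embF sigma a)).

Variable I : set L.
Hypothesis hI : frac_ideal I.
Variables (w : 'I_r -> L) (D : nat).
Hypothesis D0 : (0 < D)%N.
Hypothesis dw : forall i, dual sigma I (w i).
Hypothesis detw : \det (embmx sigma w) != 0.
Hypothesis lw : forall n, dual sigma I n ->
  exists z : 'cV[int]_r, D%:R * n = \sum_i (z i 0)%:~R * w i.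
Variables (m : nat) (b : L) (x : 'I_r -> R).
Hypothesis m0 : (0 < m)%N.
Hypothesis Ib : I b.
Hypothesis xE : forall j, x j = sigma j (b / m%:R).

Definition expi im n : R := expi_part im (2 * pi * TrR (actF sigma n x)).

Lemma Tr_act n : TrR (actF sigma n x) = Tr (n * (b / m%:R)).
Proof. by rewrite /TrR /actF; apply: eq_bigr => j _; rewrite xE /embF [RHS]rmorphM. Qed.

Lemma TrD a c : Tr (a + c) = Tr a + Tr c.
Proof. by rewrite /TrR -big_split; apply: eq_bigr => j _; rewrite /embF rmorphD. Qed.

Local Notation shift_pt := (shift_pt w m).
Local Notation na := (@na L r w D m).
Local Notation pt := (@pt L r w D m).
Local Notation isrep := (@isrep R L r sigma I w D m).

Lemma expi_shift im n z : expi im (n + shift_pt z) = expi im n.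
Proof.
rewrite /expi !Tr_act [(n + _) * _]mulrDl TrD.
have [k ->] : exists k : int, Tr (shift_pt z * (b / m%:R)) = k%:~R.
  have mL := natL_neq0 L m0 : (m%:R : L) != 0.
  pose t i := projT1 (cid (dw i Ib)).
  have tE i : Tr (w i * b) = (t i)%:~R by rewrite /t; case: (cid _) => k /= ->.
  exists (\sum_i z i 0 * t i); rewrite rmorph_sum /= mulr_suml Tr_sum; apply: eq_bigr => i _.
  by rewrite intrM -tE -TrZ; congr TrR; apply/funext => j; rewrite /embF; congr (sigma j _); field.
exact: expi_period.
Qed.

(** By biduality the character is nontrivial at some [n0] in the dual. Translation by [n0] permutes
    the cosets, so the pair of cosine and sine sums is invariant under a rotation other than the
    identity. *)
Lemma charsum im : ~ I (b / m%:R) -> \sum_(a | isrep a) expi im (na a) = 0.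
Proof.
move=> nI.
have [n0 dn0 nint] : exists2 n, dual sigma I n & ~ is_int (Tr (n * (b / m%:R))).
  apply: contrapT => h; apply: nI; apply: (bidual hdeg hsigma hI) => n dn.
  by apply: contrapT => ni; apply: h; exists n.
have [k kE] := lw dn0.
have mv a : exists az, pt az.1 az.2 = na a + n0.
  have h : D%:R * (na a + n0) = \sum_i ((\col_i ((a i : nat)%:Z + k i 0)) i 0)%:~R * w i.
    have s0 : shift_pt 0 = 0 by rewrite /shift_pt big1// => i _; rewrite mxE mul0r.
    have -> : na a = pt a 0 by rewrite /pt s0 addr0.
    rewrite mulrDr kE DptE// -big_split; apply: eq_bigr => i _ /=.
    by rewrite !mxE mulr0 addr0 intrD mulrDl.
  by have [a' [z E]] := pt_surj hdeg D0 detw m0 h; exists (a', z).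
pose tau a := (projT1 (cid (mv a))).1.
pose q a := (projT1 (cid (mv a))).2.
have tauE a : pt (tau a) (q a) = na a + n0 by rewrite /tau /q; case: (cid _).
have tau_inj : injective tau.
  move=> a a' taa; have := tauE a; have := tauE a'; rewrite -taa => E' E.
  have : pt a (q a') = pt a' (q a).
    have : na a - na a' = shift_pt (q a) - shift_pt (q a').
      by apply: (addIr n0); rewrite addrAC -E -(addrK n0 (na a')) -E' /pt; ring.
    by rewrite /pt => /eqP; rewrite subr_eq addrAC -subr_eq opprK => /eqP ->; rewrite addrC.
  by move/(pt_inj hdeg D0 detw m0) => [].
have rep_tau a : isrep (tau a) = isrep a.
  apply/idP/idP.
    move=> /(dual_pt hI dw _ (q a)); rewrite tauE => h; apply/asboolP.
    by rewrite -(addrK n0 (na a)); exact: dual_sub.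
  move=> /asboolP h; apply/(dual_pt hI dw _ (q a)); rewrite tauE.
  rewrite -[n0]opprK; apply: dual_sub => //; rewrite -sub0r; apply: dual_sub => //.
  by move=> c Ic; exists 0; rewrite mul0r /TrR big1// => j _; rewrite /embF rmorph0.
pose th0 : R := 2 * pi * Tr (n0 * (b / m%:R)).
have exp_tau im' a : expi im' (na (tau a)) = expi_part im' (2 * pi * TrR (actF sigma (na a) x) + th0).
  rewrite -(expi_shift _ _ (q a)) -/(pt (tau a) (q a)) tauE /expi; congr expi_part.
  by rewrite !Tr_act [(na a + n0) * _]mulrDl TrD mulrDr.
pose C := \sum_(a | isrep a) expi false (na a).
pose S := \sum_(a | isrep a) expi true (na a).
have re (f : {ffun 'I_r -> 'I_(m * D)} -> R) : \sum_(a | isrep a) f a = \sum_(a | isrep a) f (tau a).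
  by rewrite (reindex_inj tau_inj) /=; apply: eq_bigl => a; exact: rep_tau.
have hC : C = C * cos th0 - S * sin th0.
  rewrite {1}/C re /C /S !mulr_suml -sumrB; apply: eq_bigr => a _.
  by rewrite exp_tau /expi /expi_part cosD.
have hS : S = S * cos th0 + C * sin th0.
  rewrite {1}/S re /C /S !mulr_suml -big_split; apply: eq_bigr => a _.
  by rewrite exp_tau /expi /expi_part sinD.
have [] := rotation_fixed (cos2Dsin2 th0) _ hC hS.
  by apply/eqP => /cos2pi_eq1.
by case: im.
Qed.

End character_sums.

(** * The Green function *)

(** The uniform bounds cover only [eta <= 1]. Truncating a null sequence at [1] alters finitely many
    terms, so such sequences suffice. *)
Lemma cvg_at_right0 (R : realType) (f : R -> R) (l : R) :
  (forall e_ : nat -> R, (forall k, 0 < e_ k <= 1) -> e_ k @[k --> \oo] --> 0 ->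
    f (e_ k) @[k --> \oo] --> l) -> f e @[e --> 0^'+] --> l.
Proof.
move=> h; apply/cvg_at_rightP => e_ [e0 ecvg].
apply: cvg_trans (h (fun k => Num.min (e_ k) 1) _ _).
- apply: near_eq_cvg; move/cvgrPdist_lt : ecvg => /(_ _ ltr01); apply: filterS => k.
  rewrite sub0r normrN gtr0_norm// => e1.
  by have /min_idPl -> := ltW e1.
- by move=> k; rewrite lt_min e0 ltr01/= ge_min lexx orbT.
apply/cvgrPdist_lt => eps eps0; move/cvgrPdist_lt : ecvg => /(_ _ eps0).
apply: filterS => k; rewrite !sub0r !normrN; apply: le_lt_trans.
by rewrite !ger0_norm ?ge_min ?lexx// ?le_min ?ler01 (ltW (e0 k)).
Qed.

Section green_function.
Variables (R : realType) (L : fieldExtType rat) (r : nat).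
Variable sigma : 'I_r -> {rmorphism L -> R}.
Hypothesis hdeg : \dim {: L} = r.
Hypothesis hsigma : injective sigma.
Variable I : set L.
Hypothesis hI : frac_ideal I.
Variables (nu : 'I_r -> bool) (x : 'I_r -> R).
Hypothesis hx : torsion sigma I x.

Local Notation expi := (@expi R L r sigma x).
Local Notation emb := (@emb R L r sigma).

Definition green_term (im : bool) (s : R) (u : 'I_r -> R) (n : L) : R :=
  sgn_nu sigma nu n * expi im n / eucl_norm (actR u (embF sigma n)) `^ s.

Definition green (im : bool) (s : R) (u : 'I_r -> R) : R := abs_sum (dual sigma I `\ 0%R) (green_term im s u).

Lemma enorm_emb u n : enorm u (emb n) = eucl_norm (actR u (embF sigma n)).
Proof.
by rewrite /enorm; congr eucl_norm; apply/funext => j; rewrite /actR mxE.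
Qed.

Lemma sgn_nuE n : sgn_nu sigma nu n = Phi nu (emb n).
Proof. by rewrite /Phi; apply: eq_bigr => j _; rewrite mxE. Qed.

Let r_gt0 : (0 < r)%N. Proof. exact: degree_gt0 hdeg. Qed.

Lemma eq_abs_sum (T : choiceType) (S : set T) (f g : T -> R) :
  (forall i, S i -> f i = g i) -> abs_sum S f = abs_sum S g.
Proof.
by move=> fg; rewrite /abs_sum; congr (fine _ - fine _); apply: eq_esum => i Si; rewrite fg.
Qed.

Section decomposition.
Variables (w : 'I_r -> L) (D : nat).
Hypothesis D0 : (0 < D)%N.
Hypothesis dw : forall i, dual sigma I (w i).
Hypothesis detw : \det (embmx sigma w) != 0.
Hypothesis lw : forall n, dual sigma I n ->
  exists z : 'cV[int]_r, D%:R * n = \sum_i (z i 0)%:~R * w i.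
Variables (m : nat) (b : L).
Hypothesis m0 : (0 < m)%N.
Hypothesis Ib : I b.
Hypothesis xE : forall j, x j = sigma j (b / m%:R).
Variables (k0 : R).
Hypothesis k0_gt0 : 0 < k0.
Hypothesis k0P : forall n, dual sigma I n -> n != 0 -> exists j, k0 <= `|sigma j n|.
Variables (lo hi kappa : R).
Hypothesis lo0 : 0 < lo.
Hypothesis hi0 : 0 <= hi.
Hypothesis k01 : 0 < kappa <= 1.
Hypothesis klo : kappa <= lo * k0.

Local Notation na := (@na L r w D m).
Local Notation pt := (@pt L r w D m).
Local Notation isrep := (@isrep R L r sigma I w D m).
Local Notation B := (cosetB sigma w m).
Let detB : \det B != 0. Proof. exact: det_cosetB. Qed.

(** Some conjugate of [n] has size at least [k0], and [u] multiplies it by at least [lo]; [klo] thus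
    keeps the norm above the cutoff. *)
Lemma rho_dual u n : (forall j, lo <= u j) -> dual sigma I n -> n != 0 ->
  rho kappa u (emb n) = enorm u (emb n).
Proof.
move=> lu dn n0; apply/max_idPr; have [j hj] := k0P dn n0.
apply: (le_trans klo); apply: le_trans (enorm_ge u (emb n) j).
rewrite normrM mxE; apply: ler_pM => //; [exact: ltW|exact: ltW|].
by apply: le_trans (lu j) _; exact: ler_norm.
Qed.

Let base (s : R) (u : 'I_r -> R) (n : L) := rho kappa u (emb n) `^ (- s).

Lemma base_summable (s : R) (u : 'I_r -> R) : r%:R < s -> (forall j, lo <= u j) ->
  (\esum_(n in dual sigma I) (base s u n)%:E < +oo)%E.
Proof.
move=> rs lu.
rewrite (esum_dual hdeg hI D0 dw detw lw m0); last by move=> n; rewrite lee_fin powR_ge0.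
apply: lte_sum_pinfty => a _.
have one01 (v : 'cV[R]_r) : 0 <= (1 : R) <= 1 by rewrite ler01 lexx.
have := @lsum_lty _ _ r_gt0 B (emb (na a)) detB (fun=> 1) _ _ one01 k01 lo0 s u rs lu.
apply: le_lt_trans; rewrite /lsum; apply: le_esum => z _.
by rewrite /Fs mul1r /base emb_pt.
Qed.

Lemma green_term_summable (s : R) (u : 'I_r -> R) : r%:R < s -> (forall j, lo <= u j) ->
  (\esum_(n in dual sigma I `\ 0%R) ((eucl_norm (actR u (embF sigma n)) `^ s)^-1)%:E < +oo)%E.
Proof.
move=> rs lu; apply: le_lt_trans (base_summable rs lu).
rewrite [leRHS]esum_mkcond [leLHS]esum_mkcond; apply: le_esum => n _.
case: ifPn => [|_]; last by case: ifP => //; rewrite lee_fin powR_ge0.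
rewrite inE => -[dn /eqP n0]; rewrite mem_set// lee_fin /base rho_dual// enorm_emb.
by rewrite powRN.
Qed.

Definition Sv bb s u a := fine (lsum B (emb (na a)) (phi nu bb) kappa s u).
Definition Jv bb s u a := fine (lintegral B (emb (na a)) (phi nu bb) kappa s u).
(** Contribution of [n = 0] to the sums over full cosets, finite thanks to the cutoff; the Green
    series omits it. *)
Definition t0 im s : R := Phi nu (0 : 'cV[R]_r) * expi im 0 * kappa `^ (- s).

Lemma rho0 u : rho kappa u (emb 0) = kappa.
Proof.
apply/max_idPl; rewrite /enorm /eucl_norm big1 ?sqrtr0; first by case/andP: k01 => /ltW.
by move=> j _; rewrite /actR mxE rmorph0 mulr0 expr0n.
Qed.

(** The summand is a product of two signed factors, and regrouping by cosets is available for
    nonnegative sums; hence all four combinations of parts are summed separately and recombined at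
    the end. *)
Lemma green_formula im (s : R) (u : 'I_r -> R) : r%:R < s -> (forall j, lo <= u j) ->
  green im s u = \sum_(a | isrep a) expi im (na a) * (Sv false s u a - Sv true s u a) - t0 im s.
Proof.
move=> rs lu.
pose ep n := Num.max (expi im n) 0; pose en n := Num.max (- expi im n) 0.
have ep0 n : 0 <= ep n <= 1.
  have := expi_norm im (2 * pi * TrR (actF sigma n x)); rewrite ler_norml => /andP[h1 h2].
  by rewrite le_max lexx orbT ge_max ler01 andbT.
have en0 n : 0 <= en n <= 1.
  have := expi_norm im (2 * pi * TrR (actF sigma n x)); rewrite ler_norml => /andP[h1 h2].
  by rewrite le_max lexx orbT ge_max ler01 andbT lerNl.
have eE n : expi im n = ep n - en n.
  by rewrite /ep /en !maxEle; case: ifP => h; case: ifP => h'; lra.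
pose F bb n := Fs (phi nu bb) kappa s u (emb n).
have F0 bb n : 0 <= F bb n <= base s u n.
  rewrite /F /Fs; have /andP[p0 p1] := phi01 nu bb (emb n).
  by rewrite mulr_ge0 ?powR_ge0//= ler_piMl ?powR_ge0.
(* [tt false] collects the products of equal sign, [tt true] those of opposite sign; their
   difference is the signed summand. *)
pose tt bb n := ep n * F bb n + en n * F (~~ bb) n.
have tt0 bb n : 0 <= tt bb n.
  have /andP[? _] := ep0 n; have /andP[? _] := en0 n.
  have /andP[? _] := F0 bb n; have /andP[? _] := F0 (~~ bb) n.
  by apply: addr_ge0; apply: mulr_ge0.
have ttle bb n : tt bb n <= 2 * base s u n.
  have /andP[? ?] := ep0 n; have /andP[? ?] := en0 n.
  have /andP[? ?] := F0 bb n; have /andP[? ?] := F0 (~~ bb) n.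
  rewrite /tt mulr_natl mulr2n; apply: lerD.
    by rewrite -[leRHS]mul1r; apply: ler_pM.
  by rewrite -[leRHS]mul1r; apply: ler_pM.
have inj : injnat (dual sigma I) by exact: (injnat_dual D0 lw (subset_refl _)).
have ttsum bb : (\esum_(n in dual sigma I) (tt bb n)%:E < +oo)%E.
  apply: (@le_lt_trans _ _ (\esum_(n in dual sigma I) (2%:E * (base s u n)%:E))%E).
    by apply: le_esum => n _; rewrite -EFinM lee_fin.
  rewrite esumZl//; last by move=> n; rewrite lee_fin powR_ge0.
  by rewrite lte_mul_pinfty ?lee_fin// base_summable.
have ttD bb : (\esum_(n in dual sigma I) (tt bb n)%:E =
    (tt bb 0%R)%:E + \esum_(n in dual sigma I `\ 0%R) (tt bb n)%:E)%E.
  rewrite (esumID [set 0]); last by move=> n _; rewrite lee_fin.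
  rewrite setDE; congr (_ + _)%E.
  have -> : dual sigma I `&` [set 0] = [set 0].
    apply/seteqP; split => [n []//|n ->]; split => //.
    by move=> c Ic; exists 0; rewrite mul0r /TrR big1// => j _; rewrite /embF rmorph0.
  by rewrite esum_set1// lee_fin.
have ttsum' bb : (\esum_(n in dual sigma I `\ 0%R) (tt bb n)%:E < +oo)%E.
  apply: le_lt_trans (ttsum bb); rewrite ttD leeDr// lee_fin//.
have E1 : green im s u = fine (\esum_(n in dual sigma I `\ 0%R) (tt false n)%:E) -
    fine (\esum_(n in dual sigma I `\ 0%R) (tt true n)%:E).
  rewrite -abs_sumB//; apply: eq_abs_sum => n [dn /eqP n0].
  rewrite /green_term sgn_nuE -phiB eE -enorm_emb -(rho_dual lu dn n0) -powRN /tt /F /Fs /=.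
  ring.
have Sfin bb a : lsum B (emb (na a)) (phi nu bb) kappa s u \is a fin_num.
  rewrite ge0_fin_numE; first exact: (@lsum_lty _ _ r_gt0 B (emb (na a)) detB (phi nu bb) _ _ (phi01 nu bb) k01 lo0 s u rs lu).
  by apply: esum_ge0 => z _; rewrite lee_fin; apply: F_ge0; exact: phi01.
have E2 bb : fine (\esum_(n in dual sigma I) (tt bb n)%:E) =
    \sum_(a | isrep a) (ep (na a) * Sv bb s u a + en (na a) * Sv (~~ bb) s u a).
  rewrite (esum_dual hdeg hI D0 dw detw lw m0); last by move=> n; rewrite lee_fin.
  transitivity (fine (\sum_(a | isrep a) (ep (na a) * Sv bb s u a + en (na a) * Sv (~~ bb) s u a)%:E)%E); last first.
    by rewrite sumEFin.
  congr fine; apply: eq_bigr => a _.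
  have per z : expi im (pt a z) = expi im (na a) by exact: (expi_shift dw m0 Ib xE).
  have ppz z : 0 <= Fs (phi nu bb) kappa s u (lpt B (emb (na a)) (intv R z)).
    by apply: F_ge0; exact: phi01.
  have pnz z : 0 <= Fs (phi nu (~~ bb)) kappa s u (lpt B (emb (na a)) (intv R z)).
    by apply: F_ge0; exact: phi01.
  have /andP[? _] := ep0 (na a); have /andP[? _] := en0 (na a).
  rewrite EFinD !EFinM /Sv !fineK// /lsum -!esumZl//; try exact: injnat_countType.
  rewrite -esumD; last 2 first.
  - by move=> z _; rewrite mule_ge0 ?lee_fin.
  - by move=> z _; rewrite mule_ge0 ?lee_fin.
  have FE b' z : F b' (pt a z) = Fs (phi nu b') kappa s u (lpt B (emb (na a)) (intv R z)).
    by rewrite /F emb_pt.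
  have epE z : ep (pt a z) = ep (na a) by rewrite /ep per.
  have enE z : en (pt a z) = en (na a) by rewrite /en per.
  by apply: eq_esum => z _; rewrite /tt epE enE !FE EFinD !EFinM.
have fD bb : fine (\esum_(n in dual sigma I `\ 0%R) (tt bb n)%:E) =
    fine (\esum_(n in dual sigma I) (tt bb n)%:E) - tt bb 0.
  have Xf : (\esum_(n in dual sigma I `\ 0%R) (tt bb n)%:E \is a fin_num)%E.
    by rewrite ge0_fin_numE// esum_ge0// => n _; rewrite lee_fin.
  have tf : (tt bb 0)%:E \is a fin_num by [].
  by rewrite ttD (fineD tf Xf) addrAC subrr add0r.
rewrite E1 !fD !E2.
have -> : \sum_(a | isrep a) expi im (na a) * (Sv false s u a - Sv true s u a) =
  \sum_(a | isrep a) (ep (na a) * Sv false s u a + en (na a) * Sv true s u a) -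
  \sum_(a | isrep a) (ep (na a) * Sv true s u a + en (na a) * Sv false s u a).
  by rewrite -sumrB; apply: eq_bigr => a _; rewrite eE; ring.
have -> : t0 im s = tt false 0 - tt true 0.
  have emb0 : emb 0 = 0 by apply/colP => j; rewrite !mxE rmorph0.
  by rewrite /t0 /tt /F /Fs rho0 eE emb0 -phiB /=; ring.
ring.
Qed.

Hypothesis hdeg0 : ~ ((forall j, nu j = false) /\ congr_mod sigma I x (fun=> 0)).

(** The integral does not see the translation by [na a], so it factors out of the sum over cosets,
    leaving a product in which one factor vanishes. *)
Lemma main_term_eq0 im s u :
  \sum_(a | isrep a) expi im (na a) * (Jv false s u a - Jv true s u a) = 0.
Proof.
have JE bb a : Jv bb s u a =
    fine (`|\det B|^-1%:E * iint setT (fun y => (Fs (phi nu bb) kappa s u y)%:E))%E.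
  by rewrite /Jv (lintegralE _ detB kappa (phi01 nu bb) (cmeas_phi nu bb)).
rewrite (eq_bigr _ (fun a _ => congr1 _ (congr2 (fun p q => p - q) (JE false a) (JE true a)))).
rewrite -mulr_suml.
have [[j nuj]|nonu] := pselect (exists j, nu j).
  by rewrite (iint_phi_sym s u nuj k01) subrr mulr0.
rewrite (charsum hdeg hsigma hI D0 dw detw lw m0 Ib xE) ?mul0r// => Ibm; apply: hdeg0; split.
  by move=> j; apply/negbTE/negP => nuj; apply: nonu; exists j.
have h j : x j - 0 = sigma j (b / m%:R) by rewrite subr0 xE.
by have [_] := congr_modP hdeg I h; exact.
Qed.

Lemma green_diff im (s : R) (u : 'I_r -> R) : r%:R < s -> (forall j, lo <= u j) ->
  green im s u = \sum_(a | isrep a) expi im (na a) *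
    ((Sv false s u a - Jv false s u a) - (Sv true s u a - Jv true s u a)) - t0 im s.
Proof.
move=> rs lu; rewrite green_formula//; congr (_ - _).
rewrite -[LHS]subr0 -[X in _ - X](main_term_eq0 im s u) -sumrB.
by apply: eq_bigr => a _; ring.
Qed.

Lemma green_bounded_aux im : exists C : R, forall (s : R) (u : 'I_r -> R),
  r%:R < s <= r%:R + 1 -> (forall j, lo <= u j <= hi) -> `|green im s u| <= C.
Proof.
have bnd bb a := lsum_sub_lintegral_bounded r_gt0 (emb (na a)) detB (phi01 nu bb)
  (@sparse_phi R r nu bb) (cmeas_phi nu bb) k01 lo0 hi0.
pose C bb a := projT1 (cid (bnd bb a)).
exists (\sum_(a | isrep a) (C false a + C true a) + kappa `^ (- (r%:R + 1))) => s u sr uh.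
have /andP[rs sr1] := sr.
have lu j : lo <= u j by case/andP: (uh j).
have CP bb a : `|Sv bb s u a - Jv bb s u a| <= C bb a.
  by rewrite /C; case: cid => c /= /(_ s u sr uh).
rewrite green_diff// (le_trans (ler_normB _ _))// lerD//.
  apply: le_trans (ler_norm_sum _ _ _) _; apply: ler_sum => a _.
  rewrite normrM -[leRHS]mul1r ler_pM//; first exact: expi_norm.
  by rewrite (le_trans (ler_normB _ _))// lerD.
have one01 (v : 'cV[R]_r) : 0 <= (1 : R) <= 1 by rewrite ler01 lexx.
have s01 : 0 <= s <= r%:R + 1 by rewrite sr1 (le_trans _ (ltW rs)).
have := F_le (phi := fun=> 1) one01 k01 u (emb 0) s01.
rewrite /Fs mul1r rho0; apply: le_trans.
rewrite /t0 normrM (ger0_norm (powR_ge0 _ _)) ler_piMl ?powR_ge0//.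
by rewrite normrM mulr_ile1// ?Phi_norm//; exact: expi_norm.
Qed.

(** The limit is fixed before the sequence, as is required to pass from sequences to a one-sided
    limit. *)
Lemma cvg_green_aux im (u : 'I_r -> R) : (forall j, lo <= u j <= hi) ->
  exists l : R, forall s_ : nat -> R, (forall k, r%:R < s_ k <= r%:R + 1) ->
    s_ k @[k --> \oo] --> (r%:R : R) -> green im (s_ k) u @[k --> \oo] --> l.
Proof.
move=> uh; have lu j : lo <= u j by case/andP: (uh j).
pose l bb a := abs_sum [set: 'cV[int]_r] (cell_diff B (emb (na a)) (phi nu bb) kappa r%:R u).
exists (\sum_(a | isrep a) expi im (na a) * (l false a - l true a) - t0 im r%:R) => s_ sr scvg.
have SJ bb a : Sv bb (s_ k) u a - Jv bb (s_ k) u a @[k --> \oo] --> l bb a.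
  exact: (cvg_lsum_sub_lintegral (c := emb (na a)) r_gt0 detB (phi01 nu bb)
    (@sparse_phi R r nu bb) (cmeas_phi nu bb) k01 lo0 hi0 sr scvg uh).
rewrite (_ : (fun k => green im (s_ k) u) = fun k => \sum_(a | isrep a) expi im (na a) *
    ((Sv false (s_ k) u a - Jv false (s_ k) u a) - (Sv true (s_ k) u a - Jv true (s_ k) u a))
    - t0 im (s_ k)); last first.
  by apply/funext => k; rewrite green_diff//; case/andP: (sr k).
apply: cvgB.
  apply: cvg_big => [|a _]; first exact: add_continuous.
  by apply: cvgMl_tmp; apply: cvgB; exact: SJ.
apply: cvgMl_tmp.
have one01 (v : 'cV[R]_r) : 0 <= (1 : R) <= 1 by rewrite ler01 lexx.
have := @cvg_F R r (fun=> 1) kappa k01 s_ r%:R u (emb 0) scvg.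
by rewrite /Fs rho0; under eq_fun do rewrite mul1r; rewrite mul1r.
Qed.

End decomposition.

Hypothesis hdeg0 : ~ ((forall j, nu j = false) /\ congr_mod sigma I x (fun=> 0)).

Lemma green_bounded im (lo hi : R) : 0 < lo -> 0 <= hi ->
  exists C : R, forall (s : R) (u : 'I_r -> R),
  r%:R < s <= r%:R + 1 -> (forall j, lo <= u j <= hi) -> `|green im s u| <= C.
Proof.
move=> lo0 hi0.
have [w [D [D0 dw detw lw _]]] := ideal_lattice hdeg hsigma hI.
have [m [b [m0 Ib xE]]] := torsion_point hx.
have [k0 k00 k0P] := dual_lower hdeg D0 detw lw.
pose kappa := Num.min 1 (lo * k0).
have k01 : 0 < kappa <= 1 by rewrite lt_min ltr01 mulr_gt0//= ge_min lexx.
have klo : kappa <= lo * k0 by rewrite ge_min lexx orbT.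
exact: (@green_bounded_aux w D D0 dw detw lw m b m0 Ib xE k0 k00 k0P lo hi kappa).
Qed.

Lemma cvg_green_seq im (u : 'I_r -> R) : (forall j, 0 < u j) ->
  exists l : R, forall s_ : nat -> R, (forall k, r%:R < s_ k <= r%:R + 1) ->
    s_ k @[k --> \oo] --> (r%:R : R) -> green im (s_ k) u @[k --> \oo] --> l.
Proof.
move=> u0.
have [w [D [D0 dw detw lw _]]] := ideal_lattice hdeg hsigma hI.
have [m [b [m0 Ib xE]]] := torsion_point hx.
have [k0 k00 k0P] := dual_lower hdeg D0 detw lw.
pose lo : R := \big[Num.min/1]_j u j; pose hi : R := \sum_j u j.
have lo0 : 0 < lo by rewrite /lo; elim/big_ind: _ => // p q p0 q0; rewrite lt_min p0.
have hi0 : 0 <= hi by rewrite sumr_ge0// => j _; exact: ltW.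
have uh j : lo <= u j <= hi.
  rewrite /hi (bigD1 j)//= lerDl sumr_ge0 ?andbT; last by move=> i _; exact: ltW.
  by rewrite /lo (bigD1 j)//= ge_min lexx.
pose kappa := Num.min 1 (lo * k0).
have k01 : 0 < kappa <= 1 by rewrite lt_min ltr01 mulr_gt0//= ge_min lexx.
have klo : kappa <= lo * k0 by rewrite ge_min lexx orbT.
exact: (@cvg_green_aux w D D0 dw detw lw m b m0 Ib xE k0 k00 k0P lo hi kappa).
Qed.

Lemma cvg_green im (u : 'I_r -> R) : (forall j, 0 < u j) ->
  green im (r%:R + eta) u @[eta --> 0^'+] --> green_part sigma im I nu x u.
Proof.
move=> u0; have [l lP] := cvg_green_seq im u0.
suff h : green im (r%:R + eta) u @[eta --> 0^'+] --> l.
  by rewrite /green_part (cvg_lim _ h).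
apply: cvg_at_right0 => e_ e01 ecvg; apply: (lP (fun k => r%:R + e_ k)).
  by move=> k; rewrite ltrDl lerD2l.
by rewrite -[X in _ --> X]addr0; apply: cvgD => //; exact: cvg_cst.
Qed.

End green_function.

Lemma reindex_abs_sum (R : realType) (T T' : choiceType) (P : set T) (Q : set T') (e : T -> T')
  (f : T' -> R) : set_bij P Q e -> abs_sum Q f = abs_sum P (f \o e).
Proof. by move=> be; rewrite /abs_sum !(reindex_esum P Q e _ be). Qed.

(** * Invariance under totally positive units *)

Section units.
Variables (R : realType) (L : fieldExtType rat) (r : nat).
Variable sigma : 'I_r -> {rmorphism L -> R}.
Hypothesis hdeg : \dim {: L} = r.
Hypothesis hsigma : injective sigma.
Variable I : set L.
Hypothesis hI : frac_ideal I.
Variables (nu : 'I_r -> bool) (x : 'I_r -> R).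
Local Notation expi := (@expi R L r sigma x).
Local Notation dual0 := (dual sigma I `\ 0).

Lemma sgn_nu_unit e n : (forall j, 0 < sigma j e) -> sgn_nu sigma nu (e * n) = sgn_nu sigma nu n.
Proof.
by move=> e0; apply: eq_bigr => j _; rewrite rmorphM sgrM gtr0_sg ?mul1r.
Qed.

Lemma expi_unit im e n : congr_mod sigma I (actF sigma e x) x -> dual sigma I n ->
  expi im (e * n) = expi im n.
Proof.
move=> [b Ib eb] dn; have [z zE] := dn _ Ib.
rewrite /expi -(expi_period im (TrR (actF sigma n x)) z) -zE; congr (expi_part im (_ * _)).
rewrite /TrR -big_split /=; apply: eq_bigr => j _.
by rewrite /actF /embF !rmorphM -(eb j) /actF; ring.
Qed.

Lemma dual0_unit e n : tot_pos_unit sigma e -> dual0 n -> dual0 (e * n).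
Proof.
move=> [e0 ie _ _] [dn /eqP n0]; split; first exact: dual_mul.
by apply/eqP; rewrite mulf_neq0.
Qed.

Lemma dual0_bij e : tot_pos_unit sigma e -> set_bij dual0 dual0 (fun n => e * n).
Proof.
move=> eu; have [e0 _ _ _] := eu; split => [n|n n' _ _|n dn]; first exact: dual0_unit.
  exact: mulfI.
exists (e^-1 * n); first by apply: dual0_unit => //; exact: tot_pos_unitV.
by rewrite mulVKf.
Qed.

(** Moving [e] from [u] to [n] keeps the norm; the signs do not change because [e] is totally
    positive, nor does the character because [e] fixes [x] modulo [I]. *)
Lemma green_term_unit im s u e n : tot_pos_unit sigma e ->
  congr_mod sigma I (actF sigma e x) x -> dual sigma I n ->
  green_term sigma nu x im s (actF sigma e u) n = green_term sigma nu x im s u (e * n).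
Proof.
move=> eu ex dn; have [_ _ _ e0] := eu.
rewrite /green_term (sgn_nu_unit _ e0) (expi_unit _ ex dn); congr (_ / eucl_norm _ `^ _).
by apply/funext => j; rewrite /actR /actF /embF rmorphM; ring.
Qed.

Lemma green_unit im s u e : tot_pos_unit sigma e ->
  congr_mod sigma I (actF sigma e x) x ->
  green sigma I nu x im s (actF sigma e u) = green sigma I nu x im s u.
Proof.
move=> eu ex; rewrite /green [RHS](reindex_abs_sum _ (dual0_bij eu)).
by apply: eq_abs_sum => n [dn _]; rewrite green_term_unit.
Qed.

(** The functions under the two limits coincide, so no convergence is involved. *)
Lemma green_part_unit im u e : tot_pos_unit sigma e ->
  congr_mod sigma I (actF sigma e x) x ->
  green_part sigma im I nu x (actF sigma e u) = green_part sigma im I nu x u.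
Proof.
move=> eu ex.
have gE v : green_part sigma im I nu x v =
  lim (green sigma I nu x im (r%:R + eta) v @[eta --> 0^'+]) by [].
have h : (fun eta => green sigma I nu x im (r%:R + eta) (actF sigma e u)) =
    (fun eta => green sigma I nu x im (r%:R + eta) u).
  by apply/funext => eta; exact: green_unit.
rewrite (gE u) (gE (actF sigma e u)).
exact: (congr1 (fun f : R -> R => lim (f eta @[eta --> 0^'+])) h).
Qed.

Lemma dual0_summable (s : R) (u : 'I_r -> R) : r%:R < s -> (forall j, 0 < u j) ->
  (\esum_(n in dual sigma I `\ 0%R) ((eucl_norm (actR u (embF sigma n)) `^ s)^-1)%:E < +oo)%E.
Proof.
move=> rs u0.
have [w [D [D0 dw detw lw _]]] := ideal_lattice hdeg hsigma hI.
have [k0 k00 k0P] := dual_lower hdeg D0 detw lw.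
pose lo : R := \big[Num.min/1]_j u j.
have lo0 : 0 < lo by rewrite /lo; elim/big_ind: _ => // p q p0 q0; rewrite lt_min p0.
have lu j : lo <= u j by rewrite /lo (bigD1 j)//= ge_min lexx.
pose kappa := Num.min 1 (lo * k0).
have k01 : 0 < kappa <= 1 by rewrite lt_min ltr01 mulr_gt0//= ge_min lexx.
have klo : kappa <= lo * k0 by rewrite ge_min lexx orbT.
exact: (green_term_summable hdeg hI D0 dw detw lw (ltn0Sn 0) k00 k0P lo0 k01 klo rs lu).
Qed.

Lemma injnat_dual0 : injnat dual0.
Proof.
have [w [D [D0 dw detw lw _]]] := ideal_lattice hdeg hsigma hI.
by apply: (injnat_dual D0 lw) => n [].
Qed.

End units.

(** * The unit lattice and unfolding *)

Section bounded_elements.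
Variables (R : realType) (L : fieldExtType rat) (r : nat).
Variable sigma : 'I_r -> {rmorphism L -> R}.
Hypothesis hdeg : \dim {: L} = r.
Hypothesis hsigma : injective sigma.
Variable I : set L.
Hypothesis hI : frac_ideal I.

Lemma dual_nonzero : exists2 a, dual sigma I a & a != 0.
Proof.
have [_ _ _ _ [a [a0 _ aI]]] := hI; exists a => // b /aI; exact: integral_Tr.
Qed.

(** Pigeonhole: the integer coordinates of [D * f N] in [w] are bounded in terms of [T], so they
    take finitely many values. *)
Lemma dual_bounded_repeats (T : R) (f : nat -> L) : (forall N, dual sigma I (f N)) ->
  (forall N j, `|sigma j (f N)| <= T) -> exists N N', N <> N' /\ f N = f N'.
Proof.
move=> df fT.
have [w [D [D0 dw detw lw _]]] := ideal_lattice hdeg hsigma hI.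
pose W := invmx (embmx sigma w).
pose z N := projT1 (cid (lw _ (df N))).
have zE N : D%:R * f N = \sum_i (z N i 0)%:~R * w i by rewrite /z; case: cid.
have T0 : 0 <= T by apply: le_trans (fT 0%N (Ordinal (degree_gt0 hdeg))).
have zW N : intv R (z N) = W *m (D%:R *: emb sigma (f N)).
  have -> : D%:R *: emb sigma (f N) = embmx sigma w *m intv R (z N).
    apply/colP => j; rewrite !mxE.
    transitivity (sigma j (D%:R * f N)); first by rewrite rmorphM rmorph_nat.
    rewrite zE rmorph_sum; apply: eq_bigr => i _.
    by rewrite !mxE rmorphM rmorph_int mulrC.
  by rewrite mulmxA mulVmx ?mul1mx// unitmxE unitfE.
pose B : R := \sum_i \sum_j `|W i j| * (D%:R * T).
have zB N i : `|(z N i 0)%:~R| <= B.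
  have := congr1 (fun v : 'cV[R]_r => v i 0) (zW N); rewrite [LHS]mxE => ->.
  rewrite mxE (le_trans (ler_norm_sum _ _ _))//.
  rewrite /B [leRHS](bigD1 i)//= ler_wpDr ?sumr_ge0//.
    by move=> k _; apply: sumr_ge0 => j _; rewrite !mulr_ge0.
  apply: ler_sum => j _; rewrite normrM ler_wpM2l// !mxE normrM normr_nat.
  by rewrite ler_wpM2l.
pose Z := (Num.truncn B).+1.
have BZ : B < Z%:R by rewrite /Z; exact: truncnS_gt.
have zZ N i : (`|z N i 0%R| <= Z)%N.
  rewrite -(ler_nat R) natr_absz intr_norm; exact: le_trans (zB N i) (ltW BZ).
pose g N : {ffun 'I_r -> 'I_(2 * Z).+1} := [ffun i => inord `|(z N i 0 + Z%:Z)%R|%N].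
have ginj N N' : g N = g N' -> z N = z N'.
  move=> /ffunP gE; apply/colP => i; have := congr1 val (gE i); rewrite !ffunE /=.
  have h1 := zZ N i; have h2 := zZ N' i; rewrite !inordK; lia.
pose P := #|{: {ffun 'I_r -> 'I_(2 * Z).+1}}|.
have : ~ injective (fun N : 'I_P.+1 => g N).
  by move=> /leq_card; rewrite card_ord ltnn.
move=> /injectiveP/injectivePn[N [N' NN' gE]]; exists N, N'; split.
  by move=> h; move/eqP: NN'; apply; exact: val_inj.
apply: (mulfI (natL_neq0 L D0)); by rewrite !zE (ginj _ _ gE).
Qed.
End bounded_elements.

(** * Logarithmic coordinates, the regulator and unfolding *)

Section unit_lattice.
Variables (R : realType) (L : fieldExtType rat) (d : nat).
Variable sigma : 'I_d.+1 -> {rmorphism L -> R}.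
Hypothesis hdeg : \dim {: L} = d.+1.
Hypothesis hsigma : injective sigma.
Variable U : set L.
Hypothesis hU : forall e, U e -> tot_pos_unit sigma e.
Hypothesis U1 : U 1.
Hypothesis UM : forall e f, U e -> U f -> U (e * f).
Hypothesis UV : forall e, U e -> U e^-1.
Variable eps : 'I_d -> L.
Hypothesis heps : @unit_basis L d.+1 U eps.

Definition logu (y : 'cV[R]_d) (j : 'I_d.+1) : R := \sum_k y k 0 * ln (sigma j (eps k)).

Definition epsm (m : 'cV[int]_d) : L := \prod_(k < d) eps k ^ m k 0.

Let eps_gt0 j k : 0 < sigma j (eps k).
Proof. by have [h _] := heps; have [_ _ _] := hU (h k). Qed.

Lemma UR_pointE y j : @UR_point R L d.+1 sigma eps (seqv y) j = expR (logu y j).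
Proof.
rewrite /UR_point /logu expR_sum; apply: eq_bigr => k _.
by rewrite /powR gt_eqF// nth_seqv.
Qed.

Lemma sigma_epsm m j : sigma j (epsm m) = expR (logu (intv R m) j).
Proof.
rewrite /epsm rmorph_prod /logu expR_sum; apply: eq_bigr => k _.
rewrite mxE mulrC -[in RHS]mulrC.
transitivity (sigma j (eps k) `^ (m k 0)%:~R); last by rewrite /powR gt_eqF.
rewrite powR_intmul ?(ltW (eps_gt0 _ _))//.
by case: (m k 0) => n; [exact: rmorphXn|rewrite /exprz fmorphV rmorphXn].
Qed.

Lemma U_epsm m : U (epsm m).
Proof.
rewrite /epsm; elim/big_ind: _ => // k _.
have [h _] := heps.
have UX n : U (eps k ^+ n) by elim: n => [|n IH]; rewrite ?expr0// exprS; exact: UM.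
by case: (m k 0) => n; [exact: UX|exact/UV/UX].
Qed.

Lemma epsm_inj : injective epsm.
Proof.
move=> m m' mE; have [_ /(_ _ (U_epsm m))[m0 [_ h]]] := heps.
have e1 := h (fun k => m k 0) erefl; have e2 := h (fun k => m' k 0) mE.
by apply/colP => k; rewrite -[LHS](congr1 (@^~ k) e1) -[RHS](congr1 (@^~ k) e2).
Qed.

Lemma epsm_surj e : U e -> exists m, e = epsm m.
Proof.
move=> Ue; have [_ /(_ _ Ue)[m0 [mE _]]] := heps.
by exists (\col_k m0 k); rewrite mE; apply: eq_bigr => k _; rewrite mxE.
Qed.

Lemma logu_sum y : \sum_j logu y j = 0.
Proof.
rewrite exchange_big /= big1// => k _; rewrite -mulr_sumr.
suff -> : \sum_j ln (sigma j (eps k)) = 0 by rewrite mulr0.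
apply: expR_inj; rewrite expR0 expR_sum.
have [h _] := heps; rewrite -[RHS](tot_pos_unit_NR hdeg hsigma (hU (h k))) /NR.
by apply: eq_bigr => j _; rewrite lnK// posrE.
Qed.

Definition Amx : 'M[R]_d := \matrix_(j, k) ln (sigma (widen_ord (leqnSn d) j) (eps k)).

Lemma regulatorE : @regulator R L d.+1 sigma eps = `|\det Amx|.
Proof.
rewrite /regulator; congr (`|\det _|); apply/matrixP => j k; rewrite !mxE.
by congr (ln (sigma _ _)); exact: val_inj.
Qed.

Lemma Amx_mul y j : (Amx *m y) j 0 = logu y (widen_ord (leqnSn d) j).
Proof. by rewrite mxE; apply: eq_bigr => k _; rewrite mxE mulrC. Qed.

Lemma logu_last y : logu y ord_max = - \sum_j (Amx *m y) j 0.
Proof.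
apply/eqP; rewrite -addr_eq0 addrC; apply/eqP; rewrite -[RHS](logu_sum y) big_ord_recr /=.
by congr (_ + _); apply: eq_bigr => j _; rewrite Amx_mul.
Qed.

(* If the logarithms were linearly dependent, rounding the multiples of a
   dependency would give infinitely many units with bounded conjugates. *)
Lemma det_Amx_neq0 (I : set L) : frac_ideal I -> \det Amx != 0.
Proof.
move=> hI; apply/negP; rewrite -det_tr => /det0P[v v0 vA].
have [k0 vk0] : exists k, v 0 k != 0.
  by apply/existsP; move: v0; apply: contraNT; rewrite negb_exists => /forallP h;
    apply/eqP/rowP => k; rewrite mxE; apply/eqP; move: (h k); rewrite negbK.
have vA0 : Amx *m v^T = 0 by rewrite -[LHS]trmxK trmx_mul trmxK vA trmx0.
have lv0 j : logu v^T j = 0.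
  case: (unliftP ord_max j) => [i|] ->; last by rewrite logu_last vA0 big1 ?oppr0// => i _; rewrite mxE.
  have -> : lift ord_max i = widen_ord (leqnSn d) i by apply: val_inj; rewrite /= /bump leqNgt ltn_ord.
  by rewrite -Amx_mul vA0 mxE.
(* With this scaling the coordinate [k0] of [m N] is [N] itself, so the exponent vectors are
   pairwise distinct. *)
pose K := (v 0 k0)^-1.
pose m (N : nat) : 'cV[int]_d := \col_k Num.floor (N%:R * K * v 0 k).
have mk0 N : m N k0 0 = N%:Z.
  by rewrite mxE -mulrA mulVf// mulr1 -[N%:R]/((N%:Z)%:~R) intrKfloor.
(* The pigeonhole lemma speaks of dual elements, so the units are multiplied by a fixed nonzero
   one. *)
have [a da a0] := dual_nonzero hdeg hsigma hI.
(* Exact multiples of the dependency have zero logarithms and rounding moves each coordinate by at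
   most [1], so [M] bounds the logarithms. *)
pose M : R := \sum_j \sum_k `|ln (sigma j (eps k))|.
pose T : R := expR M * \sum_j `|sigma j a|.
have bnd N j : logu (intv R (m N)) j <= M.
  rewrite -[leLHS]subr0 -[X in _ - X](mulr0 (N%:R * K)) -(lv0 j) /logu mulr_sumr -sumrB.
  rewrite /M (bigD1 j)//= ler_wpDr ?sumr_ge0//.
    by move=> i _; apply: sumr_ge0.
  apply: ler_sum => k _; rewrite !mxE mulrA -mulrBl.
  apply: le_trans (ler_norm _) _; rewrite normrM ler_piMl//.
  have /andP[h1 h2] := floor_itv (N%:R * K * v 0 k); rewrite ler_norml.
  rewrite intrD in h2; set F := (Num.floor _)%:~R in h1 h2 *; set X := _ * v 0 k in h1 h2 *.
  by apply/andP; split; lra.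
have [||N [N' [NN']]] := @dual_bounded_repeats _ _ _ _ hdeg hsigma _ hI T (fun N => epsm (m N) * a).
- by move=> N; apply: dual_mul => //; have [] := hU (U_epsm (m N)).
- move=> N j; rewrite rmorphM normrM sigma_epsm ger0_norm ?expR_ge0// ler_pM ?expR_ge0//.
    by rewrite ler_expR.
  by rewrite (bigD1 j)//= lerDl sumr_ge0.
move=> /(mulIf a0)/epsm_inj mm; apply: NN'.
by have := mk0 N; rewrite mm mk0 => -[].
Qed.


Definition ur (y : 'cV[R]_d) : 'I_d.+1 -> R := fun j => expR (logu y j).

Lemma ur_gt0 y j : 0 < ur y j. Proof. exact: expR_gt0. Qed.

Lemma ur_epsm y m j : ur y j * sigma j (epsm m) = ur (y + intv R m) j.
Proof.
rewrite sigma_epsm /ur -expRD; congr expR; rewrite /logu -big_split /=.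
by apply: eq_bigr => k _; rewrite !mxE mulrDl.
Qed.

Definition hterm (n : L) (s : R) (y : 'cV[R]_d) : R :=
  (eucl_norm (actR (ur y) (embF sigma n)) `^ s)^-1.

Lemma hterm_ge0 n s y : 0 <= hterm n s y.
Proof. by rewrite invr_ge0 powR_ge0. Qed.

Lemma hterm_epsm n m s y : hterm (epsm m * n) s y = hterm n s (y + intv R m).
Proof.
rewrite /hterm; congr ((eucl_norm _ `^ _)^-1); apply/funext => j.
by rewrite /actR /embF rmorphM mulrA ur_epsm.
Qed.

Let lnsum (n : L) : R := \sum_j ln `|sigma j n|.

(** Logarithms of the conjugates minus their mean: for [n != 0] this writes [n], up to signs, as
    [|N n| ^ (1/r)] times a point of [U_R]. The last coordinate is minus the sum of the others and
    is dropped. *)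
Definition logshift (n : L) : 'cV[R]_d :=
  \col_j (ln `|sigma (widen_ord (leqnSn d) j) n| - lnsum n / d.+1%:R).

Lemma hterm_formula n s y : n != 0 ->
  hterm n s y = (`|NR (embF sigma n)| `^ (s / d.+1%:R))^-1 *
    logsqnorm (Amx *m y + logshift n) `^ (- (s / 2)).
Proof.
move=> n0.
have sn0 j : 0 < `|sigma j n| by rewrite normr_gt0 fmorph_eq0.
have NE : `|NR (embF sigma n)| = expR (lnsum n).
  by rewrite normr_prod expR_sum; apply: eq_bigr => j _; rewrite lnK// posrE.
have QE : \sum_j actR (ur y) (embF sigma n) j ^+ 2 =
    expR (2 * (lnsum n / d.+1%:R)) * logsqnorm (Amx *m y + logshift n).
  have sqE j : actR (ur y) (embF sigma n) j ^+ 2 = expR (2 * (logu y j + ln `|sigma j n|)).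
    rewrite mulr_natl mulr2n !expRD lnK ?posrE//.
    rewrite -[LHS]real_normK ?num_real// /actR normrM (ger0_norm (ltW (ur_gt0 y j))).
    by rewrite /ur /embF; ring.
  rewrite (eq_bigr _ (fun j _ => sqE j)) big_ord_recr /= /logsqnorm [RHS]mulrDr mulr_sumr.
  congr (_ + _).
    by apply: eq_bigr => j _; rewrite -expRD mxE Amx_mul mxE; congr expR; ring.
  rewrite -expRD; congr expR; rewrite logu_last.
  have -> : \sum_i (Amx *m y + logshift n) i 0 = \sum_i (Amx *m y) i 0 +
      (lnsum n - ln `|sigma ord_max n|) - d%:R * (lnsum n / d.+1%:R).
    have -> : lnsum n - ln `|sigma ord_max n| = \sum_(i < d) ln `|sigma (widen_ord (leqnSn d) i) n|.
      by rewrite /lnsum big_ord_recr /= addrK.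
    rewrite (eq_bigr (fun i : 'I_d => (Amx *m y) i 0 + ln `|sigma (widen_ord (leqnSn d) i) n| - lnsum n / d.+1%:R)); last first.
      by move=> i _; rewrite mxE [logshift _ _ _]mxE addrA.
    by rewrite sumrB big_split /= sumr_const card_ord [in RHS]mulr_natl.
  have -> : d%:R = d.+1%:R - 1 :> R by rewrite -natr1 addrK.
  by field; rewrite addrC natr1 pnatr_eq0.
rewrite /hterm /eucl_norm QE -powRN -powR12_sqrt ?mulr_ge0 ?expR_ge0 ?(ltW (logsqnorm_gt0 _))//.
rewrite -powRrM powRM ?expR_ge0 ?(ltW (logsqnorm_gt0 _))//.
rewrite NE -powRN /powR !gt_eqF ?expR_gt0 ?logsqnorm_gt0// !expRK.
set l := ln _; congr (_ * _); congr expR.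
  by field.
by field.
Qed.

Lemma cmeas_hterm n s : cmeasR (hterm n s).
Proof.
have [->|n0] := eqVneq n 0.
  rewrite (_ : hterm 0 s = fun=> hterm 0 s 0); first by move=> dd Y g _; exact: measurable_cst.
  apply/funext => y; rewrite /hterm; congr ((eucl_norm _ `^ _)^-1); apply/funext => j.
  by rewrite /actR /embF rmorph0 !mulr0.
rewrite /cmeasR (_ : (fun y => _) = fun y => ((`|NR (embF sigma n)| `^ (s / d.+1%:R))^-1%:E *
    (logsqnorm (Amx *m y + logshift n) `^ (- (s / 2)))%:E)%E).
  move=> dd Y g mg; apply: measurable_funeM.
  by apply: (cmeas_affine (f := fun w => (logsqnorm w `^ (- (s / 2)))%:E)) => //; exact: cmeas_logsqnorm.
by apply/funext => y; rewrite hterm_formula.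
Qed.

Variable I : set L.
Hypothesis hI : frac_ideal I.

Definition zeta_cst (s : R) : R := 2 / d.+1%:R * (Gamma (s / d.+1%:R / 2) / 2) ^+ d.+1 / Gamma (s / 2).

(** Translation invariance absorbs [logshift n], so [n] survives only through its norm. The Jacobian
    is the inverse regulator, to be cancelled by the factor in [quot_integral]. *)
Lemma iint_hterm n s : n != 0 -> 0 < s -> iint setT (fun y => (hterm n s y)%:E) =
  ((`|\det Amx|^-1 * zeta_cst s)%:E * ((`|NR (embF sigma n)| `^ (s / d.+1%:R))^-1)%:E)%E.
Proof.
move=> n0 s0.
pose G (w : 'cV[R]_d) := (logsqnorm w `^ (- (s / 2)))%:E.
have cG : cmeas G by exact: cmeas_logsqnorm.
have G0 w : (0 <= G w)%E by rewrite lee_fin powR_ge0.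
transitivity (iint setT (fun y => ((`|NR (embF sigma n)| `^ (s / d.+1%:R))^-1%:E *
    G (Amx *m y + logshift n)%R)%E)).
  by apply: eq_iint => y _; rewrite hterm_formula// EFinM.
have cA := @cmeas_affine R d d G Amx (logshift n) cG.
rewrite (iintZl measurableT cA (fun y => G0 _)); last by rewrite lee_fin invr_ge0 powR_ge0.
have cS := @cmeas_shift R d G (logshift n) cG.
have E1 := @iint_linear R d Amx _ (det_Amx_neq0 hI) cS (fun w => G0 _).
have E2 := @iint_shift R d G (logshift n) cG G0.
rewrite E1 E2 /G iint_logsqnorm// -!EFinM; congr (_%:E); rewrite /zeta_cst; ring.
Qed.

Variable S : set L.
Hypothesis hS : orbit_reps sigma I U S.
Local Notation dual0 := (dual sigma I `\ 0%R).

(** Units act freely on nonzero field elements, so each orbit is a copy of [U], which [eps]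
    identifies with integer vectors. *)
Lemma orbit_bij : set_bij (S `*`` (fun=> [set: 'cV[int]_d])) dual0 (fun p => epsm p.2 * p.1).
Proof.
have [SD SP] := hS; split.
- by move=> [t m] [/= /SD dt _]; apply: dual0_unit => //; exact/hU/U_epsm.
- move=> [t m] [t' m'] /set_mem[/= St _] /set_mem[/= St' _] E.
  have [dt t0] := SD _ St.
  have [s _ us] := SP _ (dual0_unit hI (hU (U_epsm m)) (SD _ St)).
  have e1 : t = s by apply: us => //; exists (epsm m) => //; exact: U_epsm.
  have e2 : t' = s by apply: us => //; exists (epsm m') => //; exact: U_epsm.
  move: E; rewrite e1 e2 in t0 *; move/eqP: t0 => t0 /(mulIf t0)/epsm_inj -> //.
- move=> n dn; have [s [Ss [e Ue ->]] _] := SP _ dn.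
  by have [m ->] := epsm_surj Ue; exists (s, m).
Qed.

(** Multiplying [n] by a unit translates the cube by an integer vector, and these translates tile
    the space. The identity is between possibly infinite values, which lets finiteness of the right
    side be deduced from it. *)
Lemma unfolding (chi : L -> R) s : 0 < s -> (forall n, 0 <= chi n) ->
  (forall e n, U e -> dual0 n -> chi (e * n) = chi n) ->
  (iint `[0%R, 1%R] (fun y => \esum_(n in dual0) (chi n * hterm n s y)%:E) =
  (`|\det Amx|^-1 * zeta_cst s)%:E *
    \esum_(n in S) (chi n * (`|NR (embF sigma n)| `^ (s / d.+1%:R))^-1)%:E)%E.
Proof.
move=> s0 chi0 chiU; have [SD SP] := hS.
have cm n : cmeas (fun y => (chi n * hterm n s y)%:E).
  move=> dd Y g mg; rewrite (_ : (fun y => _) = fun y => ((chi n)%:E * (hterm n s (g y))%:E)%E).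
    by apply: measurable_funeM; exact: cmeas_hterm.
  by apply/funext => y; rewrite EFinM.
have g0 n y : (0 <= (chi n * hterm n s y)%:E)%E by rewrite lee_fin mulr_ge0 ?hterm_ge0.
have D0 : 0 <= `|\det Amx|^-1 * zeta_cst s.
  have G0 a : 0 < a -> 0 <= Gamma a by move=> a0; exact/ltW/Gamma_gt0.
  rewrite /zeta_cst !mulr_ge0 ?invr_ge0 ?exprn_ge0 ?G0// ?divr_ge0 ?G0 ?divr_gt0//.
rewrite iint_esum//; [|exact: (injnat_dual0 hdeg hsigma hI)].
rewrite (reindex_esum _ _ _ _ orbit_bij).
rewrite -(@esum_esum _ _ _ S (fun=> setT) (fun t m => iint `[0%R, 1%R] (fun y =>
   (chi (epsm m * t) * hterm (epsm m * t) s y)%:E))); last first.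
  by move=> *; apply: iint_ge0.
rewrite -esumZl//; last 2 first.
- have [f fi] := injnat_dual0 hdeg hsigma hI; exists f => a b /set_mem/SD da /set_mem/SD db.
  by apply: fi; exact/mem_set.
- by move=> n; rewrite lee_fin mulr_ge0 ?invr_ge0 ?powR_ge0.
apply: eq_esum => t St.
transitivity (\esum_(m in [set: 'cV[int]_d]) iint `[0%R, 1%R] (fun y =>
   (chi t * hterm t s (y + intv R m))%:E)).
  apply: eq_esum => m _; apply: eq_iint => y _.
  by rewrite hterm_epsm chiU//; [exact: U_epsm|exact: SD].
rewrite -(iint_tile (f := fun y => (chi t * hterm t s y)%:E))//.
transitivity (iint setT (fun y => ((chi t)%:E * (hterm t s y)%:E)%E)).
  by apply: eq_iint => y _; rewrite EFinM.
have [_ /eqP t0] := SD _ St.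
have ht0 y : (0 <= (hterm t s y)%:E)%E by rewrite lee_fin hterm_ge0.
rewrite (iintZl measurableT (@cmeas_hterm t s) ht0) ?lee_fin//.
by rewrite iint_hterm// muleCA -EFinM.
Qed.

End unit_lattice.

(** * Unfolding the signed sum and passing to the limit *)

Section fundamental_domain.
Variables (R : realType) (L : fieldExtType rat) (d : nat).
Variable sigma : 'I_d.+1 -> {rmorphism L -> R}.
Hypothesis hdeg : \dim {: L} = d.+1.
Hypothesis hsigma : injective sigma.
Variable I : set L.
Hypothesis hI : frac_ideal I.
Variables (nu : 'I_d.+1 -> bool) (x : 'I_d.+1 -> R).
Variable U : set L.
Hypothesis hU : forall e, U e -> tot_pos_unit sigma e.
Hypothesis U1 : U 1.
Hypothesis UM : forall e f, U e -> U f -> U (e * f).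
Hypothesis UV : forall e, U e -> U e^-1.
Hypothesis xU : fixed_by sigma I U x.
Variable eps : 'I_d -> L.
Hypothesis heps : @unit_basis L d.+1 U eps.
Variable S : set L.
Hypothesis hS : orbit_reps sigma I U S.
Variable im : bool.
Local Notation dual0 := (dual sigma I `\ 0%R).
Local Notation hterm := (hterm sigma eps).
Local Notation ur := (ur sigma eps).
Local Notation A := (Amx sigma eps).
Local Notation green := (green sigma I nu x im).

Definition chi (n : L) : R := sgn_nu sigma nu n * expi sigma x im n.
Definition chip (b : bool) (n : L) : R := Num.max ((-1) ^+ b * chi n) 0.

Lemma chip_ge0 b n : 0 <= chip b n. Proof. by rewrite le_max lexx orbT. Qed.

Lemma chip_le1 b n : chip b n <= 1.
Proof.
rewrite ge_max ler01 andbT (le_trans (ler_norm _))// normrM normrX normrN1 expr1n mul1r.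
by rewrite normrM mulr_ile1// ?expi_norm// sgn_nuE Phi_norm.
Qed.

Lemma chip_unit b e n : U e -> dual0 n -> chip b (e * n) = chip b n.
Proof.
move=> Ue [dn _]; have [_ _ _ e0] := hU Ue.
by rewrite /chip /chi (sgn_nu_unit _ _ e0) (expi_unit _ (xU Ue) dn).
Qed.

Lemma abs_sum_chi (T : set L) (g : L -> R) : (forall n, 0 <= g n) ->
  abs_sum T (fun n => chi n * g n) =
  fine (\esum_(n in T) (chip false n * g n)%:E) - fine (\esum_(n in T) (chip true n * g n)%:E).
Proof.
move=> g0; rewrite /abs_sum /chip expr0 expr1.
by congr (fine _ - fine _); apply: eq_esum => n _; rewrite maxr_pMl ?g0// ?mul1r ?mulN1r ?mulNr mul0r.
Qed.

Definition chisum (b : bool) (s : R) (y : 'cV[R]_d) : \bar R :=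
  (\esum_(n in dual0) (chip b n * hterm n s y)%:E)%E.

Lemma chisum_le b s y : (chisum b s y <= \esum_(n in dual0) (hterm n s y)%:E)%E.
Proof.
apply: le_esum => n _; rewrite lee_fin ler_piMl ?hterm_ge0// chip_le1//.
Qed.

Lemma chisum_ge0 b s y : (0 <= chisum b s y)%E.
Proof. by apply: esum_ge0 => n _; rewrite lee_fin mulr_ge0 ?chip_ge0 ?hterm_ge0. Qed.

Lemma chisum_fin b s y : d.+1%:R < s -> chisum b s y \is a fin_num.
Proof.
move=> ds; rewrite ge0_fin_numE ?chisum_ge0// (le_lt_trans (chisum_le b s y))//.
by apply: dual0_summable => // j; exact: ur_gt0.
Qed.

Lemma green_urE s y : green s (ur y) = fine (chisum false s y) - fine (chisum true s y).
Proof. by rewrite -abs_sum_chi// => n; exact: hterm_ge0. Qed.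

Lemma cmeas_chisum b s : cmeas (chisum b s).
Proof.
apply: cmeas_esum; first exact: (injnat_dual0 hdeg hsigma hI).
- move=> n dd Y g mg; rewrite (_ : (fun y => _) = fun y => ((chip b n)%:E * (hterm n s (g y))%:E)%E).
    by apply: measurable_funeM; exact: (cmeas_hterm hdeg hsigma hU heps).
  by apply/funext => y; rewrite EFinM.
- by move=> n y; rewrite lee_fin mulr_ge0 ?chip_ge0 ?hterm_ge0.
Qed.

Lemma cmeas_fine_chisum b s : cmeasR (fun y => fine (chisum b s y)).
Proof.
move=> dd Y g mg; apply/measurable_EFinP.
apply: (measurableT_comp (@fine_measurable R setT measurableT)).
exact: cmeas_chisum.
Qed.

Lemma ur_bounds : exists lo hi : R, [/\ 0 < lo, 0 <= hi &
  forall y, incube y -> forall j, lo <= ur y j <= hi].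
Proof.
pose M : R := \sum_j \sum_k `|ln (sigma j (eps k))|.
exists (expR (- M)), (expR M); split; [exact: expR_gt0|exact: expR_ge0|].
move=> y y01 j; rewrite /ur !ler_expR -ler_norml.
apply: le_trans (ler_norm_sum _ _ _) _.
rewrite /M (bigD1 j)//= ler_wpDr ?sumr_ge0//; first by move=> i _; apply: sumr_ge0.
apply: ler_sum => k _; have /andP[y0 y1] := y01 k.
by rewrite normrM ler_piMl// ger0_norm.
Qed.

(** Comparison with the norm at [u = 1] through the lower bound [lo]. This bound depends on [s] and
    justifies the integrals for a fixed [s] only; the limit uses [green_bounded]. *)
Lemma chisum_bounded b s : d.+1%:R < s ->
  exists C, forall y, incube y -> fine (chisum b s y) <= C.
Proof.
move=> ds; have [lo [hi [lo0 _ uP]]] := ur_bounds.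
have s0 : 0 <= s by apply: le_trans (ltW ds).
pose h1 n : R := (eucl_norm (actR (fun=> 1) (embF sigma n)) `^ s)^-1.
have h1_ge0 n : 0 <= h1 n by rewrite invr_ge0 powR_ge0.
have h1fin : (\esum_(n in dual0) (h1 n)%:E < +oo)%E by apply: dual0_summable.
have h1fin' : (\esum_(n in dual0) (h1 n)%:E)%E \is a fin_num.
  by rewrite ge0_fin_numE// esum_ge0// => n _; rewrite lee_fin.
exists (fine ((lo `^ s)^-1%:E * \esum_(n in dual0) (h1 n)%:E)%E) => y y01.
rewrite fine_le ?chisum_fin ?fin_numM//.
apply: le_trans (chisum_le b s y) _; rewrite -esumZl; last 3 first.
- exact: (injnat_dual0 hdeg hsigma hI).
- by move=> n; rewrite lee_fin.
- by rewrite invr_ge0 powR_ge0.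
apply: le_esum => n [_ /eqP n0]; rewrite -EFinM lee_fin /hterm /h1 -invfM.
have N0 : 0 < eucl_norm (actR (fun=> 1) (embF sigma n)).
  rewrite sqrtr_gt0 (bigD1 ord0)//= ltr_pwDl ?sumr_ge0//.
    by rewrite /actR mul1r exprn_even_gt0//= /embF fmorph_eq0.
  by move=> j _; exact: sqr_ge0.
rewrite -powRM ?(ltW lo0) ?(ltW N0)//.
have le1 : lo * eucl_norm (actR (fun=> 1) (embF sigma n)) <=
    eucl_norm (actR (ur y) (embF sigma n)).
  rewrite -[leLHS]ger0_norm ?mulr_ge0 ?(ltW lo0) ?(ltW N0)// -sqrtr_sqr ler_wsqrtr//.
  rewrite exprMn sqr_sqrtr ?sumr_ge0//; last by move=> j _; exact: sqr_ge0.
  rewrite mulr_sumr; apply: ler_sum => j _; rewrite /actR mul1r exprMn.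
  have /andP[h _] := uP y y01 j.
  by rewrite ler_wpM2r ?sqr_ge0// ler_pXn2r// nnegrE ?(ltW lo0)// (le_trans (ltW lo0)).
rewrite lef_pV2 ?posrE ?powR_gt0 ?mulr_gt0//; last by rewrite (lt_le_trans _ le1)// mulr_gt0.
by apply: ge0_ler_powR; rewrite // nnegrE ?mulr_ge0 ?(ltW lo0) ?(ltW N0)// (le_trans _ le1)// mulr_ge0// ltW.
Qed.

Definition zsum (s : R) : R :=
  abs_sum S (fun n => chi n * (`|NR (embF sigma n)| `^ (s / d.+1%:R))^-1).

Lemma zeta_cst_gt0 (s : R) : 0 < s -> 0 < zeta_cst d s.
Proof.
move=> s0; rewrite /zeta_cst !mulr_gt0 ?invr_gt0 ?exprn_gt0 ?divr_gt0 ?Gamma_gt0 ?divr_gt0//.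
Qed.

Lemma unfolded_green s : d.+1%:R < s ->
  `|\det A| * cint (fun y => green s (ur y)) = zeta_cst d s * zsum s.
Proof.
move=> ds; have s0 : 0 < s by apply: lt_trans ds.
have A0 : 0 < `|\det A|.
  by rewrite normr_gt0 (det_Amx_neq0 hdeg hsigma hU U1 UM UV heps hI).
pose K := `|\det A|^-1 * zeta_cst d s.
have K0 : 0 < K by rewrite mulr_gt0 ?invr_gt0 ?zeta_cst_gt0.
pose X b := (\esum_(n in S) (chip b n * (`|NR (embF sigma n)| `^ (s / d.+1%:R))^-1)%:E)%E.
have X0 b : (0 <= X b)%E.
  by apply: esum_ge0 => n _; rewrite lee_fin mulr_ge0 ?chip_ge0 ?invr_ge0 ?powR_ge0.
have E b : cint (fun y => fine (chisum b s y)) = K * fine (X b).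
  have [C CP] := chisum_bounded b ds.
  have e1 : (cint (fun y => fine (chisum b s y)))%:E = (K%:E * X b)%E.
    rewrite -(iint_cint (cmeas_fine_chisum b s) (C := C))//; last first.
      by move=> y; rewrite fine_ge0 ?chisum_ge0.
    rewrite -(unfolding hdeg hsigma hU U1 UM UV heps hI hS s0 (chip_ge0 b) (chip_unit b)).
    by apply: eq_iint => y _; rewrite fineK ?chisum_fin.
  (* A positive multiple of [X b] equals a finite integral, which proves that the series of norms
     converges. *)
  have Xf : X b \is a fin_num.
    move: e1 (X0 b); case: (X b) => [r'|//|//] //.
    by rewrite gt0_muley ?lte_fin.
  by have := congr1 fine e1; rewrite fineM.
have [C0 CP0] := chisum_bounded false ds; have [C1 CP1] := chisum_bounded true ds.
have -> : cint (fun y => green s (ur y)) =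
    cint (fun y => fine (chisum false s y)) - cint (fun y => fine (chisum true s y)).
  rewrite -(@cintB _ _ _ _ (Num.max C0 C1)).
  - by congr cint; apply/funext => y; rewrite green_urE.
  - exact: cmeas_fine_chisum.
  - exact: cmeas_fine_chisum.
  - by move=> y yc; rewrite ger0_norm ?fine_ge0 ?chisum_ge0// le_max CP0.
  - by move=> y yc; rewrite ger0_norm ?fine_ge0 ?chisum_ge0// le_max CP1 ?orbT.
rewrite !E /zsum abs_sum_chi; last by move=> n; rewrite invr_ge0 powR_ge0.
rewrite -/(X false) -/(X true) -mulrBr /K mulrA mulrA divff ?mul1r//.
by rewrite gt_eqF.
Qed.

Hypothesis hx : torsion sigma I x.
Hypothesis hdeg0 : ~ ((forall j, nu j = false) /\ congr_mod sigma I x (fun=> 0)).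

Lemma cmeas_green s : cmeasR (fun y => green s (ur y)).
Proof.
move=> dd Y g mg; apply/measurable_EFinP.
rewrite (_ : (fun y => _) = fun y => fine (chisum false s (g y)) - fine (chisum true s (g y))).
  by apply: measurable_funB; apply/measurable_EFinP; exact: cmeas_fine_chisum.
by apply/funext => y; rewrite green_urE.
Qed.

Section along_a_sequence.
Variable e_ : nat -> R.
Hypothesis e01 : forall k, 0 < e_ k <= 1.
Hypothesis ecvg : e_ k @[k --> \oo] --> 0.

Let s_gt k : d.+1%:R < d.+1%:R + e_ k.
Proof. by case/andP: (e01 k) => e0 _; rewrite ltrDl. Qed.

Lemma cvg_green_ur y :
  green (d.+1%:R + e_ k) (ur y) @[k --> \oo] --> green_part sigma im I nu x (ur y).
Proof.
have h := cvg_green hdeg hsigma hI hx hdeg0 (im := im) (ur_gt0 sigma eps y).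
have [h' _] := cvg_at_rightP (fun eta => green (d.+1%:R + eta) (ur y)) 0
  (green_part sigma im I nu x (ur y)).
by apply: (h' h e_); split => // k; case/andP: (e01 k).
Qed.

(** The bound [C] is uniform in [eta <= 1] and over the image of the cube, although the separate
    parts [chisum] need not be; the limit function is measurable as a pointwise limit. *)
Lemma cvg_cint_green : cint (fun y => green (d.+1%:R + e_ k) (ur y)) @[k --> \oo] -->
  cint (fun y => green_part sigma im I nu x (ur y)).
Proof.
have [lo [hi [lo0 hi0 uP]]] := ur_bounds.
have [C CP] := green_bounded hdeg hsigma hI hx hdeg0 im lo0 hi0.
apply: (@cvg_cint _ _ _ _ C).
- by move=> k; exact: cmeas_green.
- move=> dd Y g mg; apply/measurable_EFinP.
  apply: (@measurable_fun_cvg _ _ _ _ (fun k y => green (d.+1%:R + e_ k) (ur (g y)))).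
    by move=> k; apply/measurable_EFinP; exact: (@cmeas_green (d.+1%:R + e_ k)).
  by move=> y _; exact: cvg_green_ur.
- move=> k y yc; apply: CP; last exact: uP.
  by rewrite s_gt lerD2l; case/andP: (e01 k).
- by move=> y _; exact: cvg_green_ur.
Qed.

Lemma cvg_zeta_cst : zeta_cst d (d.+1%:R + e_ k) @[k --> \oo] --> zeta_cst d (d.+1%:R : R).
Proof.
have scvg : (d.+1%:R + e_ k @[k --> \oo] --> (d.+1%:R : R)).
  by rewrite -[X in _ --> X]addr0; apply: cvgD => //; exact: cvg_cst.
have d0 : 0 < d.+1%:R :> R by [].
have d1 : 1 <= d.+1%:R :> R by rewrite ler1n.
have g1 : Gamma ((d.+1%:R + e_ k) / d.+1%:R / 2) @[k --> \oo] --> Gamma (d.+1%:R / d.+1%:R / 2 : R).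
  apply: cvg_Gamma; first by rewrite !divr_gt0.
    move=> k; have /andP[e0 e1] := e01 k.
    rewrite mulrDl mulrDl lerDl !divr_ge0 ?(ltW e0)//= lerD2l.
    rewrite ler_pdivrMr// mul1r ler_pdivrMr//; nra.
  by do 2 apply: cvgMr_tmp.
have g2 : Gamma ((d.+1%:R + e_ k) / 2) @[k --> \oo] --> Gamma (d.+1%:R / 2 : R).
  apply: cvg_Gamma; first by rewrite divr_gt0.
    move=> k; have /andP[e0 e1] := e01 k.
    rewrite mulrDl lerDl divr_ge0 ?(ltW e0)//= lerD2l ler_pdivrMr//; lra.
  by apply: cvgMr_tmp.
rewrite /zeta_cst; apply: cvgM; last first.
  by apply: cvgV => //; rewrite gt_eqF// Gamma_gt0// divr_gt0.
apply: cvgMl_tmp.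
have gX n : (Gamma ((d.+1%:R + e_ k) / d.+1%:R / 2) / 2) ^+ n @[k --> \oo] -->
    (Gamma (d.+1%:R / d.+1%:R / 2 : R) / 2) ^+ n.
  elim: n => [|n IH]; first by under eq_fun do rewrite expr0; rewrite expr0; exact: cvg_cst.
  under eq_fun do rewrite exprS; rewrite exprS; apply: cvgM => //.
  exact: cvgMr_tmp.
exact: gX.
Qed.

Lemma cvg_zsum : zsum (d.+1%:R + e_ k) @[k --> \oo] -->
  `|\det A| * cint (fun y => green_part sigma im I nu x (ur y)) / zeta_cst d (d.+1%:R : R).
Proof.
have c0 : 0 < zeta_cst d (d.+1%:R : R) by exact: zeta_cst_gt0.
rewrite (_ : (fun k => zsum _) = fun k => `|\det A| *
    cint (fun y => green (d.+1%:R + e_ k) (ur y)) / zeta_cst d (d.+1%:R + e_ k)); last first.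
  apply/funext => k; rewrite unfolded_green// mulrC mulKf// gt_eqF// zeta_cst_gt0//.
  exact: lt_trans (s_gt k).
apply: cvgM; first exact: cvgMl_tmp cvg_cint_green.
by apply: cvgV cvg_zeta_cst; rewrite gt_eqF.
Qed.

End along_a_sequence.

Lemma zeta_cstE : zeta_cst d (d.+1%:R : R) =
  2 `^ (1 - d.+1%:R) * Gamma (1 / 2) ^+ d.+1 / (d.+1%:R * Gamma (d.+1%:R / 2)).
Proof.
rewrite /zeta_cst divff ?pnatr_eq0// expr_div_n.
have -> : 2 `^ (1 - d.+1%:R) = 2 / 2 ^+ d.+1 :> R.
  by rewrite powRD ?powRr1// ?powRN ?powR_mulrn// pnatr_eq0 implybT.
have g0 : Gamma (d.+1%:R / 2) != 0 :> R by rewrite gt_eqF// Gamma_gt0// divr_gt0.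
set g := Gamma (1 / 2) ^+ _; set g' := Gamma _ in g0 *; set t := 2 ^+ d.+1.
have t0 : t != 0 by rewrite expf_neq0// pnatr_eq0.
by field; rewrite t0 g0 addrC natr1 pnatr_eq0.
Qed.

Lemma quot_integral_green :
  @quot_integral R L d.+1 sigma eps (green_part sigma im I nu x) =
  (2 `^ (1 - d.+1%:R) * Gamma (1 / 2) ^+ d.+1 / (d.+1%:R * Gamma (d.+1%:R / 2))) *
  zeta_part sigma im S nu x.
Proof.
have zcvg := @cvg_at_right0 R (fun e => zsum (d.+1%:R + e)) _ cvg_zsum.
have zE : zeta_part sigma im S nu x = lim (zsum (d.+1%:R + e) @[e --> 0^'+]) by [].
rewrite zE (cvg_lim _ zcvg)// -zeta_cstE mulrC divfK ?gt_eqF ?zeta_cst_gt0//.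
have uE y : @UR_point R L d.+1 sigma eps (seqv y) = ur y.
  by apply/funext => j; exact: (UR_pointE hU heps).
have fE : (fun y : 'cV[R]_d => green_part sigma im I nu x (@UR_point R L d.+1 sigma eps (seqv y))) =
    (fun y => green_part sigma im I nu x (ur y)).
  by apply/funext => y; exact: (congr1 (green_part sigma im I nu x) (uE y)).
rewrite /quot_integral cube_integralE regulatorE.
exact: (congr1 (fun f : 'cV[R]_d -> R => `|\det A| * cint f) fE).
Qed.

End fundamental_domain.

Theorem mainTheorem3 (R : realType) (L : fieldExtType rat) (r : nat)
    (sigma : 'I_r -> {rmorphism L -> R})
    (hdeg : \dim {: L} = r)
    (hsigma : injective sigma)
    (I : set L) (hI : frac_ideal I)
    (nu : 'I_r -> bool)
    (x : 'I_r -> R) (hx : torsion sigma I x)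
    (hdeg0 : ~ ((forall j, nu j = false) /\ congr_mod sigma I x (fun=> 0))) :
  (exists U : set L, fin_index_subgroup sigma U /\ fixed_by sigma I U x) /\
  (forall U : set L, fin_index_subgroup sigma U -> fixed_by sigma I U x ->
    (forall e u, U e -> inUR u -> forall im : bool,
        green_part sigma im I nu x (actF sigma e u) = green_part sigma im I nu x u) /\
    (forall (eps : 'I_r.-1 -> L) (S : set L),
        unit_basis U eps -> orbit_reps sigma I U S ->
        forall im : bool,
        quot_integral sigma eps (green_part sigma im I nu x) =
        (2 `^ (1 - r%:R) * Gamma (1 / 2) ^+ r / (r%:R * Gamma (r%:R / 2))) *
        zeta_part sigma im S nu x)).
Proof.
(* A field has positive degree, so [r.-1] becomes the dimension [d] of the logarithmic space. *)
destruct r as [|d]; first by have := degree_gt0 hdeg.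
split; first exact: (exists_stabilizer hdeg hsigma hI hx).
move=> U [hU U1 UM UV _] xU; split.
  by move=> e u Ue _ im; apply: green_part_unit => //; [exact: hU|exact: xU].
move=> eps S heps hS im.
exact: (quot_integral_green hdeg hsigma hI hU U1 UM UV xU heps hS im hx hdeg0).
Qed.
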